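(* Let $\rho:\mathbb R^n\times A\to\mathbb R_+$ be a continuous function. Assume (CV), (LACL) for $l+\rho$, and either (SC1) or (SC2) for $l$ replaced by $l+\rho$. Then for any $\varepsilon\in\,]0,1]$ there exists a unique nonnegative solution $W_\varepsilon$ to (BVP$\mathcal K_\varepsilon$). Moreover, as $\varepsilon\to0^+$ the $W_\varepsilon$ converge to a function $W$ such that $\mathcal V\equiv-\log(1-W)$ and $Dom(\mathcal V)=\{x: W(x)<1\}$. If $W$ is continuous in $\mathbb R^n\setminus\overset{\circ}{\mathcal T}$, then the convergence is locally uniform. If (CV) is not satisfied (all the other hypotheses being kept), then for any $\varepsilon\in\,]0,1]$ the function $W_\varepsilon$ is the unique (nonnegative) solution to (BVP$\mathcal K_\varepsilon$) just among the continuous functions.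
   Context: Standing setting. $A\subset\mathbb R^m$ is compact; the target $\mathcal T\subset\mathbb R^n$ is closed with compact boundary; $\mathcal T^c=\mathbb R^n\setminus\mathcal T$, $\overset{\circ}{\mathcal T}$ is the interior of $\mathcal T$, $\mathbf d(x)=\mathrm{dist}(x,\mathcal T)$, $\mathbb R_+=[0,+\infty[$. The functions $f:\mathbb R^n\times A\to\mathbb R^n$ and $l:\mathbb R^n\times A\to\mathbb R_+$ are continuous; there is $M>0$ with $|f(x,a)|\le M(1+|x|)$ for all $(x,a)$, and for every $R>0$ there is $L_R>0$ with $|f(x_1,a)-f(x_2,a)|\le L_R|x_1-x_2|$ and $|l(x_1,a)-l(x_2,a)|\le L_R|x_1-x_2|$ whenever $|x_1|,|x_2|\le R$, $a\in A$. $\mathcal A$ is the set of measurable controls $\alpha:\mathbb R_+\to A$, and $y_x(\cdot,\alpha)$ is the solution on $\mathbb R_+$ of $\dot y(t)=f(y(t),\alpha(t))$, $y(0)=x$. Put $t_x(\alpha)=\inf\{t\ge0: y_x(t,\alpha)\in\mathcal T\}\le+\infty$, $\mathcal J(t,x,\alpha)=\int_0^t l(y_x(s,\alpha),\alpha(s))\,ds$, and $\mathcal A(x)=\{\alpha\in\mathcal A:\ \liminf_{t\to t_x(\alpha)^-}\mathbf d(y_x(t,\alpha))=0\}$. For $x\in\mathcal T^c$, $\mathcal V(x)=\inf_{\alpha\in\mathcal A(x)}\mathcal J(t_x(\alpha),x,\alpha)$ (with $\inf\emptyset=+\infty$); $\mathcal V=0$ on $\mathcal T$. $Dom(\mathcal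 V)=\{x\in\mathbb R^n\setminus\overset{\circ}{\mathcal T}:\mathcal V(x)<+\infty\}$. Hypotheses. (CV): for each $x\in\mathbb R^n$ the set $\{(\mu,\gamma)\in\mathbb R^{n+1}:\exists a\in A,\ \mu=f(x,a),\ l(x,a)\le\gamma\}$ is convex. (LACL) for a continuous $h:\mathbb R^n\times A\to\mathbb R_+$: there exists a local Minimum Restraint Function for $h$, i.e. an open set $\Omega\supset\mathcal T$ and $U:\Omega\setminus\overset{\circ}{\mathcal T}\to\mathbb R_+$ continuous on $\Omega\setminus\overset{\circ}{\mathcal T}$, locally semiconcave, positive definite and proper on $\Omega\setminus\mathcal T$, such that for some $U_0\in\,]0,+\infty]$ one has $\lim_{x\to x_0,x\in\Omega}U(x)=U_0$ for all $x_0\in\partial\Omega$ and $U(x)<U_0$ for all $x\in\Omega\setminus\overset{\circ}{\mathcal T}$, and such that for some $k>0$, for every $x\in\Omega\setminus\mathcal T$, $\min_{a\in A}\{\langle p,f(x,a)\rangle+k\,h(x,a)\}<0$ for all $p\in D^*U(x)$. Here $D^*U(x)$ is the set of limits $p=\lim_k\nabla U(x_k)$ with $x_k\to x$, $x_k\ne x$ points of differentiability of $U$. (SC1): there exist $U:\mathbb R^n\setminus\overset{\circ}{\mathcal T}\to\mathbb R_+$ of class $C^1$, positive definite and proper on $\mathcal T^c$, and a continuous increasing $m:\,]0,+\infty[\,\to\,]0,+\infty[$ such that $\sup_{a\in A}\langle\nabla U(x),f(x,a)\rangle\le-m(\mathbf d(x))$ for all $x\in\mathcal T^c$. (SC2)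 for $l$ replaced by $l+\rho$: there is a continuous increasing $c_2:\,]0,+\infty[\,\to\,]0,+\infty[$ with $l(x,a)+\rho(x,a)\ge c_2(\mathbf d(x))$ for all $(x,a)\in\mathcal T^c\times A$. $U$ is positive definite on $\Omega\setminus\mathcal T$ if $U>0$ on $\Omega\setminus\mathcal T$ and $U=0$ on $\partial\mathcal T$; $U$ is proper if $U^{-1}(K)$ is compact for every compact $K\subset\mathbb R_+$ (for $\mathcal T^c$ take $\Omega=\mathbb R^n$). (BVP$\mathcal K_\varepsilon$). Let $\mathcal K_\varepsilon(x,u,p)=\sup_{a\in A}\{-\langle p,f(x,a)\rangle-(l+\varepsilon\rho)(x,a)+(l+\varepsilon\rho)(x,a)\,u\}$, the Hamiltonian associated to Kruzkov transforms $W=1-e^{-u}$ of functions $u$ with values in $\mathbb R\cup\{+\infty\}$ (value $1$ where $u=+\infty$; $-\log0=+\infty$). The problem is $\mathcal K_\varepsilon(x,W(x),DW(x))=0$ in $\mathbb R^n\setminus\mathcal T$, $W=0$ on $\partial\mathcal T$. A solution is a locally bounded $W:\mathbb R^n\setminus\overset{\circ}{\mathcal T}\to\,]-\infty,1]$ whose lower semicontinuous envelope $W_*$ satisfies $W_*\ge0$ on $\partial\mathcal T$ and is a viscosity supersolution of $\mathcal K_\varepsilon=0$ in $\mathbb R^n\setminus\mathcal T$, and whose upper semicontinuous envelope $W^*$ satisfies $W^*\le0$ on $\partial\mathcal T$ and is a viscosity subsolution of $\mathcal K_\varepsilon=0$ in $\mathbb R^n\setminus\mathcal T$. *)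

(* Defs.v *)
From mathcomp Require Import all_boot all_order all_algebra.
From mathcomp Require Import all_classical all_reals all_analysis.
Import Order.TTheory GRing.Theory Num.Theory.
Import numFieldNormedType.Exports.

Set Implicit Arguments.
Unset Strict Implicit.
Unset Printing Implicit Defensive.

Local Open Scope classical_set_scope.
Local Open Scope ring_scope.

(* Functions on a subset of R^n are total functions on 'rV[R]_n whose values
   off the subset are never used. The library norm on 'rV[R]_n is the sup norm
   (same topology), hence the separate Euclidean norm and distance. *)

Definition dotp (R : realType) (n : nat) (u v : 'rV[R]_n) : R :=
  \sum_i u 0 i * v 0 i.

Definition enorm (R : realType) (n : nat) (u : 'rV[R]_n) : R :=
  Num.sqrt (dotp u u).

Definition dist (R : realType) (n : nat) (T : set 'rV[R]_n) (x : 'rV[R]_n) : R :=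
  inf [set enorm (x - z) | z in T].

Definition bdry (R : realType) (n : nat) (T : set 'rV[R]_n) : set 'rV[R]_n :=
  closure T `\` interior T.

Definition grad (R : realType) (n : nat) (U : 'rV[R]_n -> R) (x : 'rV[R]_n) :
    'rV[R]_n :=
  \row_i 'D_(delta_mx 0 i) U x.

Definition C1_on (R : realType) (n : nat) (D : set 'rV[R]_n)
    (U : 'rV[R]_n -> R) : Prop :=
  (forall x, D x -> differentiable U x) /\ {within D, continuous (grad U)}.

(* Borel measurability on [0, +oo[; a Lebesgue measurable control agrees almost
   everywhere with a Borel one, which has the same trajectories and costs. *)
Definition control (R : realType) (m : nat) (A : set 'rV[R]_m)
    (alpha : R -> 'rV[R]_m) : Prop :=
  (forall t, 0 <= t -> A (alpha t)) /\
  (forall O : set 'rV[R]_m, open O ->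
     measurable (`[0, +oo[%classic `&` alpha @^-1` O : set (measurableTypeR R))).

(* Caratheodory solution of y' = f(y, alpha), y(0) = x, in integral form. *)
Definition trajectory (R : realType) (n m : nat)
    (f : 'rV[R]_n -> 'rV[R]_m -> 'rV[R]_n) (x : 'rV[R]_n)
    (alpha : R -> 'rV[R]_m) (y : R -> 'rV[R]_n) : Prop :=
  {within `[0, +oo[, continuous y} /\
  (forall t, 0 <= t -> forall i : 'I_n,
     y t 0 i = x 0 i + \int[lebesgue_measure]_(s in `[0, t]) f (y s) (alpha s) 0 i).

Definition exit_time (R : realType) (n : nat) (T : set 'rV[R]_n)
    (y : R -> 'rV[R]_n) : \bar R :=
  ereal_inf [set t%:E | t in [set t | 0 <= t /\ T (y t)]].

Definition cost (R : realType) (n m : nat) (l : 'rV[R]_n -> 'rV[R]_m -> R)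
    (t : \bar R) (alpha : R -> 'rV[R]_m) (y : R -> 'rV[R]_n) : \bar R :=
  (\int[lebesgue_measure]_(s in [set s : R | (0 <= s)%R /\ s%:E < t])
     (l (y s) (alpha s))%:E)%E.

(* The filter s -> t^-; the value at -oo plays no role, as exit times are >= 0. *)
Definition left_nbhs (R : realType) (t : \bar R) : set_system R :=
  if t is r%:E then at_left r else pinfty_nbhs R.

Definition approaches (R : realType) (n : nat) (T : set 'rV[R]_n)
    (y : R -> 'rV[R]_n) : Prop :=
  limf_einf (fun s => (dist T (y s))%:E) (left_nbhs (exit_time T y)) = 0%E.

(* For the f considered here the trajectory y of (x, alpha) is unique. *)
Definition value (R : realType) (n m : nat)
    (f : 'rV[R]_n -> 'rV[R]_m -> 'rV[R]_n) (l : 'rV[R]_n -> 'rV[R]_m -> R)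
    (A : set 'rV[R]_m) (T : set 'rV[R]_n) (x : 'rV[R]_n) : \bar R :=
  if x \in T then 0%E else
  ereal_inf [set c | exists alpha y,
    [/\ control A alpha, trajectory f x alpha y, approaches T y
      & c = cost l (exit_time T y) alpha y]].

Definition Dom (R : realType) (n : nat) (T : set 'rV[R]_n)
    (V : 'rV[R]_n -> \bar R) : set 'rV[R]_n :=
  [set x | ~ interior T x /\ (V x < +oo)%E].

Definition CV (R : realType) (n m : nat)
    (f : 'rV[R]_n -> 'rV[R]_m -> 'rV[R]_n) (l : 'rV[R]_n -> 'rV[R]_m -> R)
    (A : set 'rV[R]_m) : Prop :=
  forall x, @convex_set R ('rV[R]_n * R^o)%type
    [set q | exists2 a, A a & q.1 = f x a /\ l x a <= q.2].

(* The clauses D x1 and D x2 say that the ball lies in D. *)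
Definition semiconcave_locally (R : realType) (n : nat) (D : set 'rV[R]_n)
    (U : 'rV[R]_n -> R) : Prop :=
  forall z, D z -> exists r c : R, 0 < r /\
    forall x1 x2, enorm (x1 - z) < r -> enorm (x2 - z) < r ->
      D x1 /\ D x2 /\
      U x1 + U x2 - 2 * U (2^-1 *: (x1 + x2)) <= c * enorm (x1 - x2) ^+ 2.

Definition positive_definite (R : realType) (n : nat) (Omega T : set 'rV[R]_n)
    (U : 'rV[R]_n -> R) : Prop :=
  (forall x, Omega x -> ~ T x -> 0 < U x) /\ (forall x, bdry T x -> U x = 0).

Definition proper (R : realType) (n : nat) (Omega T : set 'rV[R]_n)
    (U : 'rV[R]_n -> R) : Prop :=
  forall K : set R, compact K -> K `<=` [set r | 0 <= r] ->
    compact ((Omega `\` interior T) `&` U @^-1` K).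

Definition limiting_gradient (R : realType) (n : nat) (U : 'rV[R]_n -> R)
    (x : 'rV[R]_n) : set 'rV[R]_n :=
  [set p | exists u : nat -> 'rV[R]_n,
    [/\ forall k, u k <> x /\ differentiable U (u k),
        u @ \oo --> x & grad U (u k) @[k --> \oo] --> p]].

(* A is compact, so the ereal_inf below is a minimum. *)
Definition local_MRF (R : realType) (n m : nat)
    (f : 'rV[R]_n -> 'rV[R]_m -> 'rV[R]_n) (h : 'rV[R]_n -> 'rV[R]_m -> R)
    (A : set 'rV[R]_m) (T Omega : set 'rV[R]_n) (U : 'rV[R]_n -> R) : Prop :=
  [/\ (forall x, (Omega `\` interior T) x -> 0 <= U x) /\
      {within Omega `\` interior T, continuous U},
      semiconcave_locally (Omega `\` T) U,
      positive_definite Omega T U /\ proper Omega T U,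
      exists U0 : \bar R, [/\ (0 < U0)%E,
        forall x0, bdry Omega x0 ->
          (U x)%:E @[x --> within Omega (nbhs x0)] --> U0
        & forall x, (Omega `\` interior T) x -> ((U x)%:E < U0)%E]
    & exists2 k : R, 0 < k &
        forall x, (Omega `\` T) x -> forall p, limiting_gradient U x p ->
          (ereal_inf [set (dotp p (f x a) + k * h x a)%:E | a in A] < 0)%E].

Definition LACL (R : realType) (n m : nat)
    (f : 'rV[R]_n -> 'rV[R]_m -> 'rV[R]_n) (h : 'rV[R]_n -> 'rV[R]_m -> R)
    (A : set 'rV[R]_m) (T : set 'rV[R]_n) : Prop :=
  exists Omega U, [/\ open Omega, T `<=` Omega & local_MRF f h A T Omega U].

Definition increasing_modulus (R : realType) (c : R -> R) : Prop :=
  [/\ {within `]0, +oo[, continuous c},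
      {in `]0, +oo[ &, {homo c : r s / r < s}}
    & forall r, 0 < r -> 0 < c r].

(* C^1 on the open set ~` T and merely continuous up to the boundary of T. *)
Definition SC1 (R : realType) (n m : nat)
    (f : 'rV[R]_n -> 'rV[R]_m -> 'rV[R]_n)
    (A : set 'rV[R]_m) (T : set 'rV[R]_n) : Prop :=
  exists U : 'rV[R]_n -> R, exists2 c : R -> R, increasing_modulus c &
    [/\ (forall x, ~ interior T x -> 0 <= U x) /\
        {within ~` interior T, continuous U}, C1_on (~` T) U,
        positive_definite setT T U, proper setT T U
      & forall x, ~ T x ->
          (ereal_sup [set (dotp (grad U x) (f x a))%:E | a in A]
             <= (- c (dist T x))%:E)%E].

Definition SC2 (R : realType) (n m : nat) (h : 'rV[R]_n -> 'rV[R]_m -> R)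
    (A : set 'rV[R]_m) (T : set 'rV[R]_n) : Prop :=
  exists2 c : R -> R, increasing_modulus c &
    forall x a, ~ T x -> A a -> c (dist T x) <= h x a.

Definition hamiltonian (R : realType) (n m : nat)
    (f : 'rV[R]_n -> 'rV[R]_m -> 'rV[R]_n) (h : 'rV[R]_n -> 'rV[R]_m -> R)
    (A : set 'rV[R]_m) (x : 'rV[R]_n) (u : R) (p : 'rV[R]_n) : \bar R :=
  ereal_sup [set (- dotp p (f x a) - h x a + h x a * u)%:E | a in A].

(* Envelopes relative to D; the filter within D (nbhs x) does not exclude x.
   Taking fine is harmless for functions that are locally bounded on D. *)
Definition lsc_env (R : realType) (n : nat) (D : set 'rV[R]_n)
    (W : 'rV[R]_n -> R) (x : 'rV[R]_n) : R :=
  fine (limf_einf (EFin \o W) (within D (nbhs x))).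

Definition usc_env (R : realType) (n : nat) (D : set 'rV[R]_n)
    (W : 'rV[R]_n -> R) (x : 'rV[R]_n) : R :=
  fine (limf_esup (EFin \o W) (within D (nbhs x))).

Definition viscosity_supersolution (R : realType) (n : nat)
    (H : 'rV[R]_n -> R -> 'rV[R]_n -> \bar R) (O : set 'rV[R]_n)
    (u : 'rV[R]_n -> R) : Prop :=
  forall (phi : 'rV[R]_n -> R) x, C1_on O phi -> O x ->
    (\forall y \near x, u x - phi x <= u y - phi y) ->
    (0 <= H x (u x) (grad phi x))%E.

Definition viscosity_subsolution (R : realType) (n : nat)
    (H : 'rV[R]_n -> R -> 'rV[R]_n -> \bar R) (O : set 'rV[R]_n)
    (u : 'rV[R]_n -> R) : Prop :=
  forall (phi : 'rV[R]_n -> R) x, C1_on O phi -> O x ->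
    (\forall y \near x, u y - phi y <= u x - phi x) ->
    (H x (u x) (grad phi x) <= 0)%E.

(* W is considered on the complement of the interior of T only. *)
Definition BVP_solution (R : realType) (n m : nat)
    (f : 'rV[R]_n -> 'rV[R]_m -> 'rV[R]_n) (h : 'rV[R]_n -> 'rV[R]_m -> R)
    (A : set 'rV[R]_m) (T : set 'rV[R]_n) (W : 'rV[R]_n -> R) : Prop :=
  let D := ~` interior T in
  [/\ forall x, D x -> W x <= 1,
      forall x, D x -> bounded_near W (within D (nbhs x)),
      (forall x, bdry T x -> 0 <= lsc_env D W x) /\
      viscosity_supersolution (hamiltonian f h A) (~` T) (lsc_env D W)
    & (forall x, bdry T x -> usc_env D W x <= 0) /\
      viscosity_subsolution (hamiltonian f h A) (~` T) (usc_env D W)].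

Definition nonneg_solution (R : realType) (n m : nat)
    (f : 'rV[R]_n -> 'rV[R]_m -> 'rV[R]_n) (h : 'rV[R]_n -> 'rV[R]_m -> R)
    (A : set 'rV[R]_m) (T : set 'rV[R]_n) (W : 'rV[R]_n -> R) : Prop :=
  BVP_solution f h A T W /\ (forall x, ~ interior T x -> 0 <= W x).

(* Main.v *)
From HB Require Import structures.
Require Import Defs.
From mathcomp Require Import all_boot all_order all_algebra.
From mathcomp Require Import all_classical all_reals all_analysis.
From mathcomp Require Import measurable_realfun.
From mathcomp Require Import ring lra.
Import Order.TTheory GRing.Theory Num.Theory.
Import numFieldNormedType.Exports.

Set Implicit Arguments.
Unset Strict Implicit.
Unset Printing Implicit Defensive.

Local Open Scope classical_set_scope.
Local Open Scope ring_scope.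

(* Put h_e = l + e rho.  Doubling variables with the extra penalty theta * g, where
   g = U under (SC1) and g = ln(1 + |x|^2) under (SC2), gives a comparison principle
   for the Hamiltonian with running cost h_e.  A Minimum Restraint Function U for
   l + rho provides the supersolution min(1, U / k), which vanishes on the boundary
   of T and does not depend on e: by semiconcavity U is differentiable wherever a
   C^1 function touches it from below, and its gradient there is a limiting one.
   Perron's method below this barrier gives a continuous solution W_e, unique by
   comparison and nondecreasing in e; let W be the limit as e -> 0.
   A regularisation of 1 - W_e by sup-convolution is monotone along trajectories:
   (1 - W_e(y_t)) exp(- int_0^t h_e) <= 1 - W_e(x).  Letting y_t approach T, where the
   W_e are uniformly small, and then e -> 0 yields exp(- J) <= 1 - W(x) for every
   admissible control.  Conversely, the inf-convolution of W_e yields piecewise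
   constant controls along which (1 - W_e(y_t)) exp(- int_0^t h_e) loses arbitrarily
   little and which reach any neighbourhood of T because theta * g - int h_e decreases
   at a definite rate; concatenating infinitely many of them gives a control in A(x)
   of cost at most - ln(1 - W_e(x)) + delta. *)

(** * Euclidean norm *)

(** With v = 1 - W the Hamiltonian is the supremum over a of <Dv, f> - h v, linear in v. A
    subsolution thus says that v exp(- int h) does not increase along any trajectory, a
    supersolution that along a suitable one it hardly decreases. The running cost may vanish, so the
    zeroth order term gives no strict monotonicity in W: the strict inequality in the comparison has
    to come from theta * g. The same g bounds the duration of a stage, which would otherwise be free
    to wander far from T at little cost. W_e is merely continuous, hence the convolutions. They
    range over a compact set of points away from T, with a penalty N so large that the extremal
    point stays in its interior, where the viscosity test applies. The integral of rho up to the
    exit time may be infinite. In the lower bound for the cost a time t close to the exit is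
    therefore fixed first and e afterwards; this requires a bound near T that does not depend on e,
    which the barrier min(1, U / k) gives. *)

Section Euclid.
Context {R : realType} {n : nat}.
Implicit Types (u v w x y z p q : 'rV[R]_n) (a b r : R).

Lemma dotpC u v : dotp u v = dotp v u.
Proof. by apply: eq_bigr => i _; rewrite mulrC. Qed.

Lemma dotpDl u v w : dotp (u + v) w = dotp u w + dotp v w.
Proof. by rewrite -big_split; apply: eq_bigr => i _; rewrite mxE mulrDl. Qed.

Lemma dotpDr u v w : dotp w (u + v) = dotp w u + dotp w v.
Proof. by rewrite dotpC dotpDl !(dotpC w). Qed.

Lemma dotpZl a u v : dotp (a *: u) v = a * dotp u v.
Proof. by rewrite mulr_sumr; apply: eq_bigr => i _; rewrite mxE mulrA. Qed.

Lemma dotpZr a u v : dotp v (a *: u) = a * dotp v u.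
Proof. by rewrite dotpC dotpZl dotpC. Qed.

Lemma dotpNl u v : dotp (- u) v = - dotp u v.
Proof. by rewrite -scaleN1r dotpZl mulN1r. Qed.

Lemma dotpNr u v : dotp v (- u) = - dotp v u.
Proof. by rewrite dotpC dotpNl dotpC. Qed.

Lemma dotpBl u v w : dotp (u - v) w = dotp u w - dotp v w.
Proof. by rewrite dotpDl dotpNl. Qed.

Lemma dotpBr u v w : dotp w (u - v) = dotp w u - dotp w v.
Proof. by rewrite dotpDr dotpNr. Qed.

Lemma dotp0l v : dotp 0 v = 0.
Proof. by rewrite -(scale0r 0) dotpZl mul0r. Qed.

Lemma dotp0r v : dotp v 0 = 0.
Proof. by rewrite dotpC dotp0l. Qed.

Lemma dotp_ge0 u : 0 <= dotp u u.
Proof. by apply: sumr_ge0 => i _; rewrite -expr2 sqr_ge0. Qed.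

Lemma dotp_delta u i : dotp u (delta_mx 0 i) = u 0 i.
Proof.
rewrite /dotp (bigD1 i) //= mxE !eqxx mulr1 big1 ?addr0 // => j ji.
by rewrite mxE (negbTE ji) mulr0.
Qed.

Lemma enorm_ge0 u : 0 <= enorm u. Proof. exact: sqrtr_ge0. Qed.

Lemma sqr_enorm u : enorm u ^+ 2 = dotp u u.
Proof. by rewrite sqr_sqrtr // dotp_ge0. Qed.

Lemma enorm0 : enorm (0 : 'rV[R]_n) = 0.
Proof. by rewrite /enorm dotp0l sqrtr0. Qed.

Lemma enormZ a u : enorm (a *: u) = `|a| * enorm u.
Proof.
by rewrite /enorm dotpZl dotpZr mulrA -expr2 sqrtrM ?sqr_ge0 // sqrtr_sqr.
Qed.

Lemma enormN u : enorm (- u) = enorm u.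
Proof. by rewrite -scaleN1r enormZ normrN1 mul1r. Qed.

Lemma enormB u v : enorm (u - v) = enorm (v - u).
Proof. by rewrite -opprB enormN. Qed.

Lemma cauchy_schwarz u v : `|dotp u v| <= enorm u * enorm v.
Proof.
rewrite -(ler_pXn2r (ltn0Sn 1)) ?nnegrE ?mulr_ge0 ?enorm_ge0 //.
rewrite exprMn !sqr_enorm -normrX ger0_norm ?sqr_ge0 //.
have [u0|u0] := eqVneq (dotp u u) 0.
  have uz : u = 0.
    apply/rowP => i; rewrite mxE; apply/eqP; rewrite -sqrf_eq0 expr2.
    have /eqP := u0; rewrite psumr_eq0; last by move=> j _; rewrite -expr2 sqr_ge0.
    by move=> /allP /(_ i) /=; rewrite mem_index_enum; apply.
  by rewrite uz !dotp0l expr0n mul0r.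
have up : 0 < dotp u u by rewrite lt_def u0 dotp_ge0.
have := dotp_ge0 (dotp u u *: v - dotp u v *: u).
rewrite !dotpBl !dotpBr !dotpZl !dotpZr (dotpC v u) => h.
rewrite -subr_ge0 -(pmulr_rge0 _ up); apply: le_trans h _.
rewrite le_eqVlt; apply/orP; left; apply/eqP; ring.
Qed.

Lemma dotp_le u v : dotp u v <= enorm u * enorm v.
Proof. exact: le_trans (ler_norm _) (cauchy_schwarz u v). Qed.

Lemma dotp_ge u v : - (enorm u * enorm v) <= dotp u v.
Proof. by have := cauchy_schwarz u v; rewrite ler_norml => /andP[]. Qed.

Lemma enormD u v : enorm (u + v) <= enorm u + enorm v.
Proof.
rewrite -(ler_pXn2r (ltn0Sn 1)) ?nnegrE ?addr_ge0 ?enorm_ge0 //.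
rewrite sqrrD !sqr_enorm dotpDl !dotpDr (dotpC v u).
have := dotp_le u v; lra.
Qed.

Lemma enorm_sub_le u v w : enorm (u - w) <= enorm (u - v) + enorm (v - w).
Proof. by rewrite -{1}(subrK v u) -addrA enormD. Qed.

Lemma enorm_sub_ge u v : enorm u - enorm v <= enorm (u - v).
Proof. by rewrite lerBlDr -{1}(subrK v u) enormD. Qed.

Lemma enorm_le_dist u v : enorm u <= enorm v + enorm (u - v).
Proof. by have := enorm_sub_ge u v; lra. Qed.

Lemma enorm_eq0 u : enorm u = 0 -> u = 0.
Proof.
move=> u0; have uu : dotp u u = 0 by rewrite -sqr_enorm u0 expr0n.
apply/rowP => i; rewrite mxE; apply/eqP; rewrite -sqrf_eq0 expr2.
move/eqP : uu; rewrite psumr_eq0; last by move=> j _; rewrite -expr2 sqr_ge0.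
by move=> /allP /(_ i) /=; rewrite mem_index_enum; apply.
Qed.

Lemma enorm_gt0 u : u != 0 -> 0 < enorm u.
Proof.
by move=> u0; rewrite lt_def enorm_ge0 andbT; apply: contra u0 => /eqP/enorm_eq0->.
Qed.

Lemma coord_le_enorm u i : `|u 0 i| <= enorm u.
Proof.
rewrite -sqrtr_sqr ler_sqrt ?dotp_ge0 // /dotp (bigD1 i) //= -expr2 lerDl.
by apply: sumr_ge0 => j _; rewrite -expr2 sqr_ge0.
Qed.

Lemma enorm_delta i : enorm (delta_mx 0 i : 'rV[R]_n) = 1.
Proof. by rewrite /enorm dotp_delta mxE !eqxx sqrtr1. Qed.

Lemma enorm_le_sum u : enorm u <= \sum_i `|u 0 i|.
Proof.
rewrite {1}[u]row_sum_delta; elim/big_rec2 : _ => [|i x y _ yx].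
  by rewrite enorm0.
apply: le_trans (enormD _ _) _; apply: lerD => //.
by rewrite enormZ enorm_delta mulr1.
Qed.

Lemma coord_le_norm u i : `|u 0 i| <= `|u|.
Proof.
rewrite [leRHS]/Num.norm /= mx_normrE.
exact: (le_bigmax_cond _ (fun j : 'I_1 * 'I_n => `|u j.1 j.2|) (j := (0, i))).
Qed.

Lemma norm_le_enorm u : `|u| <= enorm u.
Proof.
rewrite [leLHS]/Num.norm /= mx_normrE; apply: bigmax_le; first exact: enorm_ge0.
by move=> [i j] _ /=; rewrite ord1; exact: coord_le_enorm.
Qed.

Lemma enorm_le_norm u : enorm u <= n%:R * `|u|.
Proof.
apply: le_trans (enorm_le_sum u) _.
have -> : n%:R * `|u| = \sum_(i < n) `|u| by rewrite sumr_const card_ord mulr_natl.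
by apply: ler_sum => i _; exact: coord_le_norm.
Qed.

Lemma nbhs_enormP x (P : set 'rV[R]_n) :
  nbhs x P <-> exists2 r, 0 < r & forall y, enorm (y - x) < r -> P y.
Proof.
split=> [/nbhs_ballP[r /= r0 rP]|[r r0 rP]].
  exists r => // y yx; apply: rP; rewrite -ball_normE /=.
  by rewrite distrC; apply: le_lt_trans (norm_le_enorm _) yx.
apply/nbhs_ballP; exists (r / (n%:R + 1)) => /=.
  by rewrite divr_gt0 // ltr_wpDl.
move=> y; rewrite -ball_normE /= distrC => yx; apply: rP.
apply: le_lt_trans (enorm_le_norm _) _.
move: yx; rewrite ltr_pdivlMr ?ltr_wpDl // => yx.
by apply: le_lt_trans yx; rewrite mulrDr mulr1 mulrC lerDl.
Qed.

Lemma within_enormP x (D : set 'rV[R]_n) (P : set 'rV[R]_n) :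
  within D (nbhs x) P <->
  exists2 r, 0 < r & forall y, D y -> enorm (y - x) < r -> P y.
Proof.
split=> [/nbhs_enormP[r r0 rP]|[r r0 rP]].
  by exists r => // y Dy yx; exact: rP.
by apply/nbhs_enormP; exists r => // y yx Dy; exact: rP.
Qed.

Lemma open_enormP (O : set 'rV[R]_n) :
  open O <-> forall x, O x -> exists2 r, 0 < r & forall y, enorm (y - x) < r -> O y.
Proof.
rewrite openE; split=> h x Ox; first exact/nbhs_enormP/h.
exact/nbhs_enormP/h.
Qed.

Lemma within_continuous_enormP (D : set 'rV[R]_n) (g : 'rV[R]_n -> R) :
  {within D, continuous g} <-> forall x, D x -> forall e, 0 < e ->
    exists2 r, 0 < r & forall y, D y -> enorm (y - x) < r -> `|g y - g x| < e.
Proof.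

rewrite subspace_continuousP; split=> [h x Dx e e0|h x Dx].
  have /cvgrPdist_lt/(_ e e0)/within_enormP[r r0 rP] := h x Dx.
  by exists r => // y Dy yx; rewrite distrC; exact: rP.
apply/cvgrPdist_lt => e e0; have [r r0 rP] := h x Dx e e0.
by apply/within_enormP; exists r => // y Dy yx; rewrite distrC rP.
Qed.

End Euclid.

Section EuclidCompact.
Context {R : realType} {n : nat}.
Implicit Types (x : 'rV[R]_n) (r : R).

Lemma within_continuous_row_enormP m (D : set 'rV[R]_n) (g : 'rV[R]_n -> 'rV[R]_m) :
  {within D, continuous g} <-> forall x, D x -> forall e, 0 < e ->
    exists2 r, 0 < r & forall y, D y -> enorm (y - x) < r -> enorm (g y - g x) < e.
Proof.
rewrite subspace_continuousP; split=> [h x Dx e e0|h x Dx].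
  have /within_enormP[r r0 rP] : within D (nbhs x) [set y | enorm (g y - g x) < e].
    have : nbhs (g x) [set z | enorm (z - g x) < e] by apply/nbhs_enormP; exists e.
    exact: (h x Dx).
  by exists r.
move=> P /nbhs_enormP[e e0 eP]; have [r r0 rP] := h x Dx e e0.
by apply/within_enormP; exists r => // y Dy yx; exact/eP/rP.
Qed.

Lemma enorm_bounded_closed_compact (K : set 'rV[R]_n) r :
  closed K -> (forall x, K x -> enorm x <= r) -> compact K.
Proof.
move=> Kc Kr; apply: bounded_closed_compact => //.
exists r; split; first exact: num_real.
move=> s rs x Kx; apply: le_trans (norm_le_enorm _) _.
exact: le_trans (Kr x Kx) (ltW rs).
Qed.

Lemma compact_enorm_bounded (K : set 'rV[R]_n) :
  compact K -> exists2 r, 0 < r & forall x, K x -> enorm x <= r.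
Proof.
move=> /compact_bounded [M [_ hM]].
exists (n%:R * (`|M| + 1) + 1); first by rewrite ltr_wpDl // mulr_ge0.
move=> x Kx; apply: le_trans (enorm_le_norm _) _.
apply: (@le_trans _ _ (n%:R * (`|M| + 1))); last by rewrite lerDl.
by rewrite ler_wpM2l // hM // (le_lt_trans (ler_norm M)) // ltrDl.
Qed.

Lemma closed_enormP (K : set 'rV[R]_n) : closed K <->
  forall x, ~ K x -> exists2 r, 0 < r & forall y, enorm (y - x) < r -> ~ K y.
Proof.
by rewrite -openC open_enormP.
Qed.

Lemma closed_enorm_ball x r : closed [set y | enorm (y - x) <= r].
Proof.
apply/closed_enormP => y /= /negP; rewrite -ltNge => yr.
exists (enorm (y - x) - r); first by rewrite subr_gt0.
move=> z zy /=; apply/negP; rewrite -ltNge.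
have := enorm_sub_le y z x; rewrite (enormB y z); lra.
Qed.

Lemma compact_enorm_ball x r : compact [set y | enorm (y - x) <= r].
Proof.
apply: (@enorm_bounded_closed_compact _ (enorm x + r)).
  exact: closed_enorm_ball.
by move=> y /= yr; have := enorm_le_dist y x; lra.
Qed.

End EuclidCompact.
Arguments compact_enorm_ball {R n} x r [F] _ _ : rename.

(** * Gradients *)

Section DiffEps.
Context {R : realType} {V W : normedModType R}.

Lemma diff_eps (f : V -> W) x (df : {linear V -> W}) : continuous df ->
  (forall e, 0 < e -> \forall h \near 0, `|f (h + x) - f x - df h| <= e * `|h|) ->
  differentiable f x /\ 'd f x = df :> (V -> W).
Proof.
move=> dfc h; have H : f \o shift x = cst (f x) + df +o_ 0 id.
  apply/eqaddoP => e e0; have := h e e0; apply: filterS => k.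
  by rewrite /= !fctE opprD addrA.
have dE := diff_unique dfc H; split=> //.
by apply/diff_locallyP; rewrite dE.
Qed.

Lemma diff_eps_conv (f : V -> W) x : differentiable f x ->
  forall e, 0 < e -> \forall h \near 0, `|f (h + x) - f x - 'd f x h| <= e * `|h|.
Proof.
move=> /diff_locallyP[_ /eqaddoP h] e e0; have := h e e0; apply: filterS => k.
by rewrite /= !fctE opprD addrA.
Qed.

End DiffEps.

Section Gradient.
Context {R : realType} {n : nat}.
Implicit Types (g : 'rV[R]_n -> R) (x y z p q : 'rV[R]_n) (a b r : R).

(** Fréchet differentiability written in the Euclidean norm, the norm of all estimates below;
    [has_gradP] links it to the library notion. *)
Definition has_grad g x p := forall e, 0 < e -> exists2 r, 0 < r &
  forall y, enorm (y - x) < r -> `|g y - g x - dotp p (y - x)| <= e * enorm (y - x).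

Lemma dotp_is_linear p : linear (dotp p : 'rV[R]_n -> R^o).
Proof. by move=> a u v; rewrite dotpDr dotpZr. Qed.

HB.instance Definition _ p :=
  GRing.isLinear.Build R 'rV[R]_n R^o _ (dotp p) (dotp_is_linear p).

Lemma dotp_continuous p : continuous (dotp p : 'rV[R]_n -> R^o).
Proof.
move=> x P /nbhs_ballP[e /= e0 eP]; apply/(nbhs_enormP x).
have pp : 0 < enorm p + 1 by rewrite ltr_wpDl ?enorm_ge0.
exists (e / (enorm p + 1)); first by rewrite divr_gt0.
move=> y yx; apply: eP; rewrite -ball_normE /= -dotpBr; apply: le_lt_trans (cauchy_schwarz _ _) _.
rewrite enormB mulrC; move: yx; rewrite ltr_pdivlMr // => yx.
by apply: le_lt_trans yx; rewrite ler_wpM2l ?enorm_ge0 // lerDl.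
Qed.

Lemma has_grad_diff g x p : has_grad g x p ->
  differentiable g x /\ 'd g x = dotp p :> ('rV[R]_n -> R^o).
Proof.
move=> gp; apply: (@diff_eps R _ R^o g x (dotp p) (@dotp_continuous p)) => e e0.
apply/(nbhs_enormP 0).
have n0 : 0 < n%:R + 1 :> R by rewrite ltr_wpDl.
have [|r r0 rP] := gp (e / (n%:R + 1)); first by rewrite divr_gt0.
exists r => // y; rewrite subr0 => yr.
have := rP (y + x); rewrite addrK => /(_ yr) h; apply: le_trans h _.
rewrite mulrAC ler_pdivrMr // -mulrA ler_wpM2l ?(ltW e0) //.
apply: le_trans (enorm_le_norm _) _; rewrite mulrC ler_wpM2l //.
by rewrite lerDl.
Qed.

Lemma has_gradP g x p : has_grad g x p <-> differentiable g x /\ grad g x = p.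
Proof.
have D1 q : has_grad g x q -> grad g x = q.
  move=> /has_grad_diff[gd dE]; apply/rowP => i; rewrite mxE deriveE //.
  by rewrite dE dotp_delta.
split=> [gp|[gd <-]]; first by split; [have [] := has_grad_diff gp|exact: D1].
suff H q : 'd g x = dotp q :> (_ -> R^o) -> has_grad g x q.
  have E : 'd g x = dotp (grad g x) :> (_ -> R^o).
    apply/funext => v; rewrite [v in LHS]row_sum_delta linear_sum.
    by apply: eq_bigr => i _; rewrite linearZ mxE deriveE // mulrC.
  exact: H.
move=> dE e e0; have /(nbhs_enormP 0)[r r0 rP] := diff_eps_conv gd e0.
exists r => // y yr.
have := rP (y - x); rewrite subr0 => /(_ yr); rewrite dE subrK => h; apply: le_trans h _; rewrite ler_wpM2l ?(ltW e0) //; exact: norm_le_enorm.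
Qed.

Lemma has_grad_cst a x : has_grad (fun=> a) x 0.
Proof.
move=> e e0; exists 1 => // y _.
by rewrite subrr dotp0l subr0 normr0 mulr_ge0 ?enorm_ge0 ?ltW.
Qed.

Lemma has_gradD g1 g2 x p q : has_grad g1 x p -> has_grad g2 x q ->
  has_grad (fun y => g1 y + g2 y) x (p + q).
Proof.
move=> h1 h2 e e0; have e2 : 0 < e / 2 by rewrite divr_gt0.
have [r1 r10 H1] := h1 _ e2; have [r2 r20 H2] := h2 _ e2.
exists (Num.min r1 r2); first by rewrite lt_min r10.
move=> y; rewrite lt_min => /andP[y1 y2]; rewrite dotpDl.
have -> : g1 y + g2 y - (g1 x + g2 x) - (dotp p (y - x) + dotp q (y - x)) =
  (g1 y - g1 x - dotp p (y - x)) + (g2 y - g2 x - dotp q (y - x)) by ring.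
apply: le_trans (ler_normD _ _) _.
by have := H1 y y1; have := H2 y y2; lra.
Qed.

Lemma has_gradZ a g x p : has_grad g x p -> has_grad (fun y => a * g y) x (a *: p).
Proof.
move=> h e e0; have a0 : 0 < `|a| + 1 by rewrite ltr_wpDl.
have [|r r0 H] := h (e / (`|a| + 1)); first by rewrite divr_gt0.
exists r => // y yr; rewrite dotpZl -!mulrBr normrM.
apply: (@le_trans _ _ (`|a| * (e / (`|a| + 1) * enorm (y - x)))).
  by rewrite ler_wpM2l ?H.
rewrite mulrA ler_wpM2r ?enorm_ge0 // mulrCA ler_piMr ?(ltW e0) //.
by rewrite ler_pdivrMr // mul1r lerDl.
Qed.

Lemma has_grad_sq z x :
  has_grad (fun y => dotp (y - z) (y - z)) x (2 *: (x - z)).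
Proof.
move=> e e0; exists e => // y yr.
have -> : dotp (y - z) (y - z) - dotp (x - z) (x - z) - dotp (2 *: (x - z)) (y - x)
   = dotp (y - x) (y - x).
  have -> : y - z = (y - x) + (x - z) by rewrite addrA subrK.
  move: (y - x) (x - z) => u v.
  rewrite dotpZl !dotpDl !dotpDr (dotpC v u); ring.
rewrite -sqr_enorm ger0_norm ?sqr_ge0 // expr2.
by rewrite ler_wpM2r ?enorm_ge0 // ltW.
Qed.

(** A step t p raises g by at least t |p| (|p| - e), so |p| <= e for every e. *)
Lemma has_grad_max g x p r : 0 < r -> has_grad g x p ->
  (forall y, enorm (y - x) < r -> g y <= g x) -> p = 0.
Proof.
move=> r0 gp gm; apply: enorm_eq0; apply/eqP; rewrite eq_le enorm_ge0 andbT.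
apply/ler_addgt0Pr => e e0; rewrite add0r.
have [s s0 H] := gp e e0.
have [->|p0] := eqVneq p 0; first by rewrite enorm0 ltW.
have pp := enorm_gt0 p0.
pose t := Num.min r s / (2 * enorm p).
have m0 : 0 < Num.min r s by rewrite lt_min r0.
have t0 : 0 < t by rewrite divr_gt0 // mulr_gt0.
have tE : enorm (x + t *: p - x) = t * enorm p.
  by rewrite addrC addKr enormZ gtr0_norm.
have tm : t * enorm p < Num.min r s.
  have -> : t * enorm p = Num.min r s / 2 by rewrite /t; field; rewrite gt_eqF.
  by rewrite ltr_pdivrMr // ltr_pMr // ltr1n.
have := H (x + t *: p); have := gm (x + t *: p); rewrite tE.
move: tm; rewrite lt_min => /andP[tr ts] /(_ tr) h1 /(_ ts).
rewrite [x + _]addrC addrK dotpZr -sqr_enorm ler_norml => /andP[h2 _].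
rewrite -(ler_pM2l (mulr_gt0 t0 pp)); move: h1 h2; rewrite [_ + x]addrC; nra.
Qed.

Lemma has_grad_comp (phi : R -> R) d g x p :
  has_grad g x p -> is_derive (g x) 1 phi d -> has_grad (phi \o g) x (d *: p).
Proof.
move=> gp phid.
have [gd gE] := has_grad_diff gp.
have phid' : differentiable (phi : R^o -> R^o) (g x) by apply/derivable1_diffP; case: phid.
have cd : differentiable ((phi : R^o -> R^o) \o (g : _ -> R^o)) x.
  exact: differentiable_comp.
apply/has_gradP; split=> //.
apply/rowP => i; rewrite !mxE deriveE // diff_comp // gE /=.
rewrite dotp_delta.
have -> : 'd (phi : R^o -> R^o) (g x) = ( *:%R^~ d) :> (R^o -> R^o).
  by rewrite deriv1E; [rewrite derive1E derive_val|case: phid].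
by rewrite /= mulrC.
Qed.

End Gradient.

(** * C^1 functions and semicontinuous envelopes *)

Section C1.
Context {R : realType} {n : nat}.
Implicit Types (g : 'rV[R]_n -> R) (G : 'rV[R]_n -> 'rV[R]_n) (O : set 'rV[R]_n).

(** The gradient is carried as an explicit map G, so that test functions can be added and scaled
    without computing [grad]. *)
Definition C1_with O g G :=
  (forall x, O x -> has_grad g x (G x)) /\
  forall x, O x -> forall e, 0 < e -> exists2 r, 0 < r &
    forall y, O y -> enorm (y - x) < r -> enorm (G y - G x) < e.

Lemma C1_with_on O g G : C1_with O g G -> C1_on O g.
Proof.
move=> [gG Gc]; split=> [x Ox|]; first by have /has_gradP[] := gG x Ox.
apply/within_continuous_row_enormP => x Ox e e0; have [r r0 rP] := Gc x Ox e e0.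
exists r => // y Oy yr.
have /has_gradP[_ ->] := gG x Ox; have /has_gradP[_ ->] := gG y Oy; exact: rP.
Qed.

Lemma C1_on_with O g : C1_on O g -> C1_with O g (grad g).
Proof.
move=> [gd /within_continuous_row_enormP gc]; split=> [x Ox|//].
by apply/has_gradP; split=> //; exact: gd.
Qed.

Lemma C1_withD O g1 G1 g2 G2 : C1_with O g1 G1 -> C1_with O g2 G2 ->
  C1_with O (fun y => g1 y + g2 y) (fun y => G1 y + G2 y).
Proof.
move=> [h1 k1] [h2 k2]; split=> [x Ox|x Ox e e0].
  by apply: has_gradD; [exact: h1|exact: h2].
have e2 : 0 < e / 2 by rewrite divr_gt0.
have [r1 r10 H1] := k1 x Ox _ e2; have [r2 r20 H2] := k2 x Ox _ e2.
exists (Num.min r1 r2); first by rewrite lt_min r10.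
move=> y Oy; rewrite lt_min => /andP[y1 y2].
have -> : G1 y + G2 y - (G1 x + G2 x) = (G1 y - G1 x) + (G2 y - G2 x).
  by rewrite opprD addrACA.
apply: le_lt_trans (enormD _ _) _.
by have := H1 y Oy y1; have := H2 y Oy y2; lra.
Qed.

Lemma C1_withZ O g G a : C1_with O g G ->
  C1_with O (fun y => a * g y) (fun y => a *: G y).
Proof.
move=> [h k]; split=> [x Ox|x Ox e e0]; first by apply: has_gradZ; exact: h.
have a0 : 0 < `|a| + 1 by rewrite ltr_wpDl.
have [|r r0 H] := k x Ox (e / (`|a| + 1)); first by rewrite divr_gt0.
exists r => // y Oy yr; rewrite -scalerBr enormZ.
have := H y Oy yr; rewrite ltr_pdivlMr // => h'.
apply: le_lt_trans h'; rewrite mulrC ler_wpM2l ?enorm_ge0 //; lra.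
Qed.

Lemma C1_with_cst O a : C1_with O (fun=> a) (fun=> 0).
Proof.
split=> [x _|x _ e e0]; first exact: has_grad_cst.
by exists 1 => // y _ _; rewrite subrr enorm0.
Qed.

Lemma C1_with_sq O z :
  C1_with O (fun y => dotp (y - z) (y - z)) (fun y => 2 *: (y - z)).
Proof.
split=> [x _|x _ e e0]; first exact: has_grad_sq.
exists (e / 2); first by rewrite divr_gt0.
move=> y _; rewrite ltr_pdivlMr // => yx.
rewrite -scalerBr opprB addrA subrK enormZ.
by rewrite ger0_norm // mulrC.
Qed.

End C1.

Section Semicontinuity.
Context {R : realType} {n : nat}.
Implicit Types (u v W : 'rV[R]_n -> R) (D K : set 'rV[R]_n).

(** The superlevel sets of u generate a filter on K. At a cluster point p with u p < u y,
    semicontinuity gives a neighbourhood that misses the superlevel set of y. The space is arbitrary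
    because doubling of variables maximises over a product. *)
Lemma usc_compact_max (X : topologicalType) (K : set X) (u : X -> R) :
  compact K -> K !=set0 ->
  (forall x, K x -> forall c, u x < c -> within K (nbhs x) [set y | u y < c]) ->
  exists2 x, K x & forall y, K y -> u y <= u x.
Proof.
move=> Kc [x0 Kx0] uu; apply: contrapT => nomax.
have H x : K x -> exists2 y, K y & u x < u y.
  move=> Kx; apply: contrapT => h; apply: nomax; exists x => // y Ky.
  by rewrite leNgt; apply/negP => xy; apply: h; exists y.
pose B y := [set z | K z /\ u y <= u z].
have FF : ProperFilter (filter_from K B).
  apply: filter_from_proper; last by move=> y Ky; exists y.
  apply: filter_from_filter; first by exists x0.
  move=> y1 y2 K1 K2; have [h|h] := leP (u y1) (u y2).
    by exists y2 => // z [Kz zy]; split; split=> //; apply: le_trans zy.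
  by exists y1 => // z [Kz zy]; split; split=> //; apply: le_trans zy; exact: ltW.
have [|p [Kp cp]] := Kc _ FF; first by exists x0 => // z [].
have [y Ky py] := H p Kp.
have [|z [[Kz yz] /(_ Kz) /=]] := cp (B y) _ _ (uu p Kp _ py); first by exists y.
by rewrite ltNge yz.
Qed.

Definition usc_on D u := forall x, D x -> forall c, u x < c -> exists2 r, 0 < r &
  forall y, D y -> enorm (y - x) < r -> u y < c.

Definition lsc_on D v := forall x, D x -> forall c, c < v x -> exists2 r, 0 < r &
  forall y, D y -> enorm (y - x) < r -> c < v y.

Lemma lsc_onN D v : lsc_on D v -> usc_on D (fun x => - v x).
Proof.
move=> h x Dx c; rewrite ltrNl => cv; have [r r0 rP] := h x Dx _ cv.
by exists r => // y Dy yr; rewrite ltrNl; exact: rP.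
Qed.

Lemma usc_lsc_continuous D u : usc_on D u -> lsc_on D u ->
  {within D, continuous u}.
Proof.
move=> hu hl; apply/within_continuous_enormP => x Dx e e0.
have [|r1 r10 H1] := hu x Dx (u x + e); first by rewrite ltrDl.
have [|r2 r20 H2] := hl x Dx (u x - e); first by rewrite gtrBl.
exists (Num.min r1 r2); first by rewrite lt_min r10.
move=> y Dy; rewrite lt_min => /andP[y1 y2]; rewrite ltr_distl.
by rewrite H2 // H1.
Qed.

Lemma continuous_usc D u : {within D, continuous u} -> usc_on D u.
Proof.
move=> /within_continuous_enormP h x Dx c uc.
have [|r r0 H] := h x Dx (c - u x); first by rewrite subr_gt0.
exists r => // y Dy yr; have := H y Dy yr; rewrite ltr_distl => /andP[_].
by rewrite addrC subrK.
Qed.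

Lemma continuous_lsc D u : {within D, continuous u} -> lsc_on D u.
Proof.
move=> /within_continuous_enormP h x Dx c uc.
have [|r r0 H] := h x Dx (u x - c); first by rewrite subr_gt0.
exists r => // y Dy yr; have := H y Dy yr; rewrite ltr_distl => /andP[+ _].
by rewrite opprB addrC subrK.
Qed.

Lemma usc_on_max K D u : K `<=` D -> usc_on D u -> compact K -> K !=set0 ->
  exists2 x, K x & forall y, K y -> u y <= u x.
Proof.
move=> KD uu Kc K0; apply: usc_compact_max => // x Kx c uc.
have [r r0 rP] := uu x (KD x Kx) c uc.
by apply/within_enormP; exists r => // y Ky; apply: rP; exact: KD.
Qed.

Variables (a b : R) (D : set 'rV[R]_n) (W : 'rV[R]_n -> R).
Hypothesis Wab : forall x, D x -> a <= W x <= b.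

Let esup_fin x : D x ->
  limf_esup (EFin \o W) (within D (nbhs x)) \is a fin_num.
Proof.
move=> Dx; rewrite limf_esupE fin_numElt; apply/andP; split.
  apply: (@lt_le_trans _ _ a%:E); first exact: ltNyr.
  apply: le_ereal_inf_tmp => _ [V /within_enormP[r r0 rV] <-].
  apply: (@le_trans _ _ (W x)%:E); first by rewrite lee_fin; case/andP: (Wab Dx).
  apply: ereal_sup_ubound; exists x => //; apply: rV => //.
  by rewrite subrr enorm0.
apply: (@le_lt_trans _ _ b%:E); last exact: ltry.
apply: ereal_inf_le; exists (ereal_sup ((EFin \o W) @` D)).
  exists D => //; apply/within_enormP; by exists 1.
apply: ge_ereal_sup => _ [y Dy <-]; rewrite lee_fin; by case/andP: (Wab Dy).
Qed.

Lemma usc_env_lt x c : D x -> usc_env D W x < c -> exists2 r, 0 < r &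
  forall y, D y -> enorm (y - x) < r -> W y < c.
Proof.
move=> Dx; rewrite -lte_fin fineK ?esup_fin // limf_esupE => /ereal_inf_lt.
move=> [_ [V /within_enormP[r r0 rV] <-] h]; exists r => // y Dy yr.
rewrite -lte_fin; apply: le_lt_trans h; apply: ereal_sup_ubound.
by exists y => //; exact: rV.
Qed.

Lemma usc_env_le x c r : D x -> 0 < r ->
  (forall y, D y -> enorm (y - x) < r -> W y <= c) -> usc_env D W x <= c.
Proof.
move=> Dx r0 h; rewrite -lee_fin fineK ?esup_fin // limf_esupE.
pose V := [set y | D y /\ enorm (y - x) < r].
apply: ereal_inf_le; exists (ereal_sup ((EFin \o W) @` V)).
  by exists V => //; apply/within_enormP; exists r.
by apply: ge_ereal_sup => _ [y [Dy yr] <-]; rewrite lee_fin h.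
Qed.

Lemma le_usc_env x : D x -> W x <= usc_env D W x.
Proof.
move=> Dx; rewrite leNgt; apply/negP => h.
have [r r0 /(_ x Dx)] := usc_env_lt Dx h.
by rewrite subrr enorm0 ltxx => /(_ r0).
Qed.

Lemma usc_env_usc : usc_on D (usc_env D W).
Proof.
move=> x Dx c xc.
have h : usc_env D W x < (usc_env D W x + c) / 2 by lra.
have [r r0 rP] := usc_env_lt Dx h.
exists (r / 2); first by rewrite divr_gt0.
move=> y Dy yr; apply: (@le_lt_trans _ _ ((usc_env D W x + c) / 2)); last lra.
apply: (@usc_env_le _ _ (r / 2)) => //; first by rewrite divr_gt0.
move=> z Dz zy; apply/ltW/rP => //.
by have := enorm_sub_le z y x; lra.
Qed.

Lemma usc_env_id x : usc_on D W -> D x -> usc_env D W x = W x.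
Proof.
move=> h Dx; apply/eqP; rewrite eq_le le_usc_env // andbT.
apply/ler_addgt0Pr => e e0.
have [|r r0 rP] := h x Dx (W x + e); first by rewrite ltrDl.
by apply: (usc_env_le Dx r0) => y Dy yr; exact/ltW/rP.
Qed.

End Semicontinuity.

Section LowerEnvelope.
Context {R : realType} {n : nat} (a b : R) (D : set 'rV[R]_n) (W : 'rV[R]_n -> R).
Hypothesis Wab : forall x, D x -> a <= W x <= b.

Lemma lsc_envE x : lsc_env D W x = - usc_env D (fun y => - W y) x.
Proof.
rewrite /lsc_env /usc_env /limf_einf fineN; congr (- fine (limf_esup _ _)).
Qed.

Let NWab x : D x -> - b <= - W x <= - a.
Proof. by move=> Dx; rewrite !lerN2 andbC Wab. Qed.

Lemma lsc_env_gt x c : D x -> c < lsc_env D W x -> exists2 r, 0 < r &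
  forall y, D y -> enorm (y - x) < r -> c < W y.
Proof.
move=> Dx; rewrite lsc_envE ltrNr => h.
have [r r0 rP] := usc_env_lt NWab Dx h.
by exists r => // y Dy yr; rewrite -ltrN2; exact: rP.
Qed.

Lemma lsc_env_ge x c r : D x -> 0 < r ->
  (forall y, D y -> enorm (y - x) < r -> c <= W y) -> c <= lsc_env D W x.
Proof.
move=> Dx r0 h; rewrite lsc_envE lerNr; apply: (usc_env_le NWab Dx r0) => y Dy yr.
by rewrite lerN2 h.
Qed.

Lemma lsc_env_le x : D x -> lsc_env D W x <= W x.
Proof. by move=> Dx; rewrite lsc_envE lerNl; apply: (le_usc_env NWab Dx). Qed.

Lemma lsc_env_lsc : lsc_on D (lsc_env D W).
Proof.
move=> x Dx c; rewrite lsc_envE ltrNr => h.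
have [r r0 rP] := usc_env_usc NWab Dx h.
by exists r => // y Dy yr; rewrite lsc_envE ltrNr; exact: rP.
Qed.

Lemma lsc_env_id x : lsc_on D W -> D x -> lsc_env D W x = W x.
Proof.
move=> h Dx; rewrite lsc_envE (usc_env_id NWab) ?opprK //; exact: lsc_onN.
Qed.

End LowerEnvelope.

(** * Distance to the target *)

Section Uniformity.
Context {R : realType} {n : nat}.

(** The form in which compactness is used below: since P survives a decrease of r, finitely many
    local radii have a common one. The near-covering property replaces the choice of a finite
    subcover. *)
Lemma compact_uniform (K : set 'rV[R]_n) (P : R -> 'rV[R]_n -> Prop) :
  compact K ->
  (forall r s x, 0 < s -> s <= r -> P r x -> P s x) ->
  (forall x, K x -> exists2 r, 0 < r & forall y, K y -> enorm (y - x) < r -> P r y) ->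
  exists2 r, 0 < r & forall x, K x -> P r x.
Proof.
move=> /compact_near_coveringP/near_covering_withinP Kc Pm Pl.
have : \forall r \near 0^'+, K `<=` P r.
  apply: Kc => x Kx; have [r r0 rP] := Pl x Kx.
  exists ([set y | enorm (y - x) < r], [set s | 0 < s <= r]) => /=.
    split; first by apply/nbhs_enormP; exists r.
    near=> s; apply/andP; split; first by near: s; exact: nbhs_right_gt.
    by near: s; exact: nbhs_right_le.
  by move=> [y s] /= [yr /andP[s0 sr]] Ky; apply: (Pm r) => //; exact: rP.
move=> h; have [s /andP[s0 hs]] : exists s, (0 < s) && `[< K `<=` P s >].
  near (0 : R)^'+ => s; exists s; apply/andP; split.
    by near: s; exact: nbhs_right_gt.
  by apply/asboolP; near: s.
by exists s => //; apply/asboolP.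
Unshelve. all: by end_near. Qed.

End Uniformity.

Section Distance.
Context {R : realType} {n : nat}.
Variable T : set 'rV[R]_n.
Hypotheses (T0 : T !=set0) (Tcl : closed T).
Implicit Types (x y z b : 'rV[R]_n).

Lemma dist_le x z : T z -> dist T x <= enorm (x - z).
Proof.
move=> Tz; apply: ge_inf; last by exists z.
by exists 0 => _ [y _ <-]; exact: enorm_ge0.
Qed.

Lemma dist_ge x r : (forall z, T z -> r <= enorm (x - z)) -> r <= dist T x.
Proof.
move=> h; apply: lb_le_inf; first by have [z Tz] := T0; exists (enorm (x - z)), z.
by move=> _ [z Tz <-]; exact: h.
Qed.

Lemma dist_ge0 x : 0 <= dist T x.
Proof. by apply: dist_ge => z _; exact: enorm_ge0. Qed.

Lemma dist_lip x y : dist T x <= dist T y + enorm (x - y).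
Proof.
rewrite -lerBlDr; apply: dist_ge => z Tz; rewrite lerBlDr addrC.
exact: le_trans (dist_le x Tz) (enorm_sub_le _ _ _).
Qed.

Lemma dist_in x : T x -> dist T x = 0.
Proof.
move=> Tx; apply/eqP; rewrite eq_le dist_ge0 andbT.
by have := dist_le x Tx; rewrite subrr enorm0.
Qed.

Lemma dist_gt0 x : ~ T x -> 0 < dist T x.
Proof.
move=> Tx; have /closed_enormP /(_ x Tx)[r r0 rP] := Tcl.
apply: lt_le_trans r0 _; apply: dist_ge => z Tz; rewrite leNgt; apply/negP.
by rewrite enormB => /rP.
Qed.

Lemma dist_gt0_notin x : 0 < dist T x -> ~ T x.
Proof. by move=> + /dist_in dx; rewrite dx ltxx. Qed.

(** T may be unbounded, so the distance is minimised over the part of T no farther from x than a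
    given z in T. *)
Lemma dist_nearest x : exists2 b, T b & dist T x = enorm (x - b).
Proof.
have [z Tz] := T0.
pose K := T `&` [set y | enorm (y - x) <= enorm (z - x)].
have Kc : compact K.
  have Kcl : closed K by apply: closedI => //; exact: closed_enorm_ball.
  have KB : K `<=` [set y | enorm (y - x) <= enorm (z - x)] by move=> y [].
  exact: subclosed_compact Kcl (compact_enorm_ball _ _) KB.
have KT : K `<=` setT by [].
have [||b [Tb bz] bm] := usc_on_max (u := fun y => - enorm (x - y)) KT _ Kc.
- move=> y _ c yc; exists (enorm (x - y) + c); first lra.
  by move=> w _ wy; have := enorm_sub_le x w y; lra.
- by exists z; split => /=.
exists b => //; apply/eqP; rewrite eq_le dist_le //=.
apply: dist_ge => w Tw; have [wz|wz] := leP (enorm (w - x)) (enorm (z - x)).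
  by have := bm w (conj Tw wz); rewrite lerN2.
by rewrite enormB (enormB x w); exact: le_trans bz (ltW wz).
Qed.

Lemma interior_sub x : interior T x -> T x. Proof. exact: nbhs_singleton. Qed.

(** Were the nearest point b interior to T, a small move from b towards x would stay in T and come
    closer to x. *)
Lemma nearest_bdry x : ~ T x -> exists2 b, bdry T b & dist T x = enorm (x - b).
Proof.
move=> Tx; have [b Tb db] := dist_nearest x; exists b => //.
split; first exact: subset_closure.
move=> /nbhs_enormP[r r0 rT].
have d0 := dist_gt0 Tx; rewrite db in d0.
pose t := Num.min (r / (2 * enorm (x - b))) (1 / 2).
have t0 : 0 < t by rewrite lt_min !divr_gt0 // mulr_gt0.
have t1 : t <= 1 / 2 by rewrite ge_min lexx orbT.
have tr : t * enorm (x - b) < r.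
  apply: (@le_lt_trans _ _ (r / (2 * enorm (x - b)) * enorm (x - b))).
    by rewrite ler_pM2r // ge_min lexx.
  have -> : r / (2 * enorm (x - b)) * enorm (x - b) = r / 2.
    by field; rewrite gt_eqF.
  lra.
have Tw : T (b + t *: (x - b)).
  by apply: rT; rewrite addrC addKr enormZ gtr0_norm.
have := dist_le x Tw; rewrite db.
have -> : x - (b + t *: (x - b)) = (1 - t) *: (x - b).
  by rewrite opprD addrA scalerBl scale1r.
rewrite enormZ ger0_norm; last lra.
by nra.
Qed.

Lemma not_T_D x : ~ T x -> ~ interior T x.
Proof. by move=> Tx /interior_sub. Qed.

Lemma bdry_D x : bdry T x -> ~ interior T x. Proof. by case. Qed.

Lemma bdry_T x : bdry T x -> T x.
Proof. by case=> + _; move/closure_id : Tcl => <-. Qed.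

Lemma D_cases x : ~ interior T x -> ~ T x \/ bdry T x.
Proof.
move=> ix; have [Tx|Tx] := pselect (T x); [right|by left].
by split=> //; exact: subset_closure.
Qed.

Lemma notT_open x : ~ T x -> exists2 r, 0 < r & forall y, enorm (y - x) < r -> ~ T y.
Proof. by move=> Tx; have /closed_enormP := Tcl; apply. Qed.

Lemma D_closed : closed (~` interior T).
Proof. by rewrite closedC; exact: open_interior. Qed.

(** Turns the boundary condition at single points into a bound on a whole band around T: a point
    near T is near some boundary point, and the boundary is compact. *)
Lemma usc_bdry_small (u : 'rV[R]_n -> R) s : compact (bdry T) ->
  usc_on (~` interior T) u -> (forall b, bdry T b -> u b <= 0) -> 0 < s ->
  exists2 r, 0 < r & forall x, ~ interior T x -> dist T x < r -> u x < s.
Proof.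
move=> bc uu ub s0.
have [||r r0 rP] := @compact_uniform R n (bdry T)
  (fun r b => forall x, ~ interior T x -> enorm (x - b) < r -> u x < s) bc.
- by move=> r t x t0 tr h y iy yt; apply: h => //; exact: lt_le_trans tr.
- move=> b bb; have [|r r0 rP] := uu b (bdry_D bb) s.
    by apply: le_lt_trans (ub b bb) s0.
  exists (r / 2); first by rewrite divr_gt0.
  move=> c _ cb x ix xc; apply: rP => //.
  by have := enorm_sub_le x c b; lra.
exists r => // x ix dx; have [Tx|bx] := D_cases ix; last first.
  by apply: (rP x) => //; rewrite subrr enorm0.
have [b bb db] := nearest_bdry Tx.
by apply: (rP b) => //; rewrite -db.
Qed.

End Distance.

Section UniformControl.
Context {R : realType} {n m : nat}.
Variables (A : set 'rV[R]_m) (F : 'rV[R]_n -> 'rV[R]_m -> R).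
Hypotheses (Ac : compact A)
  (Fc : {within setT `*` A, continuous (fun q => F q.1 q.2)}).

Lemma joint_continuous x a e : A a -> 0 < e -> exists2 r, 0 < r &
  forall y b, enorm (y - x) < r -> A b -> enorm (b - a) < r -> `|F y b - F x a| < e.
Proof.
move=> Aa e0; move: Fc; rewrite subspace_continuousP => /(_ (x, a) (conj I Aa)).
move=> /cvgrPdist_lt/(_ e e0)[[/= B1 B2] [/nbhs_enormP[r1 r10 h1] /nbhs_enormP[r2 r20 h2]] BP].
exists (Num.min r1 r2); first by rewrite lt_min r10.
move=> y b; rewrite !lt_min => /andP[y1 _] Ab /andP[_ b2].
by rewrite distrC; apply: (BP (y, b)); split=> //=; [exact: h1|exact: h2].
Qed.

Lemma joint_bounded r : exists2 C, 0 < C &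
  forall x a, enorm x <= r -> A a -> `|F x a| <= C.
Proof.
have Kc : compact ([set x : 'rV[R]_n | enorm (x - 0) <= r] `*` A).
  by apply: compact_setX => //; exact: compact_enorm_ball.
have Fc' : {within [set x : 'rV[R]_n | enorm (x - 0) <= r] `*` A,
    continuous (fun q => F q.1 q.2)}.
  by apply: continuous_subspaceW Fc => -[x a] [].
have /compact_bounded[M [_ hM]] := continuous_compact Fc' Kc.
exists (`|M| + 1); first by rewrite ltr_wpDl.
move=> x a xr Aa; apply: hM; first by rewrite (le_lt_trans (ler_norm M)) // ltrDl.
by exists (x, a) => //; split => //=; rewrite subr0.
Qed.

(** Compactness is used twice, in a at fixed x and then in x over the ball; the error grows from e /
    4 through e / 2 to e. *)
Lemma joint_uniform r e : 0 < e -> exists2 d, 0 < d &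
  forall x y a, enorm x <= r -> enorm (y - x) < d -> A a -> `|F y a - F x a| < e.
Proof.
move=> e0; have e2 : 0 < e / 2 by rewrite divr_gt0.
have [||d d0 dP] := @compact_uniform R n [set x | enorm (x - 0) <= r]
  (fun d x => forall y a, enorm (y - x) < d -> A a -> `|F y a - F x a| < e)
  (compact_enorm_ball 0 r).
- by move=> s t x t0 ts h y a yt Aa; apply: h => //; exact: lt_le_trans ts.
- move=> x _; have [||d d0 dP] := @compact_uniform R m A
    (fun d a => forall y, enorm (y - x) < d -> `|F y a - F x a| < e / 2) Ac.
  + by move=> s t a t0 ts h y yt; apply: h; exact: lt_le_trans ts.
  + move=> a Aa; have [|d d0 dP] := @joint_continuous x a (e / 4) Aa.
      by rewrite divr_gt0.
    exists d => // b Ab ba y yx.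
    have := dP y b yx Ab ba; have := dP x b _ Ab ba.
    rewrite subrr enorm0 => /(_ d0); rewrite !ltr_norml => /andP[? ?] /andP[? ?].
    by apply/andP; split; lra.
  exists (d / 2); first by rewrite divr_gt0.
  move=> z _ zx y a yz Aa.
  have h1 : enorm (y - x) < d by have := enorm_sub_le y z x; lra.
  have h2 : enorm (z - x) < d by lra.
  have := dP a Aa y h1; have := dP a Aa z h2.
  rewrite !ltr_norml => /andP[? ?] /andP[? ?].
  by apply/andP; split; lra.
exists d => // x y a xr yx Aa; apply: dP => //=; by rewrite subr0.
Qed.

End UniformControl.

(** * Comparison principle *)

Section Hamiltonian.
Context {R : realType} {n m : nat}.
Variables (f : 'rV[R]_n -> 'rV[R]_m -> 'rV[R]_n) (h : 'rV[R]_n -> 'rV[R]_m -> R)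
  (A : set 'rV[R]_m).
Implicit Types (x p : 'rV[R]_n) (u : R) (phi w : 'rV[R]_n -> R).

Lemma ham_le0 x u p : (hamiltonian f h A x u p <= 0)%E ->
  forall a, A a -> - dotp p (f x a) - h x a + h x a * u <= 0.
Proof.
move=> H a Aa; rewrite -lee_fin; apply: le_trans H.
by apply: ereal_sup_ubound; exists a.
Qed.

Lemma ham_le0_intro x u p :
  (forall a, A a -> - dotp p (f x a) - h x a + h x a * u <= 0) ->
  (hamiltonian f h A x u p <= 0)%E.
Proof. by move=> H; apply: ge_ereal_sup => _ [a Aa <-]; rewrite lee_fin H. Qed.

Lemma ham_ge0 x u p e : (0 <= hamiltonian f h A x u p)%E -> 0 < e ->
  exists2 a, A a & - e < - dotp p (f x a) - h x a + h x a * u.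
Proof.
move=> H e0; have : ((- e)%:E < hamiltonian f h A x u p)%E.
  by apply: lt_le_trans H; rewrite lte_fin oppr_lt0.
by move=> /ereal_sup_gt[_ [a Aa <-]]; rewrite lte_fin => ?; exists a.
Qed.

Lemma ham_ge0_intro x u p a : A a ->
  0 <= - dotp p (f x a) - h x a + h x a * u -> (0 <= hamiltonian f h A x u p)%E.
Proof.
move=> Aa H; apply: (@le_trans _ _ (- dotp p (f x a) - h x a + h x a * u)%:E).
  by rewrite lee_fin.
by apply: ereal_sup_ubound; exists a.
Qed.

Variable O : set 'rV[R]_n.

Lemma subsol_test w phi G x r : viscosity_subsolution (hamiltonian f h A) O w ->
  C1_with O phi G -> O x -> 0 < r ->
  (forall y, enorm (y - x) < r -> w y - phi y <= w x - phi x) ->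
  forall a, A a -> - dotp (G x) (f x a) - h x a + h x a * w x <= 0.
Proof.
move=> hw phiG Ox r0 hm; apply: ham_le0.
have /has_gradP[_ <-] := phiG.1 x Ox.
apply: hw => //; first exact: C1_with_on phiG.
by apply/nbhs_enormP; exists r.
Qed.

Lemma supersol_test w phi G x r e : viscosity_supersolution (hamiltonian f h A) O w ->
  C1_with O phi G -> O x -> 0 < r ->
  (forall y, enorm (y - x) < r -> w x - phi x <= w y - phi y) -> 0 < e ->
  exists2 a, A a & - e < - dotp (G x) (f x a) - h x a + h x a * w x.
Proof.
move=> hw phiG Ox r0 hm e0; apply: ham_ge0 => //.
have /has_gradP[_ <-] := phiG.1 x Ox.
apply: hw => //; first exact: C1_with_on phiG.
by apply/nbhs_enormP; exists r.
Qed.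

Lemma subsol_intro w : (forall phi x r, C1_with O phi (grad phi) -> O x -> 0 < r ->
    (forall y, enorm (y - x) < r -> w y - phi y <= w x - phi x) ->
    forall a, A a -> - dotp (grad phi x) (f x a) - h x a + h x a * w x <= 0) ->
  viscosity_subsolution (hamiltonian f h A) O w.
Proof.
move=> H phi x phiC Ox /nbhs_enormP[r r0 rP]; apply: ham_le0_intro.
by apply: (H phi x r) => //; exact: C1_on_with.
Qed.

Lemma supersol_intro w : (forall phi x r, C1_with O phi (grad phi) -> O x -> 0 < r ->
    (forall y, enorm (y - x) < r -> w x - phi x <= w y - phi y) ->
    (0 <= hamiltonian f h A x (w x) (grad phi x))%E) ->
  viscosity_supersolution (hamiltonian f h A) O w.
Proof.
move=> H phi x phiC Ox /nbhs_enormP[r r0 rP].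
by apply: (H phi x r) => //; exact: C1_on_with.
Qed.

(** Viscosity tests are local, so a function and its envelope can be exchanged where they agree near
    each point of O. *)
Lemma subsol_eq w1 w2 : (forall x, O x -> exists2 r, 0 < r &
    forall y, enorm (y - x) < r -> w1 y = w2 y) ->
  viscosity_subsolution (hamiltonian f h A) O w1 ->
  viscosity_subsolution (hamiltonian f h A) O w2.
Proof.
move=> e H phi x phiC Ox hm; have [r r0 rP] := e x Ox.
have E := rP x; rewrite subrr enorm0 in E; rewrite -E //.
apply: H => //; apply: filterS2 hm _; last first.
  by apply/(nbhs_enormP x (fun y => w1 y = w2 y)); exists r.
by move=> y h1 h2; rewrite h2 E.
Qed.

Lemma supersol_eq w1 w2 : (forall x, O x -> exists2 r, 0 < r &
    forall y, enorm (y - x) < r -> w1 y = w2 y) ->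
  viscosity_supersolution (hamiltonian f h A) O w1 ->
  viscosity_supersolution (hamiltonian f h A) O w2.
Proof.
move=> e H phi x phiC Ox hm; have [r r0 rP] := e x Ox.
have E := rP x; rewrite subrr enorm0 in E; rewrite -E //.
apply: H => //; apply: filterS2 hm _; last first.
  by apply/(nbhs_enormP x (fun y => w1 y = w2 y)); exists r.
by move=> y h1 h2; rewrite h2 E.
Qed.

End Hamiltonian.

Lemma bounded_small_drop (R : realType) (M : nat -> R) (lo hi e : R) (k0 : nat) :
  (forall k, lo <= M k <= hi) -> 0 < e ->
  exists2 k, (k0 <= k)%N & M k - M k.+1 < e.
Proof.
move=> Mb e0; apply: contrapT => H.
have H' k : (k0 <= k)%N -> e <= M k - M k.+1.
  by move=> kk; rewrite leNgt; apply/negP => h; apply: H; exists k.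
have D j : M (k0 + j)%N <= M k0 - j%:R * e.
  elim: j => [|j IH]; first by rewrite addn0 mul0r subr0.
  rewrite addnS -natr1; have := H' (k0 + j)%N (leq_addr _ _); lra.
have : 0 <= (hi - lo) / e.
  by apply: divr_ge0; [have /andP[] := Mb 0%N; lra|exact: ltW].
move=> /archi_boundP; set N := Num.bound _; rewrite ltr_pdivrMr // => hN.
have := D N; have /andP[a1 a2] := Mb k0; have /andP[b1 b2] := Mb (k0 + N)%N; lra.
Qed.

(* Subtracting th * g(x) in the doubled function makes it coercive, and turns a
   gap of size s between sub- and supersolution into a strict inequality c > 0. *)
Definition comparison_barrier (R : realType) (n m : nat)
    (f : 'rV[R]_n -> 'rV[R]_m -> 'rV[R]_n) (h : 'rV[R]_n -> 'rV[R]_m -> R)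
    (A : set 'rV[R]_m) (T : set 'rV[R]_n) (g : 'rV[R]_n -> R)
    (G : 'rV[R]_n -> 'rV[R]_n) : Prop :=
  [/\ C1_with (~` T) g G,
      forall x, ~ interior T x -> 0 <= g x,
      {within ~` interior T, continuous g},
      forall c, exists r, forall x, ~ interior T x -> g x <= c -> enorm x <= r
    & forall s r t, 0 < s -> 0 < r -> 0 < t -> exists2 th, 0 < th <= t &
        exists2 c, 0 < c & forall x a, ~ T x -> A a -> r <= dist T x ->
          c <= s * h x a - th * dotp (G x) (f x a)].

Section Doubling.
Context {R : realType} {n : nat}.
Variables (D : set 'rV[R]_n) (u v g : 'rV[R]_n -> R).
Implicit Types (th N e s : R).

(** The coercive term charges the first variable alone; the quadratic term keeps the second one near
    it. *)
Definition doubled th N (q : 'rV[R]_n * 'rV[R]_n) :=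
  u q.1 - v q.2 - th * g q.1 - N * dotp (q.1 - q.2) (q.1 - q.2).

Lemma doubled_usc th N : usc_on D u -> lsc_on D v -> lsc_on D g ->
  0 < th -> 0 < N -> forall K, K `<=` D ->
  forall q, (K `*` K) q -> forall c, doubled th N q < c ->
  within (K `*` K) (nbhs q) [set q' | doubled th N q' < c].
Proof.
move=> uu vl gl th0 N0 K KD [x y] [/= Kx Ky] c qc.
have Dx := KD _ Kx; have Dy := KD _ Ky.
(* Each of the four terms moves by less than e; the fifth share keeps the inequality strict. *)
pose e := (c - doubled th N (x, y)) / 5.
have e0 : 0 < e by rewrite divr_gt0 // subr_gt0.
have [|r1 r10 H1] := uu _ Dx (u x + e); first by rewrite ltrDl.
have [|r2 r20 H2] := vl _ Dy (v y - e); first by rewrite gtrBl.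
have [|r3 r30 H3] := gl x Dx (g x - e / th); first by rewrite gtrBl divr_gt0.
have [r4 r40 H4] : exists2 r, 0 < r & forall z, enorm (z - (x - y)) < r ->
    N * dotp (x - y) (x - y) - e < N * dotp z z.
  have [r r0 rP] := @has_grad_sq _ _ 0 (x - y) 1 ltr01.
  pose C := enorm (2 *: (x - y - 0)) + 1.
  have C0 : 0 < C by rewrite ltr_wpDl ?enorm_ge0.
  exists (Num.min r (e / (N * C))).
    by rewrite lt_min r0 divr_gt0 // mulr_gt0.
  move=> z; rewrite lt_min => /andP[zr]; rewrite ltr_pdivlMr ?mulr_gt0 // => ze.
  have := rP z zr; rewrite !subr0 mul1r ler_norml => /andP[h1 _].
  have := dotp_ge (2 *: (x - y - 0)) (z - (x - y)); rewrite !subr0 => h2.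
  have h3 : - (C * enorm (z - (x - y))) <= dotp z z - dotp (x - y) (x - y).
    by rewrite /C subr0; lra.
  have h4 : N * - (C * enorm (z - (x - y))) <= N * (dotp z z - dotp (x - y) (x - y)).
    by rewrite ler_pM2l.
  have := mulrA N C (enorm (z - (x - y))); rewrite mulrBr in h4; lra.
exists ([set x' | enorm (x' - x) < Num.min r1 (Num.min r3 (r4 / 2))],
        [set y' | enorm (y' - y) < Num.min r2 (r4 / 2)]) => /=.
  split; apply/nbhs_enormP.
    exists (Num.min r1 (Num.min r3 (r4 / 2))) => //.
    by rewrite !lt_min r10 r30 divr_gt0.
  exists (Num.min r2 (r4 / 2)) => //; by rewrite !lt_min r20 divr_gt0.
move=> [x' y'] /= [+ +] [/KD Dx' /KD Dy']; rewrite !lt_min.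
move=> /andP[a1 /andP[a3 a4]] /andP[b2 b4].
have k1 := H1 x' Dx' a1; have k2 := H2 y' Dy' b2; have k3 := H3 x' Dx' a3.
have k4 : N * dotp (x - y) (x - y) - e < N * dotp (x' - y') (x' - y').
  apply: H4; have -> : x' - y' - (x - y) = (x' - x) + (y - y').
    by apply/rowP => i; rewrite !mxE; ring.
  apply: le_lt_trans (enormD _ _) _; rewrite (enormB y); lra.
have k5 : th * (g x - e / th) < th * g x' by rewrite ltr_pM2l.
have e5 : th * (g x - e / th) = th * g x - e by field; rewrite gt_eqF.
rewrite /doubled /=; rewrite e5 in k5.
have : 5 * e = c - doubled th N (x, y) by rewrite /e; field.
rewrite /doubled /=; lra.
Qed.

End Doubling.

(* The maxima M k of the doubled function with penalty 2 ^ k decrease to a finite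
   limit, so some drop M k - M (k + 1) is small; it dominates half the penalty. *)
Lemma doubling (R : realType) (n : nat) (D : set 'rV[R]_n) (u v g : 'rV[R]_n -> R)
    (x0 : 'rV[R]_n) (s th e : R) :
  closed D -> usc_on D u -> lsc_on D v -> lsc_on D g ->
  (forall x, D x -> u x <= 1) -> (forall x, D x -> 0 <= v x) ->
  (forall x, D x -> 0 <= g x) ->
  (forall c, exists r, forall x, D x -> g x <= c -> enorm x <= r) ->
  0 < s -> 0 < th -> 0 < e -> D x0 -> s <= u x0 - v x0 - th * g x0 ->
  exists N x y, [/\ 1 <= N, D x /\ D y, s <= doubled u v g th N (x, y),
    forall x' y', D x' -> D y' ->
      doubled u v g th N (x', y') <= doubled u v g th N (x, y)
    & N * dotp (x - y) (x - y) <= 2 * e].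
Proof.
move=> Dcl uu vl gl u1 v0 g0 gb s0 th0 e0 Dx0 hs0.
have Phi0 N : s <= doubled u v g th N (x0, x0).
  by rewrite /doubled /= subrr dotp0l mulr0 subr0.
have [r hr] := gb (1 / th).
pose K := D `&` [set x | enorm (x - 0) <= r + 1].
have Kcl : closed K by apply: closedI => //; exact: closed_enorm_ball.
have KB : K `<=` [set x | enorm (x - 0) <= r + 1] by move=> y [].
have Kc : compact K := subclosed_compact Kcl (compact_enorm_ball 0 (r + 1)) KB.
have KD : K `<=` D by move=> y [].
have dE N x y : doubled u v g th N (x, y) =
    u x - v y - th * g x - N * dotp (x - y) (x - y) by [].
(* Only pairs of value at least s > 0 matter. For them th * g(x) <= 1 and, as N >= 1, |x - y| <= 1;
   hence a maximum over K x K is one over D x D. *)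
have inK N q : 1 <= N -> D q.1 -> D q.2 -> s <= doubled u v g th N q -> (K `*` K) q.
  case: q => x y /= N1 Dx Dy; rewrite dE => hs.
  have q1 := u1 _ Dx; have q2 := v0 _ Dy; have q3 := dotp_ge0 (x - y).
  have q5 : 0 <= th * g x by rewrite mulr_ge0 ?g0 // ltW.
  have q6 := ler_peMl q3 N1.
  have tg : th * g x <= 1 by clear - hs q1 q2 q3 q6 s0; lra.
  have xr : enorm x <= r by apply: hr => //; rewrite ler_pdivlMr // mulrC.
  have dd : dotp (x - y) (x - y) <= 1 by clear - hs q1 q2 q5 q6 s0; lra.
  have xy : enorm (x - y) <= 1.
    by rewrite -(expr_le1 (ltn0Sn 1)) ?enorm_ge0 // sqr_enorm.
  have yr := enorm_le_dist y x; rewrite enormB in yr.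
  by split; split => //=; rewrite subr0; clear - xr xy yr; lra.
have maxN N : 1 <= N -> exists q, [/\ D q.1, D q.2, s <= doubled u v g th N q &
    forall q', D q'.1 -> D q'.2 -> doubled u v g th N q' <= doubled u v g th N q].
  move=> N1; have N0 : 0 < N by apply: lt_le_trans N1.
  have [_ xK] := inK N (x0, x0) N1 Dx0 Dx0 (Phi0 N).
  have [||q [Kq1 Kq2] qm] := @usc_compact_max _ _ _ (doubled u v g th N) (compact_setX Kc Kc).
  - by exists (x0, x0).
  - exact: (doubled_usc uu vl gl th0 N0 KD).
  have sq : s <= doubled u v g th N q by apply: le_trans (Phi0 N) _; exact: qm.
  exists q; split => //; [exact: KD|exact: KD|] => q' D1 D2.
  have [h'|h'] := leP s (doubled u v g th N q'); last exact: ltW (lt_le_trans h' sq).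
  by apply: qm; exact: inK h'.
have N1 k : 1 <= 2 ^+ k :> R by rewrite exprn_ege1 // ler1n.
have [q qP] := choice (fun k => maxN _ (N1 k)).
have Mb k : s <= doubled u v g th (2 ^+ k) (q k) <= 1.
  have [D1 D2 -> _] := qP k; case: (q k) D1 D2 => x y /= D1 D2; rewrite dE.
  have p0 : 0 <= 2 ^+ k :> R by exact: le_trans (N1 k).
  have h1 := u1 _ D1; have h2 := v0 _ D2.
  have h3 := mulr_ge0 p0 (dotp_ge0 (x - y)); have h4 := mulr_ge0 (ltW th0) (g0 _ D1).
  by clear - h1 h2 h3 h4; lra.
have [k _ Mk] := bounded_small_drop 0 Mb e0.
have [D1 D2 sM qm] := qP k.+1; have [_ _ _ /(_ _ D1 D2) qk] := qP k.
move: D1 D2 sM qm qk Mk; case: (q k.+1) => x y /= D1 D2 sM qm qk Mk.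
exists (2 ^+ k.+1), x, y; split => //.
  by move=> x' y' Dx' Dy'; exact: (qm (x', y')).
by move: qk Mk; rewrite !dE exprS; clear; lra.
Qed.

Lemma comparison (R : realType) (n m : nat)
  (f : 'rV[R]_n -> 'rV[R]_m -> 'rV[R]_n) (h : 'rV[R]_n -> 'rV[R]_m -> R)
  (A : set 'rV[R]_m) (T : set 'rV[R]_n)
  (Ac : compact A) (T0 : T !=set0) (Tcl : closed T) (bc : compact (bdry T))
  (f_lip : forall r, 0 < r -> exists2 L, 0 < L &
     forall x1 x2 a, enorm x1 <= r -> enorm x2 <= r -> A a ->
       enorm (f x1 a - f x2 a) <= L * enorm (x1 - x2))
  (h_cont : {within setT `*` A, continuous (fun q => h q.1 q.2)})
  (h_ge0 : forall x a, A a -> 0 <= h x a)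
  (g : 'rV[R]_n -> R) (G : 'rV[R]_n -> 'rV[R]_n)
  (gG : comparison_barrier f h A T g G)
  (u v : 'rV[R]_n -> R)
  (uu : usc_on (~` interior T) u) (vl : lsc_on (~` interior T) v)
  (u1 : forall x, ~ interior T x -> u x <= 1) (v0 : forall x, ~ interior T x -> 0 <= v x)
  (ub : forall x, bdry T x -> u x <= 0)
  (usub : viscosity_subsolution (hamiltonian f h A) (~` T) u)
  (vsup : viscosity_supersolution (hamiltonian f h A) (~` T) v) x :
  ~ interior T x -> u x <= v x.
Proof.
move=> Dx0; rewrite leNgt; apply/negP => vu; move: x Dx0 vu => x0 Dx0 vu.
have [gC g0 gc gb gs] := gG.
have [s [s0 sE]] : exists s, 0 < s /\ 2 * s = u x0 - v x0.
  by exists ((u x0 - v x0) / 2); rewrite divr_gt0 ?subr_gt0 //; split=> //; field.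
(* Within distance r0 of T one has u < s, whereas u x - v y >= s at the doubled maximum and v >= 0:
   the point x stays away from T. *)
have [r0 r00 hr0] := usc_bdry_small T0 Tcl bc uu ub s0.
have r02 : 0 < r0 / 2 by rewrite divr_gt0.
have g1 : 0 < g x0 + 1 by rewrite ltr_wpDl // g0.
(* The bound s / (g x0 + 1) on th leaves at least s of the gap 2 s at x0. *)
have [th /andP[th0 ths] [c c0 hc]] := gs s (r0 / 2) _ s0 r02 (divr_gt0 s0 g1).
have hs0 : s <= u x0 - v x0 - th * g x0.
  rewrite ler_pdivlMr // in ths; clear - ths th0 sE; lra.
have [r hr] := gb (1 / th).
have rp : 0 < `|r| + 1 by rewrite ltr_wpDl.
have [L L0 hL] := f_lip _ (addr_gt0 rp ltr01).
have [dh dh0 hdh] := joint_uniform Ac h_cont (`|r|) (divr_gt0 c0 (ltr0n _ 4)).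
have [d [d0 [dr dd1 dd2]]] : exists d, 0 < d /\ [/\ d <= r0 / 2, d <= dh & d <= 1].
  exists (Num.min (r0 / 2) (Num.min dh 1)); rewrite !lt_min dh0 ltr01 r02.
  by split=> //; rewrite !ge_min !lexx ?orbT.
(* As N |x - y|^2 <= 2 e, the first bound gives |x - y| < d and the second N L |x - y|^2 <= c /
   8. *)
have [e [e0 [ed ec]]] : exists e, 0 < e /\ e <= d ^+ 2 / 4 /\ e <= c / (16 * L).
  exists (Num.min (d ^+ 2 / 4) (c / (16 * L))).
  by rewrite lt_min !divr_gt0 ?exprn_gt0 ?mulr_gt0 // !ge_min !lexx orbT.
have [N [x [y [N1 [D1 D2] sM qm Nd]]]] :=
  doubling (@D_closed _ _ T) uu vl (continuous_lsc gc) u1 v0 g0 gb s0 th0 e0 Dx0 hs0.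
have dE x' y' : doubled u v g th N (x', y') =
    u x' - v y' - th * g x' - N * dotp (x' - y') (x' - y') by [].
rewrite dE in sM.
have N0 : 0 < N := lt_le_trans ltr01 N1.
have vy0 := v0 _ D2; have ux1 := u1 _ D1.
have dxy := dotp_ge0 (x - y); have Nxy := ler_peMl dxy N1.
have tg : 0 <= th * g x by rewrite mulr_ge0 ?g0 // ltW.
have suv : s <= u x - v y by clear - sM dxy Nxy tg; lra.
have xr : enorm x <= r.
  apply: hr => //; rewrite ler_pdivlMr // mulrC.
  by clear - sM dxy Nxy tg s0 vy0 ux1; lra.
have xyd : enorm (x - y) < d.
  rewrite -(ltr_pXn2r (ltn0Sn 1)) ?nnegrE ?enorm_ge0 ?(ltW d0) // sqr_enorm.
  by have := exprn_gt0 2 d0; clear - Nxy Nd ed; lra.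
have e2 : e * L <= c / 16.
  by rewrite -ler_pdivlMr //; apply: le_trans ec _; rewrite invfM mulrA.
have dx : r0 <= dist T x.
  rewrite leNgt; apply/negP => /(hr0 x D1); clear - suv vy0; lra.
have dy : 0 < dist T y.
  by have := dist_lip T0 x y; clear - dx r00 xyd dr; lra.
have Tx : ~ T x by apply: (dist_gt0_notin T0); exact: lt_le_trans dx.
have Ty := dist_gt0_notin T0 dy.
have [rx rx0 hx] := notT_open Tcl Tx; have [ry ry0 hy] := notT_open Tcl Ty.
have phiC : C1_with (~` T) (fun z => N * dotp (z - y) (z - y) + th * g z)
    (fun z => N *: (2 *: (z - y)) + th *: G z).
  by apply: C1_withD; apply: C1_withZ => //; exact: C1_with_sq.
have psiC : C1_with (~` T) (fun z => - N * dotp (z - x) (z - x))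
    (fun z => - N *: (2 *: (z - x))).
  by apply: C1_withZ; exact: C1_with_sq.
have Hsub := subsol_test usub phiC Tx rx0.
have Hsup := supersol_test vsup psiC Ty ry0.
have sqC (w z : 'rV[R]_n) : dotp (w - z) (w - z) = dotp (z - w) (z - w).
  by rewrite -(opprB z w) dotpNl dotpNr opprK.
(* The supersolution supplies one nearly optimal control; the subsolution inequality holds for every
   control and is then read at this one. *)
have [||a Aa ha] := Hsup (c / 4).
- move=> z zy; have Dz : ~ interior T z by apply: not_T_D; exact: hy.
  by have := qm x z D1 Dz; rewrite !dE (sqC x z) (sqC x y); clear; lra.
- by rewrite divr_gt0.
have {Hsub} s2 : - dotp (N *: (2 *: (x - y)) + th *: G x) (f x a) - h x a + h x a * u x <= 0.
  apply: Hsub Aa => z zx; have Dz : ~ interior T z by apply: not_T_D; exact: hx.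
  by have := qm z y Dz D2; rewrite !dE; clear; lra.
have s1 := hc x a Tx Aa (le_trans (_ : r0 / 2 <= r0) dx).
have {}s1 : c <= s * h x a - th * dotp (G x) (f x a).
  by apply: s1; clear - r00; lra.
have sh := ler_wpM2r (h_ge0 x a Aa) suv.
have /ltW : `|h y a - h x a| < c / 4.
  by apply: hdh => //; [exact: le_trans xr (ler_norm r)|rewrite enormB; exact: lt_le_trans dd1].
rewrite ler_norml => /andP[hh1 hh2].
have v1 : 0 <= 1 - v y by clear - suv s0 ux1; lra.
have kk : (h x a - h y a) * (1 - v y) <= c / 4.
  apply: (@le_trans _ _ (c / 4 * (1 - v y))); last first.
    by rewrite ler_piMr ?divr_ge0 ?gerBl // ltW.
  by rewrite ler_wpM2r //; clear - hh1; lra.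
have fL : dotp (x - y) (f x a) - dotp (x - y) (f y a) <= L * dotp (x - y) (x - y).
  rewrite -dotpBr; apply: le_trans (dotp_le _ _) _.
  rewrite -sqr_enorm expr2 mulrCA ler_wpM2l ?enorm_ge0 //.
  have rr := ler_norm r; have := enorm_le_dist y x; rewrite (enormB y) => yx.
  by apply: hL => //; clear - rr yx xr xyd dd2; lra.
have NL : N * (dotp (x - y) (f x a) - dotp (x - y) (f y a)) <= c / 8.
  apply: (@le_trans _ _ (N * (L * dotp (x - y) (x - y)))); first by rewrite ler_pM2l.
  rewrite mulrCA; apply: (@le_trans _ _ (L * (2 * e))); first by rewrite ler_pM2l.
  by clear - e2; lra.
(* Subtracting the two tests bounds s h - th <G, f> by three errors of c / 4: the test itself, the
   modulus of h and the Lipschitz term. The barrier makes it at least c. *)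
rewrite -(opprB x y) in ha; rewrite !dotpZl dotpNl in ha.
rewrite dotpDl !dotpZl in s2; move: ha s1 s2 NL sh kk; clear - c0.
move: (dotp (G x) (f x a)) (dotp (x - y) (f x a)) (dotp (x - y) (f y a)).
move: (u x) (v y) (h x a) (h y a) => ux vy hx hy p q1 q2.
lra.
Qed.

(** * Coercive functions for the comparison principle *)

Section Barriers.
Context {R : realType} {n m : nat}.
Variables (f : 'rV[R]_n -> 'rV[R]_m -> 'rV[R]_n) (h : 'rV[R]_n -> 'rV[R]_m -> R)
  (A : set 'rV[R]_m) (T : set 'rV[R]_n).
Hypothesis h_ge0 : forall x a, A a -> 0 <= h x a.

Lemma increasing_modulus_le (c : R -> R) r s : increasing_modulus c ->
  0 < r -> r <= s -> c r <= c s.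
Proof.
move=> [_ cm _] r0; rewrite le_eqVlt => /orP[/eqP->//|rs].
by apply/ltW/cm => //; rewrite in_itv /= andbT // (lt_trans r0).
Qed.

(** Strictness comes from the decrease of U along every velocity, and h enters with its sign only;
    coercivity is properness of U. *)
Lemma SC1_barrier : SC1 f A T -> exists g G, comparison_barrier f h A T g G.
Proof.
move=> [U [c cm [[U0 Uc] UC _ Up Us]]].
exists U, (grad U); split => //; first exact: C1_on_with.
- move=> b; have Kc : compact `[0, `|b|]%classic := @segment_compact R 0 `|b|.
  have [|r _ hr] := compact_enorm_bounded (Up _ Kc _).
    by move=> y /=; rewrite in_itv /= => /andP[].
  exists r => x Dx xb; apply: hr; split => //=.
  by rewrite in_itv /= U0 // (le_trans xb) // ler_norm.
- move=> s r t s0 r0 t0; exists t; first by rewrite t0 lexx.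
  have [_ _ cp] := cm.
  exists (t * c r); first by rewrite mulr_gt0 // cp.
  move=> x a Tx Aa rd.
  have hg : dotp (grad U x) (f x a) <= - c (dist T x).
    rewrite -lee_fin; apply: le_trans (Us x Tx).
    by apply: ereal_sup_ubound; exists a.
  have := increasing_modulus_le cm r0 rd; have := h_ge0 x Aa => h1 h2.
  have : t * c r <= - (t * dotp (grad U x) (f x a)).
    by rewrite -mulrN ler_pM2l //; lra.
  have : 0 <= s * h x a by rewrite mulr_ge0 // ltW.
  lra.
Qed.

(** The logarithm makes <G, f> bounded, since |G| = 2 |x| / (1 + |x|^2) meets the growth M (1 +
    |x|). A small multiple of g is then absorbed by s h >= s e c(r). *)
Lemma SC2_barrier (h' : 'rV[R]_n -> 'rV[R]_m -> R) e : SC2 h' A T -> 0 < e ->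
  (forall x a, A a -> e * h' x a <= h x a) ->
  (exists2 M : R, 0 < M & forall x a, A a -> enorm (f x a) <= M * (1 + enorm x)) ->
  exists g G, comparison_barrier f h A T g G.
Proof.
move=> [c cm hc] e0 hh [M M0 hM].
pose q x : R := 1 + dotp (x - 0 : 'rV[R]_n) (x - 0).
have q1 x : 1 <= q x by rewrite lerDl dotp_ge0.
have q0 x : 0 < q x by apply: lt_le_trans (q1 x).
pose G x := (q x)^-1 *: (0 + 2 *: (x - 0)).
have qG x : has_grad (@ln R \o q) x (G x).
  apply: has_grad_comp; last by apply: is_derive1_ln.
  by apply: has_gradD; [exact: has_grad_cst|exact: has_grad_sq].
exists (@ln R \o q), G; split.
- split=> [x _ //|x _ d d0].
  (* A bound for |G y - G x| / |y - x| when |y - x| < 1. *)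
  pose C := 2 + 2 * enorm x * (2 * enorm x + 1).
  have C0 : 0 < C.
    by rewrite ltr_pwDl // !mulr_ge0 ?addr_ge0 ?mulr_ge0 ?enorm_ge0.
  exists (Num.min 1 (d / C)); first by rewrite lt_min ltr01 divr_gt0.
  move=> y _; rewrite lt_min => /andP[y1]; rewrite ltr_pdivlMr // => yd.
  apply: le_lt_trans yd.
  have -> : G y - G x = (2 * (q y)^-1) *: (y - x) + (2 * ((q y)^-1 - (q x)^-1)) *: x.
    by apply/rowP => i; rewrite /G !mxE !subr0 !add0r; ring.
  apply: le_trans (enormD _ _) _; rewrite !enormZ !normrM (ger0_norm (ler0n _ 2)).
  have qy : `|(q y)^-1| <= 1.
    by rewrite ger0_norm ?invr_ge0 ?(ltW (q0 y)) // invf_le1.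
  have qx : `|(q x)^-1| <= 1.
    by rewrite ger0_norm ?invr_ge0 ?(ltW (q0 x)) // invf_le1.
  have qq : `|(q y)^-1 - (q x)^-1| <= enorm (y - x) * (2 * enorm x + 1).
    have -> : (q y)^-1 - (q x)^-1 = (q y)^-1 * (q x)^-1 * - dotp (y - x) (y + x).
      have -> : - dotp (y - x) (y + x) = q x - q y.
        by rewrite /q !subr0 dotpBl !dotpDr (dotpC x y); ring.
      by field; rewrite !gt_eqF.
    rewrite normrM normrN normrM.
    apply: (@le_trans _ _ (1 * `|dotp (y - x) (y + x)|)).
      by rewrite ler_wpM2r // -(mulr1 1) ler_pM.
    rewrite mul1r; apply: le_trans (cauchy_schwarz _ _) _.
    rewrite ler_wpM2l ?enorm_ge0 //; have := enormD y x.
    have := enorm_le_dist y x; lra.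
  rewrite /C mulrDr; apply: lerD.
    by rewrite mulrC ler_wpM2l ?enorm_ge0 //; lra.
  have := enorm_ge0 x; move: qq.
  move: `|_ - _| (enorm x) (enorm (y - x)) => a b c'; nra.
- by move=> x _ /=; exact: ln_ge0.
- apply: continuous_in_subspaceT => x _; apply: differentiable_continuous.
  by have /has_gradP[] := qG x.
- move=> b; exists (expR b) => x _ /= xb.
  have : q x <= expR b by rewrite -(lnK (q0 x)) ler_expR.
  rewrite /q subr0 -sqr_enorm; have := sqr_ge0 (enorm x - 1); nra.
move=> s r t s0 r0 t0; have [_ _ cp] := cm.
have se : 0 < s * (e * c r) by rewrite !mulr_gt0 // cp.
(* With <G, f> <= 4 M this th costs at most half of s e c(r). *)
exists (Num.min t (s * (e * c r) / (8 * M))).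
  by rewrite lt_min t0 ge_min lexx divr_gt0 // mulr_gt0.
set th := Num.min _ _; have th0 : 0 < th by rewrite lt_min t0 divr_gt0 // mulr_gt0.
have thM : th * (8 * M) <= s * (e * c r).
  by rewrite -ler_pdivlMr ?mulr_gt0 // ge_min lexx orbT.
exists (s * (e * c r) / 2); first by rewrite divr_gt0.
move=> x a Tx Aa rd.
have h1 : s * (e * c r) <= s * h x a.
  rewrite ler_pM2l //; apply: le_trans (hh x a Aa); rewrite ler_pM2l //.
  by apply: le_trans (hc x a Tx Aa); exact: increasing_modulus_le.
have h2 : dotp (G x) (f x a) <= 4 * M.
  apply: le_trans (dotp_le _ _) _.
  rewrite /G add0r !enormZ ger0_norm ?invr_ge0 ?(ltW (q0 x)) //.
  rewrite (ger0_norm (ler0n _ 2)) subr0 -!mulrA ler_pdivrMl //.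
  have hx := hM x a Aa; have ex := enorm_ge0 x.
  apply: (@le_trans _ _ (2 * (enorm x * (M * (1 + enorm x))))).
    by rewrite ler_pM2l // ler_wpM2l.
  have -> : q x * (4 * M) = M * (4 * (1 + enorm x ^+ 2)).
    by rewrite /q subr0 -sqr_enorm; ring.
  have -> : 2 * (enorm x * (M * (1 + enorm x))) = M * (2 * enorm x * (1 + enorm x)).
    by ring.
  by rewrite ler_pM2l //; nra.
have h3 : th * dotp (G x) (f x a) <= th * (4 * M) by rewrite ler_pM2l.
lra.
Qed.

End Barriers.

(** * Semiconcave functions and Minimum Restraint Functions *)

Section Semiconcave.
Context {R : realType} {n : nat}.
Variables (D : set 'rV[R]_n) (U : 'rV[R]_n -> R).
Hypotheses (Do : open D) (Usc : semiconcave_locally D U)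
  (Uc : {within D, continuous U}).
Implicit Types (x y z p : 'rV[R]_n).

Lemma has_grad_lin p z x : has_grad (fun y => dotp p (y - z)) x p.
Proof.
move=> e e0; exists 1 => // y _; rewrite -dotpBr opprB addrA subrK subrr normr0.
by rewrite mulr_ge0 ?enorm_ge0 // ltW.
Qed.

(* The touching inequality at y and at its reflection 2z - y, combined with
   semiconcavity on the segment between them, bounds U from both sides. *)
Lemma semiconcave_touch phi z p r : D z -> has_grad phi z p -> 0 < r ->
  (forall y, enorm (y - z) < r -> U z - phi z <= U y - phi y) -> has_grad U z p.
Proof.
move=> Dz phip r0 tch e e0; have [s [c [s0 hs]]] := Usc Dz.
have e2 : 0 < e / 2 by rewrite divr_gt0.
have [d d0 hd] := phip _ e2.
(* For |y - z| < t the semiconcavity defect 4 c |y - z|^2 is at most (e / 2) |y - z|. *)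
pose t := e / (8 * (`|c| + 1)).
have c1 : 0 < `|c| + 1 by rewrite ltr_wpDl.
have t0 : 0 < t by rewrite divr_gt0 // mulr_gt0.
exists (Num.min (Num.min r s) (Num.min d t)); first by rewrite !lt_min r0 s0 d0.
move=> y; rewrite !lt_min => /andP[/andP[yr ys] /andP[yd yt]].
pose y' := z - (y - z).
have y'z : y' - z = - (y - z) by rewrite /y' addrC addKr.
have ny : enorm (y' - z) = enorm (y - z) by rewrite y'z enormN.
have [nr [ns nd]] : enorm (y' - z) < r /\ (enorm (y' - z) < s /\ enorm (y' - z) < d).
  by rewrite ny.
have [_ [_]] := hs y y' ys ns.
have -> : 2^-1 *: (y + y') = z.
  by apply/rowP => i; rewrite /y' !mxE; field.
have -> : y - y' = 2 *: (y - z).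
  by apply/rowP => i; rewrite /y' !mxE; ring.
rewrite enormZ ger0_norm // => hsc.
have t1 := tch y yr; have t2 := tch y' nr.
have d1 := hd y yd; have := hd y' nd.
rewrite ny y'z dotpNr; move: d1; rewrite !ler_norml => /andP[a1 a2] /andP[b1 b2].
have q : c * (2 * enorm (y - z)) ^+ 2 <= e / 2 * enorm (y - z).
  have -> : c * (2 * enorm (y - z)) ^+ 2 = 4 * (c * enorm (y - z)) * enorm (y - z).
    by ring.
  rewrite ler_wpM2r ?enorm_ge0 //.
  have h1 : c * enorm (y - z) <= (`|c| + 1) * enorm (y - z).
    by rewrite ler_wpM2r ?enorm_ge0 //; have := ler_norm c; lra.
  have h2 : (`|c| + 1) * enorm (y - z) <= (`|c| + 1) * t by rewrite ler_pM2l // ltW.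
  have h3 : (`|c| + 1) * t = e / 8 by rewrite /t; field; rewrite gt_eqF.
  lra.
by apply/andP; split; lra.
Qed.

(* A maximum point of <p, y - z> - |y - w|^2 / t - U(y) near w = z + t d is a point
   other than z at which a smooth function touches U from below. *)
Lemma semiconcave_near_gradient z p (d : 'rV[R]_n) e : D z -> has_grad U z p ->
  enorm d = 1 -> 0 < e -> exists y q, [/\ y <> z, enorm (y - z) < e,
    has_grad U y q & enorm (q - p) < e].
Proof.
move=> Dz Up d1 e0.
have /open_enormP /(_ z Dz)[rD rD0 hD] := Do.
(* The maximiser will satisfy |y - w|^2 <= 2 a t^2. Then a <= 1 / 4 gives |y - w| < t = |w - z|, so
   y is not z and lies inside the ball; a <= e^2 / 16 makes the gradient error 2 |y - w| / t less
   than e. *)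
pose a := Num.min (e ^+ 2 / 16) (1 / 4).
have a0 : 0 < a by rewrite lt_min !divr_gt0 // exprn_gt0.
have [s s0 hs] := Up (a / 2) (divr_gt0 a0 (ltr0n _ 2)).
pose t := Num.min (Num.min rD s) e / 4.
have t0 : 0 < t by rewrite divr_gt0 // !lt_min rD0 s0.
have [t1 t2 t3] : [/\ 4 * t <= rD, 4 * t <= s & 4 * t <= e].
  by rewrite /t mulrC divfK // !ge_min !lexx ?orbT.
pose w := z + t *: d.
have wz : enorm (w - z) = t by rewrite /w addrC addKr enormZ d1 mulr1 gtr0_norm.
pose psi y := U y - U z - dotp p (y - z).
have psib y : enorm (y - z) <= 2 * t -> `|psi y| <= a * t.
  move=> yt; have yts : enorm (y - z) < s by lra.
  apply: le_trans (hs y yts) _.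
  have := ler_wpM2l (ltW a0) yt; lra.
pose phi y := dotp p (y - z) + - (1 / t) * dotp (y - w) (y - w).
have phig y : has_grad phi y (p + - (1 / t) *: (2 *: (y - w))).
  by apply: has_gradD; [exact: has_grad_lin|exact/has_gradZ/has_grad_sq].
have [|||y Ky ym] := @usc_on_max R n _ D (fun y => phi y - U y) _ _
    (compact_enorm_ball z (2 * t)).
- by move=> y /= yt; apply: hD; lra.
- apply: continuous_usc => /=; apply/within_continuous_enormP => x Dx b b0.
  have b2 : 0 < b / 2 by rewrite divr_gt0.
  move/within_continuous_enormP: (Uc) => /(_ x Dx _ b2)[r1 r10 H1].
  have /has_gradP[/differentiable_continuous pc _] := phig x.
  have /within_continuous_enormP /(_ x I _ b2)[r2 r20 H2] : {within setT, continuous phi}.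
    apply: continuous_in_subspaceT => v _; apply: differentiable_continuous.
    by have /has_gradP[] := phig v.
  exists (Num.min r1 r2); first by rewrite lt_min r10.
  move=> y Dy; rewrite lt_min => /andP[y1 y2].
  have := H1 y Dy y1; have := H2 y I y2; rewrite !ltr_norml.
  by move=> /andP[? ?] /andP[? ?]; apply/andP; split; lra.
- by exists z => /=; rewrite subrr enorm0 mulr_ge0 // ltW.
have wm := ym w; rewrite /= wz in wm.
have {}wm : phi w - U w <= phi y - U y by apply: wm; lra.
have yw2 : dotp (y - w) (y - w) <= 2 * a * t ^+ 2.
  have := psib y Ky; have := psib w; rewrite wz => /(_ _) pw.
  have {}pw : `|psi w| <= a * t by apply: pw; lra.
  move: pw; rewrite !ler_norml /psi => /andP[p1 p2] /andP[p3 p4].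
  move: wm; rewrite /phi subrr dotp0r mulr0 addr0 mulNr mul1r => wm.
  have : t^-1 * dotp (y - w) (y - w) <= 2 * a * t by lra.
  by rewrite ler_pdivrMl // => h; apply: le_trans h _; rewrite le_eqVlt;
    apply/orP; left; apply/eqP; ring.
have aa1 : a <= 1 / 4 by rewrite ge_min lexx orbT.
have aa2 : a <= e ^+ 2 / 16 by rewrite ge_min lexx.
have tt : 0 < t ^+ 2 by rewrite exprn_gt0.
have ywt : enorm (y - w) < t.
  rewrite -(ltr_pXn2r (ltn0Sn 1)) ?nnegrE ?enorm_ge0 ?(ltW t0) // sqr_enorm.
  nra.
exists y, (p + - (1 / t) *: (2 *: (y - w))); split.
- move=> yz; move: ywt; rewrite yz enormB wz ltxx //.
- by have := enorm_sub_le y w z; rewrite wz; lra.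
- have yz : enorm (y - z) < 2 * t by have := enorm_sub_le y w z; rewrite wz; lra.
  apply: (@semiconcave_touch phi _ _ (2 * t - enorm (y - z))).
  + by apply: hD; lra.
  + exact: phig.
  + by rewrite subr_gt0.
  + move=> v vy; have vK : enorm (v - z) <= 2 * t.
      by have := enorm_sub_le v y z; lra.
    have := ym v vK; lra.
- rewrite addrC addKr scalerA enormZ.
  rewrite -(ltr_pXn2r (ltn0Sn 1)) ?nnegrE ?mulr_ge0 ?enorm_ge0 ?(ltW e0) //.
  rewrite exprMn sqr_enorm real_normK ?num_real //.
  have -> : (- (1 / t) * 2) ^+ 2 = 4 / t ^+ 2 by field; rewrite gt_eqF.
  rewrite mulrAC ltr_pdivrMr //; nra.
Qed.

Lemma semiconcave_limiting z p (d : 'rV[R]_n) : D z -> has_grad U z p -> enorm d = 1 ->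
  limiting_gradient U z p.
Proof.
move=> Dz Up d1.
have E k : exists y, [/\ y <> z, enorm (y - z) < k.+1%:R^-1, differentiable U y &
    enorm (grad U y - p) < k.+1%:R^-1].
  have [|y [q [yz ye Uq qe]]] := @semiconcave_near_gradient z p d k.+1%:R^-1 Dz Up d1.
    by rewrite invr_gt0.
  by exists y; have /has_gradP[Ud Uq'] := Uq; rewrite Uq'.
pose u k := projT1 (cid (E k)); have uP k := projT2 (cid (E k)).
have small (e : R) : 0 < e -> \forall k \near \oo, k.+1%:R^-1 < e.
  by move=> e0; exact: near_infty_natSinv_lt (PosNum e0).
exists u; split.
- by move=> k; have [] := uP k.
- move=> P /nbhs_enormP[r r0 rP]; have := small r r0.
  apply: filterS => k kr; apply: rP; have [_ h _ _] := uP k; exact: lt_trans kr.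
- move=> P /nbhs_enormP[r r0 rP]; have := small r r0.
  apply: filterS => k kr; apply: rP; have [_ _ _ h] := uP k; exact: lt_trans kr.
Qed.

End Semiconcave.

Section MRF.
Context {R : realType} {n m : nat}.
Variables (f : 'rV[R]_n -> 'rV[R]_m -> 'rV[R]_n) (h1 : 'rV[R]_n -> 'rV[R]_m -> R)
  (A : set 'rV[R]_m) (T : set 'rV[R]_n).
Hypotheses (T0 : T !=set0) (Tcl : closed T).

(** A direction to move in exists only if n > 0; a point outside T and a point of T guarantee it. *)
Lemma unit_vector (x z : 'rV[R]_n) : x <> z -> exists d : 'rV[R]_n, enorm d = 1.
Proof.
move=> xz; exists ((enorm (x - z))^-1 *: (x - z)).
have p : 0 < enorm (x - z) by apply: enorm_gt0; rewrite subr_eq0; apply/eqP.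
by rewrite enormZ ger0_norm ?invr_ge0 ?(ltW p) // mulVf // gt_eqF.
Qed.

Lemma within_O (Omega : set 'rV[R]_n) (U : 'rV[R]_n -> R) :
  {within Omega `\` interior T, continuous U} -> {within Omega `\` T, continuous U}.
Proof.
apply: continuous_subspaceW => x [Ox Tx]; split => //; exact: not_T_D.
Qed.

Lemma MRF_point Omega U (x p : 'rV[R]_n) phi r : open Omega ->
  {within Omega `\` interior T, continuous U} ->
  semiconcave_locally (Omega `\` T) U -> forall k, 
  (forall x, (Omega `\` T) x -> forall p, limiting_gradient U x p ->
          (ereal_inf [set (dotp p (f x a) + k * h1 x a)%:E | a in A] < 0)%E) ->
  (Omega `\` T) x -> has_grad phi x p -> 0 < r ->
  (forall y, enorm (y - x) < r -> U x - phi x <= U y - phi y) ->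
  exists2 a, A a & dotp p (f x a) + k * h1 x a < 0.
Proof.
move=> Oo Uc Us k hk Ox phip r0 hr.
have Up := semiconcave_touch Us Ox phip r0 hr.
have [z Tz] := T0.
have [|d d1] := @unit_vector x z; first by move=> xz; apply: Ox.2; rewrite xz.
have Oo' : open (Omega `\` T) by apply: openI => //; rewrite openC.
have lg := semiconcave_limiting Oo' Us (within_O Uc) Ox Up d1.
have /ereal_inf_lt[_ [a Aa <-]] := hk x Ox p lg.
by rewrite lte_fin => ?; exists a.
Qed.

(* A quadratic touches U from below somewhere, and at such a point the infimum
   over A is negative, hence A is not empty. *)
Lemma LACL_control x : LACL f h1 A T -> ~ T x -> A !=set0.
Proof.
move=> [Om [U [Oo TO [[U0 Uc] Us _ _ [k k0 hk]]]]] Tx.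
have [b bb _] := nearest_bdry T0 Tcl Tx.
have Tb := bdry_T Tcl bb.
have /open_enormP /(_ b (TO b Tb))[r r0 hr] := Oo.
have [z zb Tz] : exists2 z, enorm (z - b) < r & ~ T z.
  apply: contrapT => H; apply: bb.2; apply/nbhs_enormP; exists r => // z zb.
  by apply: contrapT => Tz; apply: H; exists z.
have Oz : (Om `\` T) z by split => //; exact: hr.
have Oo' : open (Om `\` T) by apply: openI => //; rewrite openC.
have /open_enormP /(_ z Oz)[s s0 hs] := Oo'.
(* On the sphere of radius s / 2 the penalty is U z + 1, more than U z, so the maximum lies inside
   the ball. *)
pose N := (U z + 1) / (s / 2) ^+ 2.
have s20 : 0 < (s / 2) ^+ 2 by rewrite exprn_gt0 // divr_gt0.
have Uz0 : 0 <= U z by apply: U0; split; [exact: Oz.1|exact: not_T_D Oz.2].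
have [|||y Ky ym] := @usc_on_max R n _ (Om `\` T)
    (fun y => - U y - N * dotp (y - z) (y - z)) _ _ (compact_enorm_ball z (s / 2)).
- by move=> y /= yz; apply: hs; lra.
- apply: continuous_usc => x' /=.
  have Nc : {within Om `\` T, continuous (fun y => N * dotp (y - z) (y - z))}.
    apply: continuous_in_subspaceT => v _; apply: differentiable_continuous.
    by have /has_gradP[] := has_gradZ N (has_grad_sq z v).
  apply: cvgB; last exact: Nc.
  by apply: cvgN; exact: (within_O Uc).
- by exists z => /=; rewrite subrr enorm0 divr_ge0 // ltW.
have Oy : (Om `\` T) y by apply: hs; move: Ky => /=; lra.
have yz : enorm (y - z) < s / 2.
  rewrite ltNge; apply/negP => h.
  have := ym z; rewrite /= subrr enorm0 dotp0l mulr0 subr0 => /(_ _) h2.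
  have {}h2 : - U z <= - U y - N * dotp (y - z) (y - z) by apply: h2; lra.
  have Uy0 : 0 <= U y by apply: U0; split; [exact: Oy.1|exact: not_T_D Oy.2].
  have : (s / 2) ^+ 2 <= dotp (y - z) (y - z).
    by rewrite -sqr_enorm ler_pXn2r // nnegrE ?enorm_ge0 // ltW // divr_gt0.
  have N0 : 0 <= N by rewrite divr_ge0 ?(ltW s20) // addr_ge0.
  move=> /(ler_wpM2l N0); rewrite {1}/N divfK ?gt_eqF //; lra.
have [||a Aa _] := @MRF_point Om U y _ (fun y => - N * dotp (y - z) (y - z))
    (s / 2 - enorm (y - z)) Oo Uc Us k hk Oy (has_gradZ (- N) (has_grad_sq z y)) _ _.
- by rewrite subr_gt0.
- move=> v vy; have vK : enorm (v - z) <= s / 2 by have := enorm_sub_le v y z; lra.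
  have := ym v vK; lra.
by exists a.
Qed.

(** For a gradient p of U / k the decrease condition reads - <p, f> - h1 > 0. Lowering h1 to any h
    between 0 and h1, and adding h Wb >= 0, keep the sign: one barrier serves all these costs. *)
Lemma MRF_barrier : LACL f h1 A T -> exists Wb : 'rV[R]_n -> R,
  [/\ forall x, ~ interior T x -> 0 <= Wb x <= 1,
      {within ~` interior T, continuous Wb},
      forall b, bdry T b -> Wb b = 0
    & forall h, (forall x a, A a -> 0 <= h x a <= h1 x a) ->
        viscosity_supersolution (hamiltonian f h A) (~` T) Wb].
Proof.
move=> HL; have [Om [U [Oo TO [[U0 Uc] Us [[_ Ub] Up] _ [k k0 hk]]]]] := HL.
have ki0 : 0 < k^-1 by rewrite invr_gt0.
pose Wb x := if `[< Om x >] then Num.min 1 (k^-1 * U x) else 1.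
have WbO x : Om x -> Wb x = Num.min 1 (k^-1 * U x) by rewrite /Wb => /asboolT ->.
have WbN x : ~ Om x -> Wb x = 1 by rewrite /Wb => /asboolF ->.
have Wb1 x : Wb x <= 1 by rewrite /Wb; case: ifP => _ //; rewrite ge_min lexx.
exists Wb; split.
- move=> x Dx; rewrite Wb1 andbT /Wb; case: asboolP => // Ox.
  by rewrite le_min ler01 mulr_ge0 ?(ltW ki0) // U0.
- apply/within_continuous_enormP => x Dx e e0.
  have [Ox|Ox] := pselect (Om x).
    move/within_continuous_enormP: (Uc) => /(_ x (conj Ox Dx) (k * e)).
    rewrite mulr_gt0 // => /(_ isT)[r r0 hr].
    have /open_enormP /(_ x Ox)[s s0 hs] := Oo.
    exists (Num.min r s); first by rewrite lt_min r0.
    move=> y Dy; rewrite lt_min => /andP[yr ys].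
    have Oy := hs y ys; have := hr y (conj Oy Dy) yr.
    rewrite !WbO // => hU.
    have h' : `|k^-1 * U y - k^-1 * U x| < e.
      by rewrite -mulrBr normrM gtr0_norm // ltr_pdivrMl.
    move: h'; rewrite !ltr_norml => /andP[a1 a2]; rewrite /Num.min.
    by do 2 case: ifPn; rewrite -?leNgt => b1 b2; apply/andP; split; lra.
  (* By properness the set where U <= k is closed in the whole space, so Wb = 1 in D near every
     point outside [Om]. *)
  have Kc : compact `[0, k]%classic := @segment_compact R 0 k.
  have K0 : `[0, k]%classic `<=` [set r : R | 0 <= r].
    by move=> y /=; rewrite in_itv /= => /andP[].
  have Scl := compact_closed (@norm_hausdorff _ _) (Up _ Kc K0).
  have /closed_enormP /(_ x)[|r r0 hr] := Scl; first by case=> -[/Ox].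
  exists r => // y Dy yr; rewrite (WbN x Ox).
  have [Oy|Oy] := pselect (Om y); last by rewrite WbN // subrr normr0.
  rewrite WbO // min_l ?subrr ?normr0 //.
  rewrite ler_pdivlMl // mulr1 leNgt; apply/negP => Uk.
  apply: (hr y yr); split => //=.
  by rewrite in_itv /= U0 // ltW.
- move=> b bb; rewrite WbO; last by apply: TO; exact: bdry_T.
  by rewrite Ub // mulr0 min_r.
move=> h hh; apply: supersol_intro => phi x r [phiG _] Tx r0 hm.
have phix := phiG x Tx.
(* Where Wb has its largest value 1, the test function has a local maximum: its gradient is 0 and
   the Hamiltonian reduces to - h + h = 0. *)
have [Wx|Wx] := ltP (Wb x) 1; last first.
  have Wx1 : Wb x = 1 by apply/eqP; rewrite eq_le Wb1.
  have -> : grad phi x = 0.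
    apply: (has_grad_max r0 phix) => y yr.
    by have := hm y yr; have := Wb1 y; lra.
  have [a Aa] := LACL_control HL Tx.
  by apply: (ham_ge0_intro Aa); rewrite Wx1 dotp0l oppr0 add0r mulr1 addNr.
have Ox : Om x by apply: contrapT => /WbN Wx1; rewrite Wx1 ltxx in Wx.
have WE : Wb x = k^-1 * U x.
  move: Wx; rewrite WbO // /Num.min; case: ifPn => //; rewrite ltxx //.
have /open_enormP /(_ x Ox)[s s0 hs] := Oo.
have [||a Aa ha] := @MRF_point Om U x _ (fun y => k * phi y)
    (Num.min r s) Oo Uc Us k hk (conj Ox Tx) (has_gradZ k phix) _ _.
- by rewrite lt_min r0.
- move=> y; rewrite lt_min => /andP[yr ys]; have := hm y yr.
  have Oy := hs y ys.
  have : Wb y <= k^-1 * U y by rewrite WbO // ge_min lexx orbT.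
  rewrite WE => h2 h3.
  have : k * (k^-1 * U x - phi x) <= k * (k^-1 * U y - phi y).
    by rewrite ler_pM2l //; lra.
  by rewrite !mulrBr !mulrA mulfV ?gt_eqF // !mul1r.
apply: (ham_ge0_intro Aa).
have /andP[a1 a2] := hh x a Aa.
move: ha; rewrite dotpZl -mulrDr pmulr_rlt0 // => ha.
have : 0 <= h x a * Wb x.
  by rewrite mulr_ge0 // WE mulr_ge0 ?(ltW ki0) // U0; split => //; exact: not_T_D.
lra.
Qed.

End MRF.

(** * Perron's method *)

Lemma has_grad_cont (R : realType) (n : nat) (g : 'rV[R]_n -> R) x p e :
  has_grad g x p -> 0 < e ->
  exists2 r, 0 < r & forall y, enorm (y - x) < r -> `|g y - g x| < e.
Proof.
move=> /has_gradP[gd _] e0.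
have /cvgrPdist_lt /(_ e e0) /(nbhs_enormP x)[r r0 hr] := differentiable_continuous gd.
by exists r => // y yr; rewrite distrC; exact: hr.
Qed.

Section HamiltonianContinuity.
Context {R : realType} {n m : nat}.
Variables (f : 'rV[R]_n -> 'rV[R]_m -> 'rV[R]_n) (h : 'rV[R]_n -> 'rV[R]_m -> R)
  (A : set 'rV[R]_m) (T : set 'rV[R]_n).
Hypotheses (Ac : compact A) (T0 : T !=set0) (Tcl : closed T) (bc : compact (bdry T))
  (f_lip : forall r, 0 < r -> exists2 L, 0 < L &
     forall x1 x2 a, enorm x1 <= r -> enorm x2 <= r -> A a ->
       enorm (f x1 a - f x2 a) <= L * enorm (x1 - x2))
  (f_growth : exists2 M : R, 0 < M &
     forall x a, A a -> enorm (f x a) <= M * (1 + enorm x))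
  (h_cont : {within setT `*` A, continuous (fun q => h q.1 q.2)})
  (h_ge0 : forall x a, A a -> 0 <= h x a).
Let D := ~` interior T.
Let Hval x p u a := - dotp p (f x a) - h x a + h x a * u.

(** Uniformity in a lets an inequality at x be carried to nearby points for all controls at once. *)
Lemma ham_cont x p s e : 0 < e -> exists2 d, 0 < d & forall y q t a,
  enorm (y - x) < d -> enorm (q - p) < d -> `|t - s| < d -> A a ->
  `|Hval y q t a - Hval x p s a| < e.
Proof.
move=> e0; have [M M0 hM] := f_growth.
have xr : 0 < enorm x + 1 by rewrite ltr_wpDl ?enorm_ge0.
have [L L0 hL] := f_lip xr.
have [C C0 hC] := joint_bounded Ac h_cont (enorm x + 1).
pose s1 := 1 + `|s|; have s10 : 0 < s1 by rewrite ltr_pwDl.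
have [dh dh0 hdh] := joint_uniform Ac h_cont (enorm x) (divr_gt0 e0 (mulr_gt0 (ltr0n R 4) s10)).
pose Cf := M * (2 + enorm x).
have Cf0 : 0 < Cf by rewrite mulr_gt0 // ltr_pwDl ?enorm_ge0.
pose p1 := enorm p + 1; have p10 : 0 < p1 by rewrite ltr_wpDl ?enorm_ge0.
pose d := Num.min (Num.min 1 dh) (Num.min (e / (4 * Cf))
  (Num.min (e / (4 * (p1 * L))) (e / (4 * C)))).
exists d.
  rewrite !lt_min ltr01 dh0 /=.
  by do !(apply/andP; split); apply: divr_gt0 => //; do !apply: mulr_gt0 => //.
move=> y q t a; rewrite !lt_min => /andP[/andP[y1 y2] /andP[_ /andP[y4 _]]].
move=> /andP[_ /andP[q3 _]] /andP[_ /andP[_ /andP[_ t5]]] Aa.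
have yr : enorm y <= enorm x + 1 by have := enorm_le_dist y x; lra.
have xx : enorm x <= enorm x + 1 by lra.
have fy : enorm (f y a) <= Cf.
  by apply: le_trans (hM y a Aa) _; rewrite ler_pM2l //; lra.
have k1 : `|dotp (q - p) (f y a)| <= e / 4.
  apply: le_trans (cauchy_schwarz _ _) _.
  apply: (@le_trans _ _ (enorm (q - p) * Cf)); first by rewrite ler_wpM2l ?enorm_ge0.
  by rewrite -ler_pdivlMr // -mulrA -invfM ltW.
have k2 : `|dotp p (f y a - f x a)| <= e / 4.
  apply: le_trans (cauchy_schwarz _ _) _.
  apply: (@le_trans _ _ (p1 * (L * enorm (y - x)))).
    apply: ler_pM; rewrite ?enorm_ge0 //; first by rewrite /p1 lerDl.
    exact: hL.
  by rewrite mulrA mulrC -ler_pdivlMr ?mulr_gt0 // -mulrA -invfM ltW.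
have k3 : `|(h y a - h x a) * (1 - s)| < e / 4.
  rewrite normrM; have := hdh x y a (lexx _) y2 Aa.
  rewrite invfM mulrA ltr_pdivlMr // => k; apply: le_lt_trans k.
  rewrite ler_wpM2l //; apply: le_trans (ler_normB _ _) _; by rewrite normr1.
have k4 : `|h y a * (t - s)| <= e / 4.
  rewrite normrM; apply: (@le_trans _ _ (C * `|t - s|)); first by rewrite ler_wpM2r // hC.
  by rewrite mulrC -ler_pdivlMr // -mulrA -invfM ltW.
have -> : Hval y q t a - Hval x p s a = - dotp (q - p) (f y a)
    - dotp p (f y a - f x a) - (h y a - h x a) * (1 - s) + h y a * (t - s).
  by rewrite /Hval dotpBl dotpBr; ring.
move: k1 k2 k3 k4; rewrite !ler_norml !ltr_norml.
by move=> /andP[? ?] /andP[? ?] /andP[? ?] /andP[? ?]; apply/andP; split; lra.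
Qed.

Lemma ham_neg x u p : ~ (0 <= hamiltonian f h A x u p)%E ->
  exists2 e, 0 < e & forall a, A a -> Hval x p u a <= - e.
Proof.
move=> /negP; rewrite -ltNge => hneg.
have up a : A a -> ((Hval x p u a)%:E <= hamiltonian f h A x u p)%E.
  by move=> Aa; apply: ereal_sup_ubound; exists a.
case: (hamiltonian f h A x u p) hneg up => [r|//|_ up].
  rewrite lte_fin => r0 up; exists (- r); first by rewrite oppr_gt0.
  by move=> a Aa; rewrite opprK -lee_fin; exact: up.
(* The supremum is [-oo] only for empty A, where any e will do. *)
by exists 1 => // a Aa; have := up a Aa; rewrite leeNy_eq.
Qed.

End HamiltonianContinuity.

(** A quadratic makes the maximum of V - phi at x strict. Some w in P comes within e of V x close to
    x, so w - phi1 has a maximum z near x; testing w there and letting [ham_cont] carry the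
    inequality to x contradicts a positive value at x. *)
Lemma subsolution_sup (R : realType) (n m : nat)
    (f : 'rV[R]_n -> 'rV[R]_m -> 'rV[R]_n) (h : 'rV[R]_n -> 'rV[R]_m -> R)
    (A : set 'rV[R]_m) (T : set 'rV[R]_n)
    (P : set ('rV[R]_n -> R)) (W : 'rV[R]_n -> R) :
  compact A -> closed T ->
  (forall r, 0 < r -> exists2 L, 0 < L &
     forall x1 x2 a, enorm x1 <= r -> enorm x2 <= r -> A a ->
       enorm (f x1 a - f x2 a) <= L * enorm (x1 - x2)) ->
  (exists2 M : R, 0 < M &
     forall x a, A a -> enorm (f x a) <= M * (1 + enorm x)) ->
  {within setT `*` A, continuous (fun q => h q.1 q.2)} ->
  (forall x, ~ interior T x -> 0 <= W x <= 1) ->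
  (forall w, P w -> usc_on (~` interior T) w /\
     viscosity_subsolution (hamiltonian f h A) (~` T) w) ->
  (forall w x, P w -> ~ interior T x -> w x <= W x) ->
  (forall x c, ~ interior T x -> c < W x -> exists2 w, P w & c < w x) ->
  viscosity_subsolution (hamiltonian f h A) (~` T) (usc_env (~` interior T) W).
Proof.
move=> Ac Tcl f_lip f_growth h_cont W01 Psub PW Plub.
have [V [WV Venv]] : exists V, (forall x, ~ interior T x -> W x <= V x) /\
    V = usc_env (~` interior T) W.
  by exists (usc_env (~` interior T) W); split => // x Dx; exact: (le_usc_env W01).
rewrite -Venv; apply: subsol_intro => phi x r phiG Tx r0 hm a Aa.
rewrite leNgt; apply/negP => pos.
have Dx : ~ interior T x := not_T_D Tx.
have [d d0 hd] := ham_cont Ac f_lip f_growth h_cont x (grad phi x) (V x) pos.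
have d2 : 0 < d / 2 by rewrite divr_gt0.
have phi1G : C1_with (~` T) (fun y => phi y + dotp (y - x) (y - x))
    (fun y => grad phi y + 2 *: (y - x)).
  by apply: C1_withD => //; exact: C1_with_sq.
have [phi1 phi1E] : exists phi1, forall y, phi1 y = phi y + dotp (y - x) (y - x).
  by exists (fun y => phi y + dotp (y - x) (y - x)).
have E1 : phi1 = (fun y => phi y + dotp (y - x) (y - x)) by apply/funext.
rewrite -E1 in phi1G.
have [rT rT0 hT] := notT_open Tcl Tx.
have [r1 r10 h1] := phi1G.2 x Tx d d0.
have [r2 r20 h2] := has_grad_cont (phiG.1 x Tx) d2.
have [rho [rho0 [[rho1 rho2 rho3] [rho4 rho5]]]] : exists rho, 0 < rho /\
    [/\ rho < r, rho < rT & rho < d] /\ rho < r1 /\ rho < r2.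
  pose q := Num.min (Num.min r rT) (Num.min (Num.min r1 r2) d).
  have q0 : 0 < q by rewrite !lt_min r0 rT0 r10 r20 d0.
  exists (q / 2); rewrite divr_gt0 //.
  have : q / 2 < q by clear - q0; lra.
  by rewrite !lt_min => /andP[/andP[-> ->] /andP[/andP[-> ->] ->]].
have inb y : enorm (y - x) <= rho -> [/\ enorm (y - x) < r, ~ T y, enorm (y - x) < d,
    enorm (grad phi y + 2 *: (y - x) - grad phi x) < d & `|phi y - phi x| < d / 2].
  move=> yr; have Ty : ~ T y by apply: hT; exact: le_lt_trans rho2.
  split => //; [exact: le_lt_trans rho1|exact: le_lt_trans rho3| |].
    by have := h1 y Ty (le_lt_trans yr rho4); rewrite subrr scaler0 addr0.
  by apply: h2; exact: le_lt_trans rho5.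
(* The maximiser z will satisfy |z - x|^2 <= 2 e, hence lies off the sphere of radius rho; the bound
   by d keeps w z within d of V x. *)
have [e [e0 [e1 e2]]] : exists e, 0 < e /\ 8 * e <= rho ^+ 2 /\ 8 * e <= d.
  exists (Num.min (rho ^+ 2) d / 8); rewrite divr_gt0 ?lt_min ?exprn_gt0 //.
  by rewrite mulrC divfK // !ge_min !lexx orbT.
have [r3 r30 h3] := has_grad_cont (phi1G.1 x Tx) e0.
have [y0 [Dy0 y0r y0W]] : exists y0, [/\ ~ interior T y0,
    enorm (y0 - x) < Num.min r3 rho & V x - e < W y0].
  apply: contrapT => H; have : V x <= V x - e.
    rewrite {1}Venv; apply: (usc_env_le W01 Dx (r := Num.min r3 rho)).
      by rewrite lt_min r30.
    by move=> y Dy yr; rewrite leNgt; apply/negP => h'; apply: H; exists y.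
  by rewrite lerBrDr gerDl leNgt e0.
have [w Pw wy0] := Plub y0 _ Dy0 y0W.
have [wu wsub] := Psub w Pw.
move: y0r; rewrite lt_min => /andP[y03 y0rho].
have K_D : [set y | enorm (y - x) <= rho] `<=` ~` T by move=> y /inb[].
have phi1c : {within ~` T, continuous phi1}.
  apply: continuous_in_subspaceT => v /[!inE] Tv; apply: differentiable_continuous.
  by have /has_gradP[] := phi1G.1 v Tv.
have wphi_usc : usc_on (~` T) (fun y => w y - phi1 y).
  move=> y Ty c hc; have [b [b0 bE]] : exists b, 0 < b /\ 2 * b = c - (w y - phi1 y).
    by exists ((c - (w y - phi1 y)) / 2); rewrite divr_gt0 ?subr_gt0 //; split => //; field.
  have [|s1 s10 k1] := wu y (not_T_D Ty) (w y + b); first by rewrite ltrDl.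
  have [|s2 s20 k2] := continuous_lsc phi1c Ty (c := phi1 y - b); first by rewrite gtrBl.
  exists (Num.min s1 s2); first by rewrite lt_min s10.
  move=> z Tz; rewrite lt_min => /andP[z1 z2].
  have := k1 z (not_T_D Tz) z1; have := k2 z Tz z2; clear - bE.
  by move: (w z) (phi1 z) => wz pz; lra.
have [|z Kz zm] := usc_on_max K_D wphi_usc (compact_enorm_ball x rho).
  by exists x => /=; rewrite subrr enorm0 ltW.
have zy0 := zm y0 (ltW y0rho); rewrite (phi1E z) in zy0.
have [zr Tz zd zg zphi] := inb z Kz.
have wzV : w z <= V z := le_trans (PW _ _ Pw (not_T_D Tz)) (WV _ (not_T_D Tz)).
have Vz := hm z zr; have dz := dotp_ge0 (z - x).
have := h3 y0 y03; rewrite (phi1E x) subrr dotp0l addr0 ltr_norml => /andP[p1 p2].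
move: zphi; rewrite ltr_norml => /andP[p3 p4].
have sq : dotp (z - x) (z - x) <= 2 * e by clear - p1 p2 zy0 wy0 wzV Vz; lra.
have zrho : enorm (z - x) < rho.
  rewrite -(ltr_pXn2r (ltn0Sn 1)) ?nnegrE ?enorm_ge0 ?(ltW rho0) // sqr_enorm.
  by clear - sq e0 e1; lra.
have wz : `|w z - V x| < d.
  by rewrite ltr_norml; clear - dz p1 p2 p3 p4 zy0 wy0 wzV Vz e2 e0; apply/andP; split; lra.
have := hd z _ (w z) a zd zg wz Aa; rewrite ltr_norml => /andP[+ _].
have := subsol_test wsub phi1G Tz (r := rho - enorm (z - x)).
rewrite subr_gt0 => /(_ zrho) /(_ _ a Aa) Hs.
have {}Hs : - dotp (grad phi z + 2 *: (z - x)) (f z a) - h z a + h z a * w z <= 0.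
  apply: Hs => y yz; apply: zm => /=; have := enorm_sub_le y z x.
  by clear - yz; lra.
move: Hs; move: (- dotp _ _ - h z a + _) (_ + h x a * _) => p q; clear; lra.
Qed.

Section Perron.
Context {R : realType} {n m : nat}.
Variables (f : 'rV[R]_n -> 'rV[R]_m -> 'rV[R]_n) (h : 'rV[R]_n -> 'rV[R]_m -> R)
  (A : set 'rV[R]_m) (T : set 'rV[R]_n).
Hypotheses (Ac : compact A) (T0 : T !=set0) (Tcl : closed T) (bc : compact (bdry T))
  (f_lip : forall r, 0 < r -> exists2 L, 0 < L &
     forall x1 x2 a, enorm x1 <= r -> enorm x2 <= r -> A a ->
       enorm (f x1 a - f x2 a) <= L * enorm (x1 - x2))
  (f_growth : exists2 M : R, 0 < M &
     forall x a, A a -> enorm (f x a) <= M * (1 + enorm x))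
  (h_cont : {within setT `*` A, continuous (fun q => h q.1 q.2)})
  (h_ge0 : forall x a, A a -> 0 <= h x a).
Let D := ~` interior T.

Variable Wb : 'rV[R]_n -> R.
Hypotheses (Wb01 : forall x, D x -> 0 <= Wb x <= 1)
  (Wbc : {within D, continuous Wb}) (Wb0 : forall b, bdry T b -> Wb b = 0)
  (Wbsup : viscosity_supersolution (hamiltonian f h A) (~` T) Wb).

(** Lying between 0 and the barrier forces the value 0 on the boundary of T. *)
Definition perron_class (w : 'rV[R]_n -> R) :=
  [/\ usc_on D w, forall x, D x -> 0 <= w x <= Wb x
    & viscosity_subsolution (hamiltonian f h A) (~` T) w].

Lemma perron_zero : perron_class (fun=> 0).
Proof.
split.
- by move=> x _ c c0; exists 1.
- by move=> x Dx; rewrite lexx; case/andP: (Wb01 Dx).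
apply: subsol_intro => phi x r [phiG _] Tx r0 hm a Aa.
have hN := has_gradZ (-1) (phiG x Tx).
have /eqP : -1 *: grad phi x = 0.
  by apply: (has_grad_max r0 hN) => y yr; have := hm y yr; lra.
rewrite scaleN1r oppr_eq0 => /eqP ->; rewrite dotp0l mulr0.
by have := h_ge0 x Aa; lra.
Qed.

Let Wsup x := sup [set w x | w in perron_class].

Let Wsup_ub x w : D x -> perron_class w -> w x <= Wsup x.
Proof.
move=> Dx Pw; apply: ub_le_sup; last by exists w.
by exists (Wb x) => _ [w' [_ h' _] <-]; case/andP: (h' x Dx).
Qed.

Let Wsup_b x : D x -> 0 <= Wsup x <= Wb x.
Proof.
move=> Dx; rewrite (Wsup_ub Dx perron_zero) /=.
apply: ge_sup; first by exists 0, (fun=> 0) => //; exact: perron_zero.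
by move=> _ [w' [_ h' _] <-]; case/andP: (h' x Dx).
Qed.

Let Wsup01 x : D x -> 0 <= Wsup x <= 1.
Proof.
move=> Dx; have /andP[-> h1] := Wsup_b Dx.
by case/andP: (Wb01 Dx) => _; exact: le_trans.
Qed.

Let V := usc_env D Wsup.

Let V_usc : usc_on D V. Proof. exact: usc_env_usc Wsup01. Qed.

Let Wsup_V x : D x -> Wsup x <= V x. Proof. exact: (le_usc_env Wsup01). Qed.

Let V_b x : D x -> 0 <= V x <= Wb x.
Proof.
move=> Dx; apply/andP; split.
  by apply: le_trans (Wsup_V Dx); case/andP: (Wsup_b Dx).
apply/ler_addgt0Pr => e e0.
have [|r r0 hr] := continuous_usc Wbc Dx (c := Wb x + e); first by rewrite ltrDl.
apply: (usc_env_le Wsup01 Dx r0) => y Dy yr.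
by apply: le_trans (ltW (hr y Dy yr)); case/andP: (Wsup_b Dy).
Qed.

Let V_sub : viscosity_subsolution (hamiltonian f h A) (~` T) V.
Proof.
apply: (subsolution_sup Ac Tcl f_lip f_growth h_cont Wsup01 (P := perron_class)).
- by move=> w [].
- by move=> w x Pw Dx; exact: Wsup_ub.
move=> x c Dx xc; have [||_ [w Pw <-] wx] := @sup_gt R [set w x | w in perron_class] c _ _.
- by exists 0, (fun=> 0) => //; exact: perron_zero.
- exact: xc.
by exists w.
Qed.

(** The upper envelope of the pointwise supremum is still a subsolution and, the barrier being
    continuous, still below it: it is a largest element of the class. *)
Lemma perron_max : exists V, perron_class V /\
  forall w x, perron_class w -> D x -> w x <= V x.
Proof.
exists V; split; first by split.
by move=> w x Pw Dx; apply: le_trans (Wsup_ub Dx Pw) (Wsup_V Dx).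
Qed.

End Perron.

Section PerronSolution.
Context {R : realType} {n m : nat}.
Variables (f : 'rV[R]_n -> 'rV[R]_m -> 'rV[R]_n) (h : 'rV[R]_n -> 'rV[R]_m -> R)
  (A : set 'rV[R]_m) (T : set 'rV[R]_n).
Hypotheses (Ac : compact A) (T0 : T !=set0) (Tcl : closed T) (bc : compact (bdry T))
  (f_lip : forall r, 0 < r -> exists2 L, 0 < L &
     forall x1 x2 a, enorm x1 <= r -> enorm x2 <= r -> A a ->
       enorm (f x1 a - f x2 a) <= L * enorm (x1 - x2))
  (f_growth : exists2 M : R, 0 < M &
     forall x a, A a -> enorm (f x a) <= M * (1 + enorm x))
  (h_cont : {within setT `*` A, continuous (fun q => h q.1 q.2)})
  (h_ge0 : forall x a, A a -> 0 <= h x a).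
Let D := ~` interior T.

Variable Wb : 'rV[R]_n -> R.
Hypotheses (Wb01 : forall x, D x -> 0 <= Wb x <= 1)
  (Wbc : {within D, continuous Wb}) (Wb0 : forall b, bdry T b -> Wb b = 0)
  (Wbsup : viscosity_supersolution (hamiltonian f h A) (~` T) Wb).

Section Bump.
Variable V : 'rV[R]_n -> R.
Hypotheses (PV : perron_class f h A T Wb V)
  (Vmax : forall w x, perron_class f h A T Wb w -> D x -> w x <= V x).

Let V01 x : D x -> 0 <= V x <= 1.
Proof.
have [_ Vb _] := PV; move=> Dx; have /andP[-> h1] := Vb x Dx.
by case/andP: (Wb01 Dx) => _; exact: le_trans.
Qed.

(* If the lower envelope fails to be a supersolution at x, the maximum of V and of
   the test function raised by b near x is a larger member of the Perron class. *)
Lemma perron_lsc_supersol :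
  viscosity_supersolution (hamiltonian f h A) (~` T) (lsc_env D V).
Proof.
have [Vu Vb Vsub] := PV.
apply: supersol_intro => phi x r phiG Tx r0 hm; apply: contrapT => /ham_neg[e e0 he].
have Dx : D x := not_T_D Tx.
set v := lsc_env D V x in he.
have VsV y : D y -> lsc_env D V y <= V y by move=> Dy; exact: (lsc_env_le V01).
have vW : v <= Wb x by apply: le_trans (VsV x Dx) _; case/andP: (Vb x Dx).
have [rT rT0 hT] := notT_open Tcl Tx.
have {vW} vW : v < Wb x.
  (* In case of equality phi touches the barrier from below at x, and the barrier is a
     supersolution. The strict inequality leaves room for the bump. *)
  rewrite lt_neqAle vW andbT; apply/eqP => vE.
  have [||a Aa] := supersol_test Wbsup phiG Tx (r := Num.min r rT) _ _ e0.
  - by rewrite lt_min r0.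
  - move=> y; rewrite lt_min => /andP[yr yT]; have Dy : D y := not_T_D (hT y yT).
    have := hm y yr; rewrite -/v vE; have := VsV y Dy; case/andP: (Vb y Dy); lra.
  by rewrite -vE; have := he a Aa; lra.
have [d d0 hd] := ham_cont Ac f_lip f_growth h_cont x (grad phi x) v e0.
pose gap := Num.min d (Wb x - v) / 4.
have gap0 : 0 < gap by rewrite divr_gt0 // lt_min d0 subr_gt0.
have [gapd gapW] : 4 * gap <= d /\ 4 * gap <= Wb x - v.
  by rewrite /gap mulrC divfK // !ge_min !lexx orbT.
(* Subtracting the quadratic puts the test function strictly below V away from x, so that a small
   raise affects a small ball only. *)
pose psi0 y := phi y + -1 * dotp (y - x) (y - x).
have psi0G : C1_with (~` T) psi0 (fun y => grad phi y + -1 *: (2 *: (y - x))).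
  by apply: C1_withD => //; apply: C1_withZ; exact: C1_with_sq.
have [r1 r10 h1] := psi0G.2 x Tx d d0.
have [r2 r20 h2] := has_grad_cont (psi0G.1 x Tx) gap0.
have [r3 r30 h3] := continuous_lsc Wbc Dx (c := Wb x - gap) (ltac:(by rewrite gtrBl)).
pose rho := Num.min (Num.min r rT) (Num.min (Num.min r1 r2) (Num.min r3 d)) / 2.
have rho0 : 0 < rho by rewrite divr_gt0 // !lt_min r0 rT0 r10 r20 r30 d0.
have inb y : enorm (y - x) <= rho -> [/\ enorm (y - x) < r, ~ T y, enorm (y - x) < d,
    enorm (grad phi y + -1 *: (2 *: (y - x)) - grad phi x) < d
    & `|psi0 y - phi x| < gap /\ Wb x - gap < Wb y].
  move=> yr; have : enorm (y - x) < Num.min (Num.min r rT) (Num.min (Num.min r1 r2) (Num.min r3 d)).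
    by rewrite /rho in yr rho0; lra.
  rewrite !lt_min => /andP[/andP[y1 yT] /andP[/andP[y2 y3] /andP[y4 y5]]].
  have Ty := hT y yT; split => //.
    by have := h1 y Ty y2; rewrite subrr scaler0 scaler0 addr0.
  split; last exact: h3 (not_T_D Ty) y4.
  by have := h2 y y3; rewrite {2}/psi0 subrr dotp0l mulr0 addr0.
(* The raise b is beaten by the quadratic as soon as |y - x|^2 > rho^2 / 2, well before the sphere
   of radius rho: w = V near that sphere, so the pieces fit. *)
pose b := Num.min gap (rho ^+ 2 / 4).
have b0 : 0 < b by rewrite lt_min gap0 divr_gt0 // exprn_gt0.
have [bg br] : b <= gap /\ 4 * b <= rho ^+ 2.
  rewrite ge_min lexx; split => //.
  have : b <= rho ^+ 2 / 4 by rewrite ge_min lexx orbT.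
  lra.
pose psi y := psi0 y + (v + b - phi x).
have psiG : C1_with (~` T) psi (fun y => grad phi y + -1 *: (2 *: (y - x)) + 0).
  by apply: C1_withD => //; exact: C1_with_cst.
have psid y : enorm (y - x) <= rho -> `|psi y - v| < d.
  move=> /inb[_ _ _ _ [+ _]]; rewrite /psi !ltr_norml => /andP[? ?].
  by apply/andP; split; lra.
have psiW y : enorm (y - x) <= rho -> psi y <= Wb y.
  by move=> /inb[_ _ _ _ [+ ?]]; rewrite /psi !ltr_norml => /andP[? ?]; lra.
have psiV y : enorm (y - x) <= rho -> rho ^+ 2 / 2 < dotp (y - x) (y - x) -> psi y < V y.
  move=> /inb[yr Ty _ _ _] sq; have := hm y yr; have := VsV y (not_T_D Ty).
  by rewrite /psi /psi0 -/v; lra.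
pose w y := if enorm (y - x) < rho then Num.max (V y) (psi y) else V y.
have Vw y : V y <= w y by rewrite /w; case: ifP => _ //; rewrite le_max lexx.
have w_in y : enorm (y - x) < rho -> w y = Num.max (V y) (psi y) by rewrite /w => ->.
have w_near y : ~ enorm (y - x) < rho -> exists2 s, 0 < s &
    forall z, enorm (z - y) < s -> w z = V z.
  move=> /negP; rewrite -leNgt => yr; exists (rho / 4); first by rewrite divr_gt0.
  move=> z zy; rewrite /w; case: ifP => // zx; rewrite max_l // ltW //.
  apply: psiV; first exact: ltW.
  have zl : rho * (3 / 4) < enorm (z - x).
    by have := enorm_sub_le y z x; rewrite (enormB y z); lra.
  rewrite -sqr_enorm; nra.
have psic : {within ~` T, continuous psi}.
  apply: continuous_in_subspaceT => y /[!inE] Ty; apply: differentiable_continuous.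
  by have /has_gradP[] := psiG.1 y Ty.
have Pw : perron_class f h A T Wb w.
  split.
  - move=> y Dy c wc; have Vyc := le_lt_trans (Vw y) wc.
    have [s1 s10 k1] := Vu y Dy c Vyc.
    have [yx|yx] := pselect (enorm (y - x) < rho); last first.
      have [s s0 hs] := w_near y yx.
      exists (Num.min s s1); first by rewrite lt_min s0.
      by move=> z Dz; rewrite lt_min => /andP[/hs -> z1]; exact: k1.
    have [_ Ty _ _ _] := inb y (ltW yx).
    move: wc; rewrite w_in // gt_max => /andP[_ pc].
    have [s2 s20 k2] := continuous_usc psic Ty pc.
    have [s3 s30 k3] := notT_open Tcl Ty.
    exists (Num.min (Num.min s1 s2) (Num.min s3 (rho - enorm (y - x)))).
      by rewrite !lt_min s10 s20 s30 subr_gt0.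
    move=> z Dz; rewrite !lt_min => /andP[/andP[z1 z2] /andP[z3 z4]].
    rewrite w_in; last by have := enorm_sub_le z y x; lra.
    by rewrite gt_max k1 // k2 //; exact: k3.
  - move=> y Dy; have /andP[V0 VW] := Vb y Dy; rewrite (le_trans V0 (Vw y)) /=.
    rewrite /w; case: ifP => // yx; rewrite ge_max VW /=; exact/psiW/ltW.
  apply: subsol_intro => chi y s chiG Ty s0 hchi a Aa.
  have [s1 s10 k1] := notT_open Tcl Ty.
  (* Where w = V a test from above for w is one for V. Elsewhere w = psi, so the test function has
     the gradient of psi, and the Hamiltonian of psi is negative. *)
  have [wV|wV] := eqVneq (w y) (V y).
    rewrite wV; apply: (subsol_test Vsub chiG Ty s0) => // z zy.
    by have := hchi z zy; have := Vw z; rewrite wV; lra.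
  have yx : enorm (y - x) < rho.
    by apply: contraNT wV => /negP/w_near[t t0 ->] //; rewrite subrr enorm0.
  have wpsi : w y = psi y.
    by move: wV; rewrite w_in // /Num.max; case: ifPn => //; rewrite eqxx.
  have [_ _ yd yg _] := inb y (ltW yx).
  have gE : grad chi y = grad phi y + -1 *: (2 *: (y - x)) + 0.
    have dG := has_gradD (psiG.1 y Ty) (has_gradZ (-1) (chiG.1 y Ty)).
    have /eqP : grad phi y + -1 *: (2 *: (y - x)) + 0 + -1 *: grad chi y = 0.
      apply: (has_grad_max (r := Num.min s (rho - enorm (y - x))) _ dG).
        by rewrite lt_min s0 subr_gt0.
      move=> z; rewrite lt_min => /andP[zs zr].
      have zx : enorm (z - x) < rho by have := enorm_sub_le z y x; lra.
      have : psi z <= w z by rewrite w_in // le_max lexx orbT.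
      by have := hchi z zs; rewrite wpsi; lra.
    by rewrite (scaleN1r (grad chi y)) subr_eq0 => /eqP.
  rewrite addr0 in gE; rewrite gE wpsi.
  have := hd y _ (psi y) a yd yg (psid y (ltW yx)) Aa; rewrite ltr_norml => /andP[_].
  have := he a Aa; lra.
have wle y (Dy : D y) := Vmax Pw Dy.
have psix : v + b / 2 < psi x by rewrite /psi /psi0 subrr dotp0l; lra.
have [s1 s10 k1] := continuous_lsc psic Tx psix.
(* As v is a lower envelope, V comes close to v arbitrarily near x, while psi exceeds v + b / 2
   there: w beats the maximal V. *)
have [y [Dy yx yV]] : exists y, [/\ D y, enorm (y - x) < Num.min s1 rho & V y < v + b / 2].
  apply: contrapT => H; have : v + b / 2 <= v.
    apply: (lsc_env_ge V01 Dx (r := Num.min s1 rho)); first by rewrite lt_min s10.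
    by move=> y Dy yr; rewrite leNgt; apply/negP => h'; apply: H; exists y.
  lra.
move: yx; rewrite lt_min => /andP[ys yrho].
have [_ Ty _ _ _] := inb y (ltW yrho).
have := k1 y Ty ys; have := wle y Dy; rewrite w_in // ge_max => /andP[_]; lra.
Qed.

End Bump.

Variables (g : 'rV[R]_n -> R) (G : 'rV[R]_n -> 'rV[R]_n).
Hypothesis gG : comparison_barrier f h A T g G.

(** Comparing V with its own lower envelope shows that the two agree, so V is continuous. *)
Lemma perron_solution : exists V : 'rV[R]_n -> R,
  [/\ {within D, continuous V}, forall x, D x -> 0 <= V x <= Wb x,
      viscosity_supersolution (hamiltonian f h A) (~` T) V
    & viscosity_subsolution (hamiltonian f h A) (~` T) V].
Proof.
have [V [PV Vmax]] := perron_max Ac Tcl f_lip f_growth h_cont h_ge0 Wb01 Wbc.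
have [Vu Vb Vsub] := PV.
have V01 x : D x -> 0 <= V x <= 1.
  move=> Dx; have /andP[-> h1] := Vb x Dx.
  by case/andP: (Wb01 Dx) => _; exact: le_trans.
have Vsup := perron_lsc_supersol PV Vmax.
have Vle x : D x -> V x <= lsc_env D V x.
  apply: (comparison Ac T0 Tcl bc f_lip h_cont h_ge0 gG Vu (lsc_env_lsc V01)) => //.
  - by move=> y /V01/andP[].
  - move=> y Dy; apply: (lsc_env_ge V01 Dy (r := 1)) => // z Dz _.
    by case/andP: (V01 z Dz).
  - move=> b bb; have Db := bdry_D bb.
    by rewrite -(Wb0 bb); case/andP: (Vb b Db).
have VE x : D x -> lsc_env D V x = V x.
  by move=> Dx; apply/eqP; rewrite eq_le (lsc_env_le V01) //= Vle.
exists V; split => //.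
- apply: usc_lsc_continuous => // x Dx c; rewrite -VE // => hc.
  exact: (lsc_env_gt V01 Dx hc).
- apply: supersol_eq Vsup => x Tx; have [r r0 hr] := notT_open Tcl Tx.
  by exists r => // y yr; rewrite VE //; exact: not_T_D (hr y yr).
Qed.

End PerronSolution.

(** * Integrals along trajectories *)

Section LocallyBounded.
Context {R : realType}.
Local Notation mu := (@lebesgue_measure R).
Implicit Types (F G : R -> R) (a b c t : R).

(** A class closed under the operations below, every member of which is integrable on bounded
    intervals of the half-line. *)
Definition loc_bounded_meas F :=
  measurable_fun (`[0, +oo[%classic : set (measurableTypeR R)) F /\
  forall t, exists C, forall s, 0 <= s <= t -> `|F s| <= C.

(* The half-open interval makes intg additive and gives 0 when b <= a. *)
Definition intg F a b : R := \int[mu]_(s in `]a, b]) F s.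

Lemma lbm_integrable F a b (i : bool) : loc_bounded_meas F -> 0 <= a ->
  mu.-integrable [set` Interval (BSide i a) (BRight b)] (EFin \o F).
Proof.
move=> [Fm Fb] a0.
have sub : [set` Interval (BSide i a) (BRight b)] `<=` [set` `[0, +oo[].
  move=> s /=; rewrite !in_itv /= andbT => /andP[sa _].
  by apply: le_trans a0 _; move: sa; case: i => //=; exact: ltW.
apply: measurable_bounded_integrable.
- exact: measurable_itv.
- rewrite /= lebesgue_measure_itv /=.
  by case: ifPn => // _; rewrite -EFinB ltry.
- by apply: measurable_funS Fm => //; exact: measurable_itv.
have [C hC] := Fb b; exists C; split; first exact: num_real.
move=> M CM s /= sab; apply: le_trans (ltW CM); apply: hC.
have := sub s sab; move: sab; rewrite /= !in_itv /= andbT => /andP[_ ->] ->.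
by [].
Qed.

Lemma intg0E F t : loc_bounded_meas F -> \int[mu]_(s in `[0, t]) F s = intg F 0 t.
Proof.
move=> hF; rewrite /intg -(@Rintegral_itv_obnd_cbnd R 0 (BRight t)) //.
exact: lbm_integrable.
Qed.

Lemma intg_split F a b c : loc_bounded_meas F -> 0 <= a -> a <= b -> b <= c ->
  intg F a c = intg F a b + intg F b c.
Proof.
move=> hF a0 ab bc; rewrite /intg.
have H := @Rintegral_itvB R F (BRight a) (BRight c) b (lbm_integrable c false hF a0).
by rewrite -H ?bnd_simp // addrC subrK.
Qed.

Lemma le_intg F G a b : loc_bounded_meas F -> loc_bounded_meas G -> 0 <= a ->
  (forall s, a < s <= b -> F s <= G s) -> intg F a b <= intg G a b.
Proof.
move=> hF hG a0 h; apply: le_Rintegral => //=; exact: lbm_integrable.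
Qed.

Lemma eq_intg F G a b : (forall s, a < s <= b -> F s = G s) ->
  intg F a b = intg G a b.
Proof.
by move=> h; apply: eq_Rintegral => s; rewrite inE /= in_itv /=; exact: h.
Qed.

Lemma intg_cst c a b : a <= b -> intg (fun=> c) a b = c * (b - a).
Proof.
move=> ab; rewrite /intg Rintegral_cst //= lebesgue_measure_itv /= lte_fin.
case: ifPn => [_//|]; rewrite -leNgt => ba.
have -> : a = b by apply/eqP; rewrite eq_le ab.
by rewrite subrr.
Qed.

Lemma lbm_cst c : loc_bounded_meas (fun=> c).
Proof. by split; [exact: measurable_cst|move=> t; exists `|c|]. Qed.

Lemma lbmD F G : loc_bounded_meas F -> loc_bounded_meas G ->
  loc_bounded_meas (fun s => F s + G s).
Proof.
move=> [Fm Fb] [Gm Gb]; split; first exact: measurable_funD.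
move=> t; have [C1 h1] := Fb t; have [C2 h2] := Gb t; exists (C1 + C2) => s st.
by apply: le_trans (ler_normD _ _) _; apply: lerD; [exact: h1|exact: h2].
Qed.

Lemma lbmZ c F : loc_bounded_meas F -> loc_bounded_meas (fun s => c * F s).
Proof.
move=> [Fm Fb]; split; first by apply: measurable_funM => //; exact: measurable_cst.
move=> t; have [C h] := Fb t; exists (`|c| * C) => s st.
by rewrite normrM ler_wpM2l //; exact: h.
Qed.

Lemma intgD F G a b : loc_bounded_meas F -> loc_bounded_meas G -> 0 <= a ->
  intg (fun s => F s + G s) a b = intg F a b + intg G a b.
Proof.
by move=> hF hG a0; apply: RintegralD => //=; exact: lbm_integrable.
Qed.

Lemma intgZ c F a b : loc_bounded_meas F -> 0 <= a ->
  intg (fun s => c * F s) a b = c * intg F a b.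
Proof. by move=> hF a0; apply: RintegralZl => //=; exact: lbm_integrable. Qed.

Lemma lbm_sum n (F : 'I_n -> R -> R) : (forall i, loc_bounded_meas (F i)) ->
  loc_bounded_meas (fun s => \sum_i F i s).
Proof.
move=> hF; elim: (index_enum 'I_n) => [|i r IH].
  by have := lbm_cst 0; congr loc_bounded_meas; apply/funext => s; rewrite big_nil.
have := lbmD (hF i) IH; congr loc_bounded_meas; apply/funext => s.
by rewrite big_cons.
Qed.

Lemma intg_sum n (F : 'I_n -> R -> R) a b : (forall i, loc_bounded_meas (F i)) ->
  0 <= a -> intg (fun s => \sum_i F i s) a b = \sum_i intg (F i) a b.
Proof.
move=> hF a0.
have H r : loc_bounded_meas (fun s => \sum_(i <- r) F i s) /\
    intg (fun s => \sum_(i <- r) F i s) a b = \sum_(i <- r) intg (F i) a b.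
  elim: r => [|i r [IH1 IH2]].
    have E : (fun s => \sum_(i <- [::]) F i s) = fun=> 0 :> R.
      by apply/funext => s; rewrite big_nil.
    rewrite E big_nil; split; first exact: lbm_cst.
    by rewrite /intg /Rintegral integral0.
  have E : (fun s => \sum_(j <- i :: r) F j s) = fun s => F i s + \sum_(j <- r) F j s.
    by apply/funext => s; rewrite big_cons.
  by rewrite E big_cons intgD // IH2; split => //; exact: lbmD.
by have [] := H (index_enum 'I_n).
Qed.

Lemma intg_ge c F a b : loc_bounded_meas F -> 0 <= a -> a <= b ->
  (forall s, a < s <= b -> c <= F s) -> c * (b - a) <= intg F a b.
Proof.
by move=> hF a0 ab h; rewrite -intg_cst //; apply: le_intg => //; exact: lbm_cst.
Qed.

Lemma intg_le c F a b : loc_bounded_meas F -> 0 <= a -> a <= b ->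
  (forall s, a < s <= b -> F s <= c) -> intg F a b <= c * (b - a).
Proof.
by move=> hF a0 ab h; rewrite -intg_cst //; apply: le_intg => //; exact: lbm_cst.
Qed.

Lemma intg_ge0 F a b : (forall s, a < s <= b -> 0 <= F s) -> 0 <= intg F a b.
Proof. by move=> h; apply: Rintegral_ge0 => s /=; rewrite in_itv /=; exact: h. Qed.

Lemma intg_set0 F a b : b <= a -> intg F a b = 0.
Proof.
move=> ba; rewrite /intg set_itv_ge ?Rintegral_set0 //.
by rewrite bnd_simp -leNgt.
Qed.

End LocallyBounded.

Section AlongCurve.
Context {R : realType} {n m : nat}.
Variables (A : set 'rV[R]_m) (F : 'rV[R]_n -> 'rV[R]_m -> R).
Hypotheses (Ac : compact A)
  (Fc : {within setT `*` A, continuous (fun q => F q.1 q.2)}).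
Variables (alpha : R -> 'rV[R]_m) (y : R -> 'rV[R]_n).
Hypotheses (ca : control A alpha) (yc : {within `[0, +oo[, continuous y}).

Lemma curve_continuous t e : 0 <= t -> 0 < e -> exists2 d, 0 < d &
  forall s, 0 <= s -> `|s - t| < d -> enorm (y s - y t) < e.
Proof.
move=> t0 e0; move: yc; rewrite subspace_continuousP => /(_ t).
rewrite /= in_itv /= andbT => /(_ t0) h.
have : nbhs (y t) [set z | enorm (z - y t) < e] by apply/nbhs_enormP; exists e.
move=> /h /nbhs_ballP[d /= d0 hd]; exists d => // s s0 st.
by apply: hd; rewrite /ball /= 1?distrC // in_itv /= s0.
Qed.

Lemma curve_bounded t : exists2 C, 0 < C & forall s, 0 <= s <= t -> enorm (y s) <= C.
Proof.
have yc' : {within `[0, t]%classic, continuous y}.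
  by apply: continuous_subspaceW yc => s /=; rewrite !in_itv /= => /andP[->].
have := continuous_compact yc' (@segment_compact R 0 t).
move=> /compact_enorm_bounded[C C0 hC]; exists C => // s st; apply: hC.
by exists s => //=; rewrite in_itv.
Qed.

Let meas_const z : measurable_fun (`[0, +oo[%classic : set (measurableTypeR R))
  (fun s => F z (alpha s)).
Proof.
have [aA am] := ca.
move=> mD; apply: (measurability _ (RGenOpens.measurableE R)) => //.
move=> _ [_ [a [b ->] <-]].
(* F z is continuous on A only, while measurability of the control concerns open sets of the whole
   space. The union O of suitable balls centred in A meets A in the required preimage. *)
pose O := \bigcup_(p in [set p : 'rV[R]_m * R | A p.1 /\ 0 < p.2 /\
   forall c, A c -> enorm (c - p.1) < p.2 -> F z c \in `]a, b[])
   [set c | enorm (c - p.1) < p.2].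
have Oo : open O.
  apply: bigcup_open => -[p r] _ /=; apply/open_enormP => c /= cp.
  exists (r - enorm (c - p)); first by rewrite subr_gt0.
  by move=> v vc; have := enorm_sub_le v c p; lra.
have -> : `[0, +oo[%classic `&` (fun s => F z (alpha s)) @^-1` `]a, b[%classic =
    `[0, +oo[%classic `&` alpha @^-1` O.
  apply/seteqP; split => s [s0 hs]; split => //.
    have s0' : 0 <= s by move: s0; rewrite /= in_itv /= andbT.
    have As := aA s s0'.
    pose e := Num.min (F z (alpha s) - a) (b - F z (alpha s)).
    have e0 : 0 < e by move: hs; rewrite /= in_itv /= lt_min !subr_gt0.
    have [r r0 hr] := joint_continuous Fc z As e0.
    exists (alpha s, r); last by rewrite /= subrr enorm0.
    split => //; split => // c Ac' cs.
    have := hr z c; rewrite subrr enorm0 => /(_ r0 Ac' cs).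
    have : e <= F z (alpha s) - a by rewrite ge_min lexx.
    have : e <= b - F z (alpha s) by rewrite ge_min lexx orbT.
    rewrite ltr_norml in_itv /= => ? ? /andP[? ?]; apply/andP; split; lra.
  case: hs => -[p r] [/= Ap [r0 hp]] ps; apply: hp => //; apply: aA.
  by move: s0; rewrite /= in_itv /= andbT.
exact: am.
Qed.

(** With y sampled at the left ends of a grid of mesh 1 / (j + 1), only the control varies on each
    cell; the samples converge by continuity of y and F. *)
Lemma curve_lbm : loc_bounded_meas (fun s => F (y s) (alpha s)).
Proof.
have [aA am] := ca.
split; last first.
  move=> t; have [C C0 hC] := curve_bounded t.
  have [C' _ hC'] := joint_bounded Ac Fc C; exists C' => s st.
  by apply: hC'; [exact: hC|apply: aA; case/andP: st].
pose g (j : nat) (s : R) : R := (Num.floor (s * j.+1%:R))%:~R / j.+1%:R.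
apply: (@measurable_fun_cvg _ _ _ _ (fun j s => F (y (g j s)) (alpha s))).
- move=> j mD Y mY.
  pose E (i : nat) := `[i%:R / j.+1%:R, i.+1%:R / j.+1%:R[%classic : set R.
  have -> : `[0, +oo[%classic `&` (fun s => F (y (g j s)) (alpha s)) @^-1` Y =
    \bigcup_i (E i `&` (`[0, +oo[%classic `&`
      (fun s => F (y (i%:R / j.+1%:R)) (alpha s)) @^-1` Y)).
    have gE i s : E i s -> g j s = i%:R / j.+1%:R.
      rewrite /E /= in_itv /= ler_pdivrMr // ltr_pdivlMr // => /andP[h1 h2].
      rewrite /g; congr (_ / _).
      have -> : Num.floor (s * j.+1%:R) = i%:Z.
        by apply: Num.Theory.floor_def; rewrite -[(i%:Z + 1)%R]/((i + 1)%N%:Z) addn1 h1 h2.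
      by [].
    apply/seteqP; split => s.
      move=> [s0 hs]; have s0' : 0 <= s by move: s0; rewrite /= in_itv /= andbT.
      exists (Num.truncn (s * j.+1%:R)) => //.
      have Es : E (Num.truncn (s * j.+1%:R)) s.
        have sj : 0 <= s * j.+1%:R by rewrite mulr_ge0.
        have /andP[h1 h2] := truncn_itv sj.
        by rewrite /E /= in_itv /= ler_pdivrMr // ltr_pdivlMr // h1 h2.
      by split => //; split => //=; rewrite -(gE _ _ Es).
    move=> [i _ [Es [s0 hs]]]; split => //=; by rewrite (gE _ _ Es).
  apply: bigcupT_measurable => i; apply: measurableI; first exact: measurable_itv.
  exact: meas_const.
move=> s /=; rewrite in_itv /= andbT => s0.
have As := aA s s0.
apply/cvgrPdist_lt => e e0.
have [r r0 hr] := joint_continuous Fc (y s) As e0.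
have [d d0 hd] := curve_continuous s0 r0.
have := near_infty_natSinv_lt (PosNum d0); apply: filterS => j /= jd.
rewrite distrC; apply: hr => //; last by rewrite subrr enorm0.
have j0 : 0 < j.+1%:R :> R by [].
have /andP[f1 f2] := Num.Theory.floor_itv (s * j.+1%:R).
have g1 : g j s <= s by rewrite /g ler_pdivrMr.
have g2 : s < g j s + j.+1%:R^-1.
  by rewrite /g -[X in _ + X]mul1r -mulrDl ltr_pdivlMr // -intrD1.
apply: hd.
  by rewrite /g divr_ge0 // ler0z Num.Theory.floor_ge0 ?mulr_ge0.
by rewrite distrC ger0_norm ?subr_ge0 //; apply: lt_trans jd; rewrite ltrBlDl.
Qed.

End AlongCurve.

(** Telescoping over equal steps no longer than s: a bound on difference quotients replaces a
    derivative. *)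
Lemma local_growth (R : realType) (E : R -> R) (k s t : R) : 0 < s -> 0 <= t ->
  (forall a b, 0 <= a -> a <= b -> b <= t -> b - a <= s -> E b - E a <= k * (b - a)) ->
  E t - E 0 <= k * t.
Proof.
move=> s0 t0 h.
have [N hN] : exists N : nat, t / s < N.+1%:R.
  exists (Num.bound (t / s)); apply: lt_trans (archi_boundP _) _.
    by rewrite divr_ge0 // ltW.
  by rewrite ltr_nat.
have N0 : 0 < N.+1%:R :> R by [].
pose d := t / N.+1%:R.
have d0 : 0 <= d by rewrite divr_ge0.
have ds : d <= s.
  by rewrite /d ler_pdivrMr // mulrC -ler_pdivrMr // ltW.
have dN : d * N.+1%:R = t by rewrite /d divfK // gt_eqF.
have H j : (j <= N.+1)%N -> E (d * j%:R) - E 0 <= k * (d * j%:R).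
  elim: j => [|j IH] jN; first by rewrite !mulr0 subrr.
  have dE : d * j.+1%:R = d * j%:R + d by rewrite -natr1 mulrDr mulr1.
  have := IH (ltnW jN).
  have : E (d * j.+1%:R) - E (d * j%:R) <= k * (d * j.+1%:R - d * j%:R).
    apply: h.
    - by rewrite mulr_ge0.
    - by rewrite ler_wpM2l // ler_nat.
    - by rewrite -dN ler_wpM2l // ler_nat.
    - by rewrite dE addrC addKr.
  rewrite dE; lra.
by have := H N.+1 (leqnn _); rewrite dN.
Qed.

Lemma closed_dist_ge (R : realType) (n : nat) (T : set 'rV[R]_n) r :
  T !=set0 -> closed [set z | r <= dist T z].
Proof.
move=> T0; apply/closed_enormP => z /= /negP; rewrite -ltNge => zr.
exists (r - dist T z); first by rewrite subr_gt0.
move=> v vz; apply/negP; rewrite -ltNge.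
have := dist_lip T0 v z; lra.
Qed.

Section Trajectories.
Context {R : realType} {n m : nat}.
Variables (A : set 'rV[R]_m) (f : 'rV[R]_n -> 'rV[R]_m -> 'rV[R]_n).
Hypotheses (Ac : compact A)
  (f_cont : {within setT `*` A, continuous (fun q => f q.1 q.2)}).

Lemma coord_joint_continuous i :
  {within setT `*` A, continuous (fun q : 'rV[R]_n * 'rV[R]_m => f q.1 q.2 0 i : R)}.
Proof.
move: f_cont; rewrite !subspace_continuousP => h q Aq.
move=> P hP; have cP := @coord_continuous _ _ _ 0 i (f q.1 q.2) P hP.
exact: (h q Aq _ cP).
Qed.

Lemma coord_lbm i alpha (y : R -> 'rV[R]_n) :
  control A alpha -> {within `[0, +oo[, continuous y} ->
  loc_bounded_meas (fun s => f (y s) (alpha s) 0 i).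
Proof.
move=> ca yc.
exact: (@curve_lbm R n m A (fun z a => f z a 0 i) Ac (@coord_joint_continuous i) _ _ ca yc).
Qed.

Lemma curve_dotp_lbm p alpha (y : R -> 'rV[R]_n) : control A alpha -> {within `[0, +oo[, continuous y} ->
  loc_bounded_meas (fun s => dotp p (f (y s) (alpha s))).
Proof.
move=> ca yc; apply: lbm_sum => i; apply: lbmZ.
exact: coord_lbm.
Qed.

Variables (x : 'rV[R]_n) (alpha : R -> 'rV[R]_m) (y : R -> 'rV[R]_n).
Hypotheses (ca : control A alpha) (ty : trajectory f x alpha y).

Let yc := ty.1.

Lemma traj_coord i t : 0 <= t ->
  y t 0 i = x 0 i + intg (fun s => f (y s) (alpha s) 0 i) 0 t.
Proof.
move=> t0; rewrite ty.2 // intg0E //.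
exact: coord_lbm.
Qed.

Lemma traj0 : y 0 = x.
Proof. by apply/rowP => i; rewrite traj_coord // intg_set0 // addr0. Qed.

Lemma traj_dotp p a b : 0 <= a -> a <= b ->
  dotp p (y b - y a) = intg (fun s => dotp p (f (y s) (alpha s))) a b.
Proof.
move=> a0 ab; have b0 := le_trans a0 ab.
have lb i := coord_lbm i ca yc.
rewrite intg_sum //; last by move=> i; exact: lbmZ.
apply: eq_bigr => i _; rewrite intgZ // !mxE !traj_coord //.
by rewrite (intg_split (lb i) (lexx 0) a0 ab); ring.
Qed.

Lemma traj_speed C a b : 0 <= a -> a <= b ->
  (forall s, a < s <= b -> enorm (f (y s) (alpha s)) <= C) ->
  enorm (y b - y a) <= C * (b - a).
Proof.
move=> a0 ab hC; set v := y b - y a.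
have [->|v0] := eqVneq v 0.
  rewrite enorm0; move: ab; rewrite le_eqVlt => /orP[/eqP->|ab].
    by rewrite subrr mulr0.
  apply: mulr_ge0; last by rewrite subr_ge0 ltW.
  apply: le_trans (enorm_ge0 (f (y b) (alpha b))) _; apply: hC.
  by rewrite ab lexx.
have vp := enorm_gt0 v0.
rewrite -(ler_pM2l vp) -expr2 sqr_enorm {2}/v traj_dotp //.
rewrite mulrA; apply: intg_le => //; first exact: curve_dotp_lbm.
by move=> s sab; apply: le_trans (dotp_le _ _) _; rewrite ler_pM2l //; exact: hC.
Qed.

End Trajectories.

(** * Monotonicity along trajectories *)

Section Suboptimality.
Context {R : realType} {n m : nat}.
Variables (f : 'rV[R]_n -> 'rV[R]_m -> 'rV[R]_n) (h : 'rV[R]_n -> 'rV[R]_m -> R)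
  (A : set 'rV[R]_m) (T : set 'rV[R]_n).
Hypotheses (Ac : compact A) (T0 : T !=set0) (Tcl : closed T)
  (f_cont : {within setT `*` A, continuous (fun q => f q.1 q.2)})
  (f_lip : forall r, 0 < r -> exists2 L, 0 < L &
     forall x1 x2 a, enorm x1 <= r -> enorm x2 <= r -> A a ->
       enorm (f x1 a - f x2 a) <= L * enorm (x1 - x2))
  (f_growth : exists2 M : R, 0 < M &
     forall x a, A a -> enorm (f x a) <= M * (1 + enorm x))
  (h_cont : {within setT `*` A, continuous (fun q => h q.1 q.2)})
  (h_ge0 : forall x a, A a -> 0 <= h x a).
Let D := ~` interior T.
Variable w : 'rV[R]_n -> R.
Hypotheses (wc : {within D, continuous w}) (w01 : forall x, D x -> 0 <= w x <= 1).

(** For r > 0 a compact set disjoint from T, over which the sup- and inf-convolutions are taken. *)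
Definition tube C r := [set z : 'rV[R]_n | enorm z <= C] `&` [set z | r <= dist T z].

Lemma tube_compact C r : compact (tube C r).
Proof.
have Kcl : closed (tube C r).
  apply: closedI; last exact: closed_dist_ge.
  have := @closed_enorm_ball R n 0 C; congr closed.
  by apply/seteqP; split => z /=; rewrite subr0.
have KC z : tube C r z -> enorm z <= C by case.
exact: enorm_bounded_closed_compact Kcl KC.
Qed.

Lemma tube_notT C r z : 0 < r -> tube C r z -> ~ T z.
Proof. by move=> r0 [_ zr]; apply: (dist_gt0_notin T0); exact: lt_le_trans zr. Qed.

Lemma tube_modulus C r k : 0 < r -> 0 < k -> exists2 d, 0 < d &
  forall x z, tube C r x -> tube C r z -> enorm (x - z) < d -> `|w x - w z| < k.
Proof.
move=> r0 k0; have [||d d0 hd] := @compact_uniform R n (tube C r)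
  (fun d x => forall z, tube C r z -> enorm (x - z) < d -> `|w x - w z| < k)
  (@tube_compact C r).
- move=> s t x t0 ts H z Kz xz; apply: H => //; exact: lt_le_trans ts.
- move=> x Kx; have Dx : D x := not_T_D (tube_notT r0 Kx).
  move/within_continuous_enormP: (wc) => /(_ x Dx (k / 2)).
  rewrite divr_gt0 // => /(_ isT)[d d0 hd].
  exists (d / 2); first by rewrite divr_gt0.
  move=> v Kv vx z Kz vz.
  have Dv : D v := not_T_D (tube_notT r0 Kv).
  have Dz : D z := not_T_D (tube_notT r0 Kz).
  have h1 : enorm (v - x) < d by lra.
  have h2 : enorm (z - x) < d.
    by have := enorm_sub_le z v x; rewrite (enormB z v); lra.
  have := hd v Dv h1; have := hd z Dz h2; rewrite !ltr_norml.
  by move=> /andP[? ?] /andP[? ?]; apply/andP; split; lra.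
by exists d => // x z Kx Kz; exact: hd.
Qed.

Lemma tube_sup_conv C r N x : 0 < r -> tube C r !=set0 -> exists2 z, tube C r z &
  forall z', tube C r z' ->
    w z' - N * dotp (x - z') (x - z') <= w z - N * dotp (x - z) (x - z).
Proof.
move=> r0 K0; apply: (@usc_on_max R n (tube C r) D _) => //.
- by move=> z /(tube_notT r0)/not_T_D.
- have Nc : {within D, continuous (fun z' => N * dotp (x - z') (x - z'))}.
    have -> : (fun z' => N * dotp (x - z') (x - z')) = (fun z' => N * dotp (z' - x) (z' - x)).
      by apply/funext => z'; rewrite -(opprB x z') dotpNl dotpNr opprK.
    apply: continuous_in_subspaceT => v _; apply: differentiable_continuous.
    by have /has_gradP[] := has_gradZ N (has_grad_sq x v).
  by apply: continuous_usc => z; apply: cvgB; [exact: wc|exact: Nc].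
exact: tube_compact.
Qed.

Lemma curve_dist_pos (y : R -> 'rV[R]_n) t : {within `[0, +oo[, continuous y} -> 0 <= t ->
  (forall s, 0 <= s <= t -> ~ T (y s)) ->
  exists2 r, 0 < r & forall s, 0 <= s <= t -> r <= dist T (y s).
Proof.
move=> yc t0 yT.
have dc : {within `[0, t], continuous (fun s => dist T (y s))}.
  rewrite subspace_continuousP => s; rewrite /= in_itv /= => /andP[s0 st].
  apply/cvgrPdist_lt => e e0.
  have [d d0 hd] := curve_continuous yc s0 e0.
  apply/nbhs_ballP; exists d => //= u us; rewrite in_itv /= => /andP[u0 _].
  have := hd u u0; rewrite distrC => /(_ us) h1; rewrite ltr_norml.
  have := dist_lip T0 (y s) (y u); have := dist_lip T0 (y u) (y s).
  by rewrite (enormB (y s)) => ? ?; apply/andP; split; lra.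
have [c] := EVT_min t0 dc; rewrite in_itv /= => ct hc.
exists (dist T (y c)); first by apply: dist_gt0 => //; exact: yT.
by move=> s st; apply: hc; rewrite in_itv.
Qed.

End Suboptimality.

(* Along y the regularisation W(z) = max over v in K of w(v) - N |z - v|^2 has one-sided
   Taylor expansions whose gradients are test gradients for w at the maximiser. *)
Lemma suboptimality (R : realType) (n m : nat)
  (f : 'rV[R]_n -> 'rV[R]_m -> 'rV[R]_n) (h : 'rV[R]_n -> 'rV[R]_m -> R)
  (A : set 'rV[R]_m) (T : set 'rV[R]_n)
  (Ac : compact A) (T0 : T !=set0) (Tcl : closed T)
  (f_cont : {within setT `*` A, continuous (fun q => f q.1 q.2)})
  (f_lip : forall r, 0 < r -> exists2 L, 0 < L &
     forall x1 x2 a, enorm x1 <= r -> enorm x2 <= r -> A a ->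
       enorm (f x1 a - f x2 a) <= L * enorm (x1 - x2))
  (f_growth : exists2 M : R, 0 < M &
     forall x a, A a -> enorm (f x a) <= M * (1 + enorm x))
  (h_cont : {within setT `*` A, continuous (fun q => h q.1 q.2)})
  (h_ge0 : forall x a, A a -> 0 <= h x a)
  (w : 'rV[R]_n -> R) (wc : {within ~` interior T, continuous w})
  (w01 : forall x, ~ interior T x -> 0 <= w x <= 1)
  (wsub : viscosity_subsolution (hamiltonian f h A) (~` T) w) x alpha y t :
  control A alpha -> trajectory f x alpha y -> 0 <= t ->
  (forall s, 0 <= s <= t -> ~ T (y s)) ->
  (1 - w (y t)) * expR (- intg (fun s => h (y s) (alpha s)) 0 t) <= 1 - w x.
Proof.
move=> ca ty t0 yT; have yc := ty.1; have [aA _] := ca.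
have [r2 r20 hr2] := curve_dist_pos T0 Tcl yc t0 yT.
pose r := r2 / 2; have r0 : 0 < r by rewrite divr_gt0.
have [C C0 hC] := curve_bounded yc t.
pose K := tube T (C + 1) r.
have yK s : 0 <= s <= t -> K (y s).
  by move=> st; split => /=; [have := hC s st; lra|have := hr2 s st; rewrite /r; lra].
have C10 : 0 < C + 1 by rewrite addr_gt0.
have [L L0 hL] := f_lip _ C10.
have [M M0 hM] := f_growth.
pose Mf := M * (2 + C); have Mf0 : 0 < Mf by rewrite mulr_gt0 // addr_gt0.
have fMf z a : enorm z <= C + 1 -> A a -> enorm (f z a) <= Mf.
  by move=> zC Aa; apply: le_trans (hM z a Aa) _; rewrite ler_pM2l //; lra.
have hlb := curve_lbm Ac h_cont ca yc.
pose H s := intg (fun s => h (y s) (alpha s)) 0 s.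
have H0 s : 0 <= H s by apply: intg_ge0 => v /andP[v0 _]; apply/h_ge0/aA/ltW.
rewrite -/(H t).
(* L depends only on the bound for the curve, so the error vanishes with k; N and the step length
   may depend on k. *)
suff main k : 0 < k -> k <= 1 -> (1 - w (y t)) * expR (- H t) <= 1 - w x + k * (1 + (2 + 2 * L) * t).
  apply/ler_addgt0Pr => e e0.
  have c0 : 0 < 1 + (2 + 2 * L) * t by rewrite ltr_pwDl // mulr_ge0 // addr_ge0 // mulr_ge0 // ltW.
  have m0 : 0 < Num.min 1 (e / (1 + (2 + 2 * L) * t)) by rewrite lt_min ltr01 divr_gt0.
  have m1 : Num.min 1 (e / (1 + (2 + 2 * L) * t)) <= 1 by rewrite ge_min lexx.
  have := main _ m0 m1.
  have : Num.min 1 (e / (1 + (2 + 2 * L) * t)) * (1 + (2 + 2 * L) * t) <= e.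
    by rewrite -ler_pdivlMr // ge_min lexx orbT.
  lra.
move=> k0 k1.
have [dw dw0 hdw] := tube_modulus T0 wc (C + 1) r0 k0.
have [dh dh0 hdh] := joint_uniform Ac h_cont (C + 1) k0.
pose d := Num.min (Num.min dw (dh / 2)) (Num.min (r / 2) (1 / 2)).
have d0 : 0 < d by rewrite !lt_min dw0 !divr_gt0.
(* Since w varies by at most 1, N |z - v|^2 <= 1 at the maximiser v, so |z - v| <= d / 2. *)
pose N := 4 / d ^+ 2; have N0 : 0 < N by rewrite divr_gt0 // exprn_gt0.
have K0 : K !=set0 by exists (y t); apply: yK; rewrite t0 lexx.
have E z : exists z', K z' /\ forall v, K v ->
    w v - N * dotp (z - v) (z - v) <= w z' - N * dotp (z - z') (z - z').
  by have [z' Kz' hz'] := tube_sup_conv T0 wc N z r0 K0; exists z'.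
pose mz z := projT1 (cid (E z)); have mzP z := projT2 (cid (E z)).
rewrite -/(mz _) in mzP.
pose W z := w (mz z) - N * dotp (z - mz z) (z - mz z).
have Kw v : K v -> 0 <= w v <= 1 by move=> /(tube_notT T0 r0)/not_T_D /w01.
have near s : 0 <= s <= t -> [/\ w (y s) <= W (y s), enorm (y s - mz (y s)) < d,
    N * dotp (y s - mz (y s)) (y s - mz (y s)) <= k, W (y s) <= w (mz (y s))
    & w (mz (y s)) <= w (y s) + k].
  move=> st; have Ks := yK s st; have [Kz hz] := mzP (y s).
  rewrite -/(mz (y s)) in Kz hz.
  have h1 := hz _ Ks; rewrite subrr dotp0l mulr0 subr0 in h1.
  have dd := dotp_ge0 (y s - mz (y s)).
  have Nd := mulr_ge0 (ltW N0) dd.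
  have /andP[a1 a2] := Kw _ Ks; have /andP[a3 a4] := Kw _ Kz.
  have hd : enorm (y s - mz (y s)) < d.
    rewrite -(ltr_pXn2r (ltn0Sn 1)) ?nnegrE ?enorm_ge0 ?(ltW d0) // sqr_enorm.
    have : N * dotp (y s - mz (y s)) (y s - mz (y s)) <= 1.
      by clear - h1 a1 a4; lra.
    rewrite /N mulrAC ler_pdivrMr ?exprn_gt0 // mul1r.
    have := exprn_gt0 2 d0; clear; lra.
  have hw : `|w (y s) - w (mz (y s))| < k.
    by apply: hdw => //; apply: lt_le_trans hd _; rewrite !ge_min lexx.
  move: hw; rewrite ltr_norml /W => /andP[b1 b2].
  by clear - b1 b2 h1 Nd hd a1 a2 a3 a4; split => //; lra.
pose Q z := 1 - W z.
have Q0 s : 0 <= s <= t -> 0 <= Q (y s).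
  move=> st; have [_ _ _ h1 _] := near s st; have [Kz _] := mzP (y s).
  by have /andP[_ h2] := Kw _ Kz; rewrite /Q; rewrite -/(mz (y s)) in h2; clear - h1 h2; lra.
(* The terms of second order in b - a are at most c1 (b - a)^2, and c1 (b - a) <= k. *)
pose c1 := 2 * N * L * Mf + N * Mf ^+ 2 + 1.
have c10 : 0 < c1.
  have a1 : 0 < 2 * N * L * Mf by do !apply: mulr_gt0 => //.
  have a2 : 0 < N * Mf ^+ 2 by rewrite mulr_gt0 // exprn_gt0.
  by rewrite /c1; lra.
pose s0 := Num.min (k / c1) (dh / (4 * Mf)).
have s00 : 0 < s0 by rewrite lt_min !divr_gt0 // mulr_gt0.
have := @local_growth R (fun s => Q (y s) * expR (- H s)) (k * (2 + 2 * L)) s0 t s00 t0 _.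
have HH0 : H 0 = 0 by rewrite /H intg_set0.
rewrite HH0 oppr0 expR0 mulr1 (traj0 Ac f_cont ca ty) => HG.
have : Q (y t) * expR (- H t) - Q x <= k * (2 + 2 * L) * t.
  apply: HG => a b a0 ab bt bas.
  have st : 0 <= a <= t by rewrite a0 (le_trans ab bt).
  have [n1 n2 n3 n4 n5] := near a st; have [Kz hz] := mzP (y a).
  rewrite -/(mz (y a)) in Kz hz; set z := mz (y a) in n2 n3 n4 n5 Kz hz.
  set X := y a in n1 n2 n3 n4 n5 Kz hz *.
  have b0 := le_trans a0 ab.
  have btt : 0 <= b <= t by rewrite b0.
  have hb s : a < s <= b -> 0 <= s <= t.
    by move=> /andP[q1 q2]; clear - q1 q2 bt a0; apply/andP; split; lra.
  have [bs1 bs2] : c1 * (b - a) <= k /\ 4 * Mf * (b - a) <= dh.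
    have M4 : 0 < 4 * Mf by rewrite mulr_gt0.
    have [q1 q2] : s0 <= k / c1 /\ s0 <= dh / (4 * Mf) by rewrite !ge_min !lexx orbT.
    by split; rewrite mulrC -ler_pdivlMr //; exact: le_trans bas _.
  have ba0 : 0 <= b - a by rewrite subr_ge0.
  have spd s : a < s <= b -> enorm (y s - X) <= Mf * (b - a).
    move=> sab; case/andP: (sab) => sa sb.
    apply: le_trans (traj_speed Ac f_cont ca ty (C := Mf) a0 (ltW sa) _) _.
      move=> v /andP[va vs]; have vt : 0 <= v <= t by apply: hb; rewrite va (le_trans vs sb).
      by apply: fMf; [case: (yK v vt)|apply: aA; case/andP: vt].
    by rewrite ler_pM2l // lerD2r.
  (* The gradient at z of N |v - X|^2, which touches w from above at z up to a constant. *)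
  pose p := 2 * N *: (z - X).
  have Tz : ~ T z := tube_notT T0 r0 Kz.
  have zin : exists2 rz, 0 < rz & forall v, enorm (v - z) < rz -> K v.
    move: n2; rewrite !lt_min => /andP[_ /andP[n2 n2']].
    exists (Num.min (r / 2) (1 / 2)); first by rewrite lt_min !divr_gt0.
    move=> v; rewrite lt_min => /andP[v1 v2]; split => /=.
      have := hC a st; have := enorm_le_dist v z; have := enorm_le_dist z X.
      by rewrite (enormB z X) -/X; clear - v2 n2'; lra.
    have := hr2 a st; have := dist_lip T0 X z; have := dist_lip T0 z v.
    by rewrite (enormB z v) -/X /r in v1 n2 *; clear - v1 n2; lra.
  have [rz rz0 hrz] := zin.
  have phiC : C1_with (~` T) (fun v => N * dotp (v - X) (v - X))
      (fun v => N *: (2 *: (v - X))) by apply: C1_withZ; exact: C1_with_sq.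
  have sqC (u v : 'rV[R]_n) : dotp (u - v) (u - v) = dotp (v - u) (v - u).
    by rewrite -(opprB v u) dotpNl dotpNr opprK.
  have Hs : forall a', A a' -> - dotp p (f z a') - h z a' + h z a' * w z <= 0.
    have := subsol_test wsub phiC Tz rz0.
    rewrite scalerA [N * 2]mulrC; apply => v vz.
    by have := hz v (hrz v vz); rewrite (sqC v X) (sqC z X).
  have N2 : 0 <= 2 * N by rewrite mulr_ge0 // ltW.
  have pE : enorm p = 2 * N * enorm (X - z).
    by rewrite /p enormZ ger0_norm // (enormB z X).
  have pn : enorm p * enorm (X - z) <= 2 * k.
    have -> : enorm p * enorm (X - z) = 2 * (N * enorm (X - z) ^+ 2) by rewrite pE; ring.
    by rewrite sqr_enorm; clear - n3; lra.
  have pn1 : enorm p <= 2 * N.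
    rewrite pE ler_piMr //.
    by move: n2; rewrite !lt_min => /andP[_ /andP[_ n2]]; clear - n2; lra.
  have zC : enorm z <= C + 1 by case: Kz.
  have /andP[wz0 wz1] := Kw _ Kz.
  (* The test at z is carried to y s. Although p is of size up to N, the Lipschitz error stays small
     because |p| |X - z| = 2 N |X - z|^2 <= 2 k. *)
  have pw s : a < s <= b -> - (Q X * h (y s) (alpha s) + (k + 2 * L * k + 2 * N * L * Mf * (b - a)))
      <= dotp p (f (y s) (alpha s)).
    move=> sab; have st' := hb s sab; have As : A (alpha s) by apply: aA; case/andP: st'.
    have [yC _] := yK s st'; have sp := spd s sab.
    have d1 : dotp p (f z (alpha s)) - dotp p (f (y s) (alpha s)) <=
        2 * L * k + 2 * N * L * Mf * (b - a).
      rewrite -dotpBr; apply: le_trans (dotp_le _ _) _.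
      have := hL z (y s) _ zC yC As; have := enorm_sub_le (y s) X z.
      rewrite (enormB z (y s)) => e1 e2.
      apply: (@le_trans _ _ (enorm p * (L * (Mf * (b - a) + enorm (X - z))))).
        rewrite ler_wpM2l ?enorm_ge0 //; apply: le_trans e2 _.
        by rewrite ler_pM2l //; clear - sp e1; lra.
      have LM : 0 <= L * (Mf * (b - a)).
        by apply: mulr_ge0; [exact: ltW|apply: mulr_ge0 => //; exact: ltW].
      have := ler_wpM2r LM pn1; have := ler_wpM2l (ltW L0) pn.
      rewrite mulrDr mulrDr mulrCA; clear; lra.
    have d2 : h z (alpha s) <= h (y s) (alpha s) + k.
      have : `|h (y s) (alpha s) - h z (alpha s)| < k.
        apply: hdh => //; have := enorm_sub_le (y s) X z.
        have : d <= dh / 2 by rewrite !ge_min lexx orbT.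
        by clear - n2 sp bs2 dh0; lra.
      by rewrite ltr_norml => /andP[q1 q2]; clear - q1 q2; lra.
    have d3 := Hs _ As; have hy0 := h_ge0 (y s) _ As; have hz0 := h_ge0 z _ As.
    have d4 : (1 - w z) * h (y s) (alpha s) <= Q X * h (y s) (alpha s).
      by apply: ler_wpM2r => //; rewrite /Q; clear - n4; lra.
    have d5 : (1 - w z) * h z (alpha s) <= (1 - w z) * (h (y s) (alpha s) + k).
      by apply: ler_wpM2l => //; clear - wz1; lra.
    have d6 : (1 - w z) * k <= k by rewrite ler_piMl ?(ltW k0) //; clear - wz0; lra.
    rewrite mulrDr in d5; clear - d1 d3 d4 d5 d6; lra.
  set u := intg (fun s => h (y s) (alpha s)) a b.
  have u0 : 0 <= u by apply: intg_ge0 => s /hb/andP[? _]; exact/h_ge0/aA.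
  have int1 : - (Q X * u + (k + 2 * L * k + 2 * N * L * Mf * (b - a)) * (b - a))
      <= dotp p (y b - X).
    rewrite (traj_dotp Ac f_cont ca ty) //.
    have lc := lbm_cst (k + 2 * L * k + 2 * N * L * Mf * (b - a)).
    have lq := lbmZ (Q X) hlb.
    rewrite -(intg_cst _ ab) -intgZ // -intgD // -mulN1r -intgZ //; last exact: lbmD.
    apply: le_intg => //.
    - by apply: lbmZ; exact: lbmD.
    - exact: (curve_dotp_lbm Ac f_cont p ca yc).
    by move=> s sab; rewrite mulN1r; exact: pw.
  have Wb : W X + dotp p (y b - X) - N * (Mf * (b - a)) ^+ 2 <= W (y b).
    have [Kzb hzb] := mzP (y b); apply: le_trans (hzb z Kz).
    have sp : dotp (y b - X) (y b - X) <= (Mf * (b - a)) ^+ 2.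
      have MB : 0 <= Mf * (b - a) by apply: mulr_ge0 => //; exact: ltW.
      rewrite -sqr_enorm ler_pXn2r ?nnegrE ?enorm_ge0 //.
      move: ab; rewrite le_eqVlt => /orP[/eqP E'|ab].
        by rewrite /X E' subrr enorm0 subrr mulr0.
      by apply: spd; rewrite ab lexx.
    have -> : y b - z = (y b - X) + (X - z) by rewrite addrA subrK.
    have := ler_wpM2l (ltW N0) sp; rewrite /W -/z /p -(opprB X z).
    move: (y b - X) (X - z) => U V'.
    rewrite scalerN dotpNl dotpZl !dotpDl !dotpDr (dotpC U V'); clear; lra.
  have hQ : Q (y b) <= Q X * expR u + k * (2 + 2 * L) * (b - a).
    have := ler_wpM2l (Q0 a st) (expR_ge1Dx u); rewrite mulrDr mulr1 -/X => e1.
    have e2 : c1 * (b - a) * (b - a) <= k * (b - a) by rewrite ler_wpM2r.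
    have e3 : 0 <= (b - a) * (b - a) by rewrite mulr_ge0.
    rewrite /c1 in e2; rewrite /Q in e1 int1 *; clear - e1 e2 e3 int1 Wb; lra.
  have HE : H b = H a + u by rewrite /H (intg_split hlb (lexx 0) a0 ab).
  have eb : expR (- H b) <= 1 by rewrite -[leRHS]expR0 ler_expR oppr_le0.
  have EE : Q X * expR u * expR (- H b) = Q X * expR (- H a).
    by rewrite -mulrA -expRD HE opprD addrCA subrr addr0.
  have kk : 0 <= k * (2 + 2 * L) * (b - a).
    have L2 : 0 <= 2 + 2 * L by clear - L0; lra.
    exact: (mulr_ge0 (mulr_ge0 (ltW k0) L2) ba0).
  have e7 := ler_wpM2r (expR_ge0 (- H b)) hQ; rewrite (mulrDl (Q X * expR u) _ (expR (- H b))) EE in e7.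
  have e8 := ler_wpM2l kk eb; rewrite mulr1 in e8.
  by rewrite lerBlDl; apply: le_trans e7 _; rewrite lerD2l.
(* Back from W to w: W >= w at the start and W <= w + k at the end. *)
have x0 : y 0 = x := traj0 Ac f_cont ca ty.
have [n1 _ _ _ _] := near 0 (ltac:(by rewrite lexx)).
have [_ _ _ n4 n5] := near t (ltac:(by rewrite t0 lexx)).
rewrite x0 in n1.
have eb : expR (- H t) <= 1 by rewrite -[leRHS]expR0 ler_expR oppr_le0.
have e0 := expR_ge0 (- H t).
have : (1 - w (y t) - k) * expR (- H t) <= Q (y t) * expR (- H t).
  by apply: (ler_wpM2r e0); rewrite /Q; clear - n4 n5; lra.
have : k * expR (- H t) <= k by rewrite ler_piMr // ltW.
rewrite /Q; lra.
Qed.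

Lemma lbm_exp (R : realType) (c : R) : loc_bounded_meas (fun s => c * expR (c * s)).
Proof.
split.
  apply: measurable_funTS; apply: continuous_measurable_fun => s.
  apply: cvgM; first exact: cvg_cst.
  apply: continuous_comp; last exact: continuous_expR.
  by apply: cvgM; [exact: cvg_cst|exact: cvg_id].
move=> t; exists (`|c| * expR (`|c| * `|t|)) => s /andP[s0 st].
rewrite normrM ler_wpM2l // ger0_norm ?expR_ge0 // ler_expR.
apply: le_trans (ler_norm _) _; rewrite normrM ler_wpM2l //.
by rewrite !ger0_norm // (le_trans s0 st).
Qed.

Lemma intg_exp (R : realType) (c t : R) : 0 <= t ->
  intg (fun s => c * expR (c * s)) 0 t = expR (c * t) - 1.
Proof.
rewrite le_eqVlt => /orP[/eqP<-|t0]; first by rewrite intg_set0 // mulr0 expR0 subrr.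
rewrite -intg0E; last exact: lbm_exp.
pose F (s : R) := expR (c * s).
have FD (s : R) : is_derive s 1 F (c * expR (c * s)).
  have h : is_derive s 1 (fun u : R => c * u) c.
    have := @is_deriveZ R R R id c s 1 1 (is_derive_id s 1).
    by rewrite /GRing.scale /= mulr1.
  have := @is_derive1_comp R expR (fun u => c * u) s (expR (c * s)) c (is_derive_expR _) h.
  by rewrite mulrC.
have Fc s : F u @[u --> s] --> F s.
  by apply: differentiable_continuous; apply/derivable1_diffP; case: (FD s).
have := @continuous_FTC2 R (fun s => c * expR (c * s)) F 0 t t0 _ _ _.
rewrite /Rintegral => ->; first by rewrite /F mulr0 expR0.
- apply: continuous_subspaceT => s; apply: cvgM; [exact: cvg_cst|exact: Fc].
- split.
  + by move=> s _; case: (FD s).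
  + apply: cvg_at_right_filter; exact: Fc.
  + apply: cvg_at_left_filter; exact: Fc.
- by move=> s _; rewrite derive1E; have := FD s => h; exact: derive_val.
Qed.

Lemma div_pow2_small (R : realType) (C e : R) : 0 <= C -> 0 < e ->
  exists k0, forall k, (k0 <= k)%N -> C / 2 ^+ k < e.
Proof.
move=> C0 e0; exists (Num.bound (C / e)) => k kk.
have := archi_boundP (divr_ge0 C0 (ltW e0)); rewrite ltr_pdivrMr // => h.
rewrite ltr_pdivrMr ?exprn_gt0 //; apply: lt_le_trans h _.
rewrite mulrC ler_pM2l // -natrX ler_nat.
by apply: leq_trans kk _; apply/ltnW/ltn_expl.
Qed.

(** The sequences u k - 2 C / 2 ^ k and u k + 2 C / 2 ^ k are monotone in opposite directions and
    enclose the limit, which also gives the rate. *)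
Lemma geometric_lim (R : realType) (u : nat -> R) (C : R) :
  (forall k, `|u k.+1 - u k| <= C / 2 ^+ k) ->
  forall k, `|u k - lim (u j @[j --> \oo])| <= 2 * C / 2 ^+ k.
Proof.
move=> hu.
have p2 k : 0 < 2 ^+ k :> R by rewrite exprn_gt0.
have C0 : 0 <= C.
  by have := le_trans (normr_ge0 _) (hu 0%N); rewrite expr0 divr1.
have e2 k : C / 2 ^+ k = 2 * (C / 2 ^+ k.+1).
  by rewrite exprS; field; rewrite gt_eqF.
have E2 k : 2 * C / 2 ^+ k = 2 * (C / 2 ^+ k) by rewrite mulrA.
pose a k := u k - 2 * (C / 2 ^+ k); pose b k := u k + 2 * (C / 2 ^+ k).
have as_ k : a k <= a k.+1.
  have := hu k; rewrite ler_norml /a => /andP[h1 h2]; have := e2 k; lra.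
have bs_ k : b k.+1 <= b k.
  have := hu k; rewrite ler_norml /b => /andP[h1 h2]; have := e2 k; lra.
have am : nondecreasing_seq a by apply/nondecreasing_seqP.
have bm : nonincreasing_seq b by apply/nonincreasing_seqP.
have Cp k : 0 <= C / 2 ^+ k by rewrite divr_ge0 // ltW.
have ab j k : a j <= b k.
  have := am j (maxn j k) (leq_maxl _ _); have := bm k (maxn j k) (leq_maxr _ _).
  have := Cp (maxn j k); rewrite /a /b; lra.
have Sub k : ubound (range a) (b k) by move=> _ [j _ <-]; exact: ab.
have hS : has_sup (range a) by split; [exists (a 0%N), 0%N|exists (b 0%N)].
pose s := sup (range a).
have sk k : `|u k - s| <= 2 * (C / 2 ^+ k).
  have h1 : a k <= s by apply: ub_le_sup; [exact: hS.2|exists k].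
  have h2 : s <= b k by apply: ge_sup; [exact: hS.1|exact: Sub].
  by rewrite ler_norml; rewrite /a /b in h1 h2; apply/andP; split; lra.
suff -> : lim (u j @[j --> \oo]) = s by move=> k; rewrite E2.
apply/cvg_lim => //; apply/cvgrPdist_lt => e e0.
have [|k0 hk] := div_pow2_small (C := 2 * C) _ e0; first by rewrite mulr_ge0.
exists k0 => // k /= kk; rewrite distrC; apply: le_lt_trans (hk k kk).
by rewrite E2.
Qed.

(** * Flow of a control *)

Lemma rowB (R : realType) n (u v : 'rV[R]_n) i : (u - v) 0 i = u 0 i - v 0 i.
Proof. by rewrite !mxE. Qed.

Section Picard.
Context {R : realType} {n m : nat}.
Variables (f : 'rV[R]_n -> 'rV[R]_m -> 'rV[R]_n).

Definition picard_step (x : 'rV[R]_n) (alpha : R -> 'rV[R]_m) (y : R -> 'rV[R]_n)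
    (t : R) : 'rV[R]_n :=
  \row_i (x 0 i + intg (fun s => f (y s) (alpha s) 0 i) 0 t).

Definition picard x alpha k := iter k (picard_step x alpha) (fun=> x).

Lemma picardS x alpha k t i : picard x alpha k.+1 t 0 i =
  x 0 i + intg (fun s => f (picard x alpha k s) (alpha s) 0 i) 0 t.
Proof. by rewrite mxE. Qed.

(** An explicit limit of Picard iterates selects one trajectory per control. Each iterate up to time
    t depends on the control up to t only, which is how [flow_causal] is obtained and controls can
    be concatenated. *)
Definition flow x alpha t : 'rV[R]_n :=
  \row_i lim (picard x alpha k t 0 i @[k --> \oo]).

Lemma flow_causal x alpha beta t : (forall s, s <= t -> alpha s = beta s) ->
  forall s, s <= t -> flow x alpha s = flow x beta s.
Proof.
move=> ab; have H k : forall s, s <= t -> picard x alpha k s = picard x beta k s.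
  elim: k => [//|k IH] s st; apply/rowP => i; rewrite !picardS; congr (_ + _).
  apply: eq_intg => v /andP[_ vs]; have vt := le_trans vs st.
  by rewrite (IH v vt) (ab v vt).
move=> s st; apply/rowP => i; rewrite !mxE.
have E : (fun k => picard x alpha k s 0 i) = (fun k => picard x beta k s 0 i).
  by apply/funext => k; rewrite (H k s st).
by rewrite E.
Qed.

Variable A : set 'rV[R]_m.
Context (Ac : compact A)
  (f_cont : {within setT `*` A, continuous (fun q => f q.1 q.2)})
  (f_lip : forall r, 0 < r -> exists2 L, 0 < L &
     forall x1 x2 a, enorm x1 <= r -> enorm x2 <= r -> A a ->
       enorm (f x1 a - f x2 a) <= L * enorm (x1 - x2))
  (M : R) (M0 : 0 < M)
  (f_growth : forall x a, A a -> enorm (f x a) <= M * (1 + enorm x)).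

(** Speed bound for a Picard image y of another curve z, with a bound g that may vary in time. *)
Lemma curve_speed (y z : R -> 'rV[R]_n) (alpha : R -> 'rV[R]_m) (g : R -> R) (a b : R) (x : 'rV[R]_n) :
  control A alpha -> {within `[0, +oo[, continuous z} -> loc_bounded_meas g ->
  (forall t, 0 <= t ->
     y t = \row_i (x 0 i + intg (fun s => f (z s) (alpha s) 0 i) 0 t)) ->
  0 <= a -> a <= b -> (forall s, a < s <= b -> enorm (f (z s) (alpha s)) <= g s) ->
  enorm (y b - y a) <= intg g a b.
Proof.
move=> ca zc gl yE a0 ab hg; have b0 := le_trans a0 ab; set v := y b - y a.
have vE p : dotp p v = intg (fun s => dotp p (f (z s) (alpha s))) a b.
  have lb i := coord_lbm Ac f_cont i ca zc.
  rewrite intg_sum //; last by move=> i; exact: lbmZ.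
  apply: eq_bigr => i _; rewrite intgZ // /v !yE // !mxE.
  by rewrite (intg_split (lb i) (lexx 0) a0 ab); ring.
have [->|v0] := eqVneq v 0.
  rewrite enorm0; apply: intg_ge0 => s sab.
  by apply: le_trans (enorm_ge0 (f (z s) (alpha s))) _; apply: hg.
have vp := enorm_gt0 v0.
rewrite -(ler_pM2l vp) -expr2 sqr_enorm vE -intgZ //.
apply: le_intg => //.
- exact: (curve_dotp_lbm Ac f_cont _ ca zc).
- exact: lbmZ.
- by move=> s sab; apply: le_trans (dotp_le _ _) _; rewrite ler_pM2l //; exact: hg.
Qed.

Lemma lipschitz_within_continuous (y : R -> 'rV[R]_n) :
  (forall t, exists2 C, 0 < C & forall a b, 0 <= a -> a <= b -> b <= t ->
     enorm (y b - y a) <= C * (b - a)) -> {within `[0, +oo[, continuous y}.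
Proof.
move=> hy; rewrite subspace_continuousP => s; rewrite /= in_itv /= andbT => s0.
move=> P /nbhs_enormP[e e0 eP]; have [C C0 hC] := hy (s + 1).
apply/nbhs_ballP; exists (Num.min 1 (e / C)) => /=; first by rewrite lt_min ltr01 divr_gt0.
move=> u; rewrite /ball /= lt_min => /andP[u1 ue]; rewrite in_itv /= andbT => u0.
apply: eP; have hs : `|s - u| * C < e by rewrite -ltr_pdivlMr.
have [us|us] := leP u s.
  rewrite enormB; apply: le_lt_trans (hC u s u0 us _) _; first by rewrite lerDl.
  by rewrite mulrC -(ger0_norm (_ : 0 <= s - u)) // subr_ge0.
apply: le_lt_trans (hC s u s0 (ltW us) _) _.
  by move: u1; rewrite distrC ltr_norml => /andP[_ ?]; lra.
by rewrite mulrC -(gtr0_norm (_ : 0 < u - s)) ?subr_gt0 // distrC.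
Qed.

Variables (x : 'rV[R]_n) (alpha : R -> 'rV[R]_m).
Hypothesis ca : control A alpha.

(** The bound reproduces itself, because the integral of M (1 + |x|) exp(M s) over [0, t] is (1 +
    |x|) (exp(M t) - 1). All iterates thus share one ball and one Lipschitz constant. *)
Lemma picard_props k :
  {within `[0, +oo[, continuous (picard x alpha k)} /\
  forall t, 0 <= t -> enorm (picard x alpha k t) <= (1 + enorm x) * expR (M * t) - 1.
Proof.
have [aA _] := ca.
have x1 : 0 < 1 + enorm x by rewrite ltr_pwDl ?enorm_ge0.
elim: k => [|k [IHc IHb]].
  split; first by apply: continuous_subspaceT => s; exact: cvg_cst.
  move=> t t0; have : 1 <= expR (M * t) by rewrite -expR0 ler_expR mulr_ge0 // ltW.
  by move=> /(ler_wpM2l (ltW x1)); rewrite mulr1 /=; lra.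
have yE t : 0 <= t -> picard x alpha k.+1 t =
    \row_i (x 0 i + intg (fun s => f (picard x alpha k s) (alpha s) 0 i) 0 t) by [].
have gl : loc_bounded_meas (fun s => (1 + enorm x) * (M * expR (M * s))).
  by apply: lbmZ; exact: lbm_exp.
have hg s : 0 <= s -> enorm (f (picard x alpha k s) (alpha s)) <=
    (1 + enorm x) * (M * expR (M * s)).
  move=> s0; apply: le_trans (f_growth _ (aA s s0)) _.
  rewrite mulrCA ler_pM2l //; have := IHb s s0; lra.
split.
  apply: lipschitz_within_continuous => t.
  exists ((1 + enorm x) * (M * expR (M * t))); first by rewrite !mulr_gt0 // expR_gt0.
  move=> a b a0 ab bt; rewrite -intg_cst //.
  apply: (curve_speed ca IHc (lbm_cst _) yE a0 ab) => s /andP[sa sb].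
  have s0 : 0 <= s by apply: le_trans a0 (ltW sa).
  apply: le_trans (hg s s0) _.
  by rewrite !ler_pM2l // ler_expR ler_pM2l // (le_trans sb).
move=> t t0.
have h : enorm (picard x alpha k.+1 t - picard x alpha k.+1 0) <=
    intg (fun s => (1 + enorm x) * (M * expR (M * s))) 0 t.
  by apply: (curve_speed ca IHc gl yE) => // s /andP[s0 _]; exact/hg/ltW.
have y0 : picard x alpha k.+1 0 = x.
  by apply/rowP => i; rewrite picardS intg_set0 // addr0.
rewrite y0 intgZ ?intg_exp // in h; last exact: lbm_exp.
have := enorm_le_dist (picard x alpha k.+1 t) x; lra.
Qed.

(* Picard's map halves distances in the norm weighted by exp(- 2 L s). *)
Lemma picard_contract t : 0 <= t -> exists2 C, 0 <= C & forall k s i, 0 <= s <= t ->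
  `|picard x alpha k.+1 s 0 i - picard x alpha k s 0 i| <= C / 2 ^+ k.
Proof.
move=> t0; have [aA _] := ca; have hP := picard_props.
pose r := (1 + enorm x) * expR (M * t).
have x1 : 0 < 1 + enorm x by rewrite ltr_pwDl ?enorm_ge0.
have r0 : 0 < r by rewrite mulr_gt0 // expR_gt0.
have pr k s : 0 <= s <= t -> enorm (picard x alpha k s) <= r.
  move=> /andP[s0 st]; apply: le_trans ((hP k).2 s s0) _.
  have : (1 + enorm x) * expR (M * s) <= r.
    by rewrite ler_pM2l // ler_expR ler_pM2l.
  lra.
have [L L0 hL] := f_lip r0.
pose C := 2 * r.
exists (C * expR (2 * L * t)); first by rewrite !mulr_ge0 ?expR_ge0 // ltW.
have L2 : 0 < 2 * L by rewrite mulr_gt0.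
have H k s : 0 <= s <= t -> enorm (picard x alpha k.+1 s - picard x alpha k s) <=
    C / 2 ^+ k * expR (2 * L * s).
  elim: k s => [|k IH] s st; have /andP[s0 s1] := st.
    rewrite expr0 divr1; apply: (@le_trans _ _ C).
      apply: le_trans (enormD _ _) _; rewrite enormN /C mulr2n mulrDl !mul1r.
      by apply: lerD; exact: pr.
    have e1 : 1 <= expR (2 * L * s) by rewrite -[leLHS]expR0 ler_expR mulr_ge0 // ltW.
    by rewrite ler_peMr // /C mulr_ge0 // ltW.
  pose z s := picard x alpha k.+2 s - picard x alpha k.+1 s.
  have lb j i := coord_lbm Ac f_cont i ca (hP j).1.
  have vE p : dotp p (z s) = intg (fun v => dotp p (f (picard x alpha k.+1 v) (alpha v)) +
      -1 * dotp p (f (picard x alpha k v) (alpha v))) 0 s.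
    have l1 := curve_dotp_lbm Ac f_cont p ca (hP k.+1).1.
    have l2 := curve_dotp_lbm Ac f_cont p ca (hP k).1.
    rewrite intgD // ?intgZ //; last exact: lbmZ.
    rewrite intg_sum //; last by move=> i; exact: lbmZ.
    rewrite intg_sum //; last by move=> i; exact: lbmZ.
    rewrite mulN1r -sumrB; apply: eq_bigr => i _.
    by rewrite !intgZ // /z !mxE; ring.
  have E : C / 2 ^+ k.+1 * expR (2 * L * s) =
      C / 2 ^+ k.+1 + intg (fun v => C / 2 ^+ k.+1 * (2 * L * expR (2 * L * v))) 0 s.
    by rewrite intgZ ?intg_exp //; [ring|exact: lbm_exp].
  have Cp j : 0 <= C / 2 ^+ j by rewrite divr_ge0 ?exprn_ge0 // mulr_ge0 // ltW.
  rewrite -/(z s); have [->|v0] := eqVneq (z s) 0.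
    by rewrite enorm0 mulr_ge0 ?expR_ge0.
  have vp := enorm_gt0 v0.
  rewrite E -lerBlDl; apply: (@le_trans _ _ (enorm (z s))); first by rewrite gerBl.
  rewrite -(ler_pM2l vp) -expr2 sqr_enorm vE -intgZ //; last by apply: lbmZ; exact: lbm_exp.
  apply: le_intg => //.
  - apply: lbmD; first exact: (curve_dotp_lbm Ac f_cont _ ca (hP k.+1).1).
    by apply: lbmZ; exact: (curve_dotp_lbm Ac f_cont _ ca (hP k).1).
  - by apply: lbmZ; apply: lbmZ; exact: lbm_exp.
  move=> v /andP[v0' vs]; have vt : 0 <= v <= t by rewrite ltW //= (le_trans vs).
  rewrite mulN1r -dotpBr; apply: le_trans (dotp_le _ _) _; rewrite ler_pM2l //.
  have Av : A (alpha v) by apply/aA/ltW.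
  apply: le_trans (hL _ _ _ (pr _ _ vt) (pr _ _ vt) Av) _.
  have := IH v vt; rewrite -(ler_pM2l L0) => h; apply: le_trans h _.
  rewrite exprS le_eqVlt; apply/orP; left; apply/eqP; field.
  by rewrite expf_neq0.
move=> k s i st; apply: (@le_trans _ _ (enorm (picard x alpha k.+1 s - picard x alpha k s))).
  by have := coord_le_enorm (picard x alpha k.+1 s - picard x alpha k s) i; rewrite rowB.
apply: le_trans (H k s st) _; case/andP: st => s0 s1.
rewrite mulrAC ler_wpM2r ?invr_ge0 ?exprn_ge0 //.
have C0 : 0 < C by rewrite mulr_gt0.
by rewrite (ler_pM2l C0) ler_expR (ler_pM2l L2).
Qed.

Lemma picard_flow t : 0 <= t -> exists2 C, 0 <= C & forall k s, 0 <= s <= t ->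
  enorm (picard x alpha k s - flow x alpha s) <= C / 2 ^+ k.
Proof.
move=> t0; have [C' C'0 hC'] := picard_contract t0.
pose C := 2 * C'; have C0 : 0 <= C by rewrite mulr_ge0.
have hC k s i : 0 <= s <= t -> `|picard x alpha k s 0 i - flow x alpha s 0 i| <= C / 2 ^+ k.
  move=> st; rewrite [flow _ _ _]/flow mxE.
  apply: (@geometric_lim R (fun k => picard x alpha k s 0 i) C') => j.
  exact: hC'.
exists (n%:R * C); first by rewrite mulr_ge0.
move=> k s st; apply: le_trans (enorm_le_sum _) _.
have -> : n%:R * C / 2 ^+ k = \sum_(i < n) (C / 2 ^+ k).
  by rewrite sumr_const card_ord -[RHS]mulr_natl mulrA.
by apply: ler_sum => i _; rewrite rowB; exact: hC.
Qed.

Let x1 : 0 < 1 + enorm x. Proof. by rewrite ltr_pwDl ?enorm_ge0. Qed.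

Lemma picard_bound k s t : 0 <= s <= t ->
  enorm (picard x alpha k s) <= (1 + enorm x) * expR (M * t).
Proof.
move=> /andP[s0 st]; apply: le_trans ((picard_props k).2 s s0) _.
have : (1 + enorm x) * expR (M * s) <= (1 + enorm x) * expR (M * t).
  by rewrite ler_pM2l // ler_expR ler_pM2l.
lra.
Qed.

Lemma le_geometric (u v C : R) : 0 <= C -> (forall k, u <= v + C / 2 ^+ k) -> u <= v.
Proof.
move=> C0 h; apply/ler_addgt0Pr => e e0; have [k0 hk] := div_pow2_small C0 e0.
by have := h k0; have := hk k0 (leqnn _); lra.
Qed.

Lemma flow_bound s t : 0 <= s <= t ->
  enorm (flow x alpha s) <= (1 + enorm x) * expR (M * t).
Proof.
move=> st; have t0 : 0 <= t by case/andP: st => /le_trans; apply.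
have [C C0 hC] := picard_flow t0; apply: (le_geometric C0) => k.
have := enorm_le_dist (flow x alpha s) (picard x alpha k s).
rewrite enormB; have := picard_bound k st; have := hC k s st; lra.
Qed.

Lemma flow_trajectory : trajectory f x alpha (flow x alpha).
Proof.
have [aA _] := ca; have hP := picard_props.
have approxe := picard_flow.
pose r t := (1 + enorm x) * expR (M * t).
have r0 t : 0 < r t by rewrite mulr_gt0 // expR_gt0.
have fc : {within `[0, +oo[, continuous (flow x alpha)}.
  apply: lipschitz_within_continuous => t.
  have [t0|t0] := leP 0 t; last by exists 1 => // a b a0 ab bt; exfalso; lra.
  have [C C0 hC] := approxe t t0.
  exists (M * (1 + r t)); first by rewrite mulr_gt0 // addr_gt0.
  move=> a b a0 ab bt; apply: (le_geometric (C := 2 * C)); first by rewrite mulr_ge0.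
  move=> k; have at' : 0 <= a <= t by rewrite a0 (le_trans ab).
  have bt' : 0 <= b <= t by rewrite bt (le_trans a0).
  have p1 : enorm (picard x alpha k.+1 b - picard x alpha k.+1 a) <= M * (1 + r t) * (b - a).
    rewrite -intg_cst //; apply: (@curve_speed _ _ _ _ _ _ x ca (hP k).1 (lbm_cst _)) => //.
    move=> s /andP[sa sb]; have st : 0 <= s <= t by apply/andP; split; lra.
    apply: le_trans (f_growth _ (_ : A (alpha s))) _; first by apply: aA; case/andP: st.
    by rewrite ler_pM2l // lerD2l; exact: picard_bound.
  have h1 := hC k.+1 a at'; have h2 := hC k.+1 b bt'.
  have h3 : C / 2 ^+ k.+1 <= C / 2 ^+ k.
    rewrite ler_wpM2l // lef_pV2 ?posrE ?exprn_gt0 // exprS ler_peMl ?exprn_ge0 //.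
    by rewrite ler1n.
  have h4 := enorm_sub_le (flow x alpha b) (picard x alpha k.+1 b) (flow x alpha a).
  have h5 := enorm_sub_le (picard x alpha k.+1 b) (picard x alpha k.+1 a) (flow x alpha a).
  rewrite enormB in h2.
  have -> : 2 * C / 2 ^+ k = 2 * (C / 2 ^+ k) by rewrite mulrA.
  move: p1 h1 h2 h3 h4 h5; move: (M * _ * _) (C / _) (C / _) => Z1 Z2 Z3.
  move: (enorm _); move: (enorm _); move: (enorm _); move: (enorm _); move: (enorm _).
  move=> e1 e2 e3 e4 e5; lra.
split => // t t0 i.
have lb := coord_lbm Ac f_cont i ca fc; rewrite intg0E //.
have [C C0 hC] := approxe t t0.
have [L L0 hL] := f_lip (r0 t).
apply/eqP; rewrite eq_sym -subr_eq0 -normr_eq0; apply/eqP.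
apply/eqP; rewrite eq_le normr_ge0 andbT.
(* The equation links iterates k and k + 1: C bounds the error of the left side, L C t that of the
   integral. *)
apply: (le_geometric (C := C + L * C * t)).
  by rewrite addr_ge0 // !mulr_ge0 // ltW.
move=> k; rewrite add0r.
have lbk := coord_lbm Ac f_cont i ca (hP k).1.
have d1 : `|intg (fun s => f (flow x alpha s) (alpha s) 0 i) 0 t -
    intg (fun s => f (picard x alpha k s) (alpha s) 0 i) 0 t| <= L * (C / 2 ^+ k) * t.
  have hs s : 0 < s <= t -> `|f (flow x alpha s) (alpha s) 0 i -
      f (picard x alpha k s) (alpha s) 0 i| <= L * (C / 2 ^+ k).
    move=> /andP[s0 st]; have st' : 0 <= s <= t by rewrite (ltW s0).
    have := coord_le_enorm (f (flow x alpha s) (alpha s) - f (picard x alpha k s) (alpha s)) i.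
    rewrite rowB => h; apply: le_trans h _.
    apply: le_trans (hL _ _ _ _ _ _) _.
    - exact: flow_bound.
    - exact: picard_bound.
    - by apply: aA; exact: ltW.
    by rewrite ler_pM2l // enormB; exact: hC.
  have -> : L * (C / 2 ^+ k) * t = L * (C / 2 ^+ k) * (t - 0) by rewrite subr0.
  rewrite -mulN1r -intgZ // -intgD //; last exact: lbmZ.
  rewrite ler_norml; apply/andP; split.
    rewrite -mulNr; apply: intg_ge => //; first by apply: lbmD => //; exact: lbmZ.
    by move=> s /hs; rewrite ler_norml mulN1r => /andP[].
  apply: intg_le => //; first by apply: lbmD => //; exact: lbmZ.
  by move=> s /hs; rewrite ler_norml mulN1r => /andP[].
have d2 : `|picard x alpha k.+1 t 0 i - flow x alpha t 0 i| <= C / 2 ^+ k.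
  have tt : 0 <= t <= t by rewrite t0 lexx.
  have := coord_le_enorm (picard x alpha k.+1 t - flow x alpha t) i.
  rewrite rowB => h; apply: le_trans h _.
  apply: le_trans (hC k.+1 t tt) _.
  rewrite ler_wpM2l // lef_pV2 ?posrE ?exprn_gt0 // exprS ler_peMl ?exprn_ge0 //.
  by rewrite ler1n.
rewrite picardS in d2.
have -> : (C + L * C * t) / 2 ^+ k = C / 2 ^+ k + L * (C / 2 ^+ k) * t by ring.
move: d1 d2; rewrite !ler_norml => /andP[a1 a2] /andP[b1 b2].
by apply/andP; split; lra.
Qed.

End Picard.

Section FirstOrder.
Context {R : realType} {n : nat}.

Lemma has_grad_line (g : 'rV[R]_n -> R) (z u : 'rV[R]_n) (s : R) p :
  has_grad g (z + s *: u) p -> is_derive s 1 (fun t : R => g (z + t *: u)) (dotp p u).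
Proof.
move=> /has_grad_diff[gd gE].
pose L (t : R) : 'rV[R]_n := z + t *: u.
have Ld : is_diff s L (0 + ( *:%R^~ u)) by exact: is_diffD.
have gd' : differentiable (g : _ -> R^o) (L s) by [].
have cd : differentiable ((g : _ -> R^o) \o L) s by apply: differentiable_comp => //; case: Ld.
have D : derivable ((g : _ -> R^o) \o L) s 1 by apply/derivable1_diffP.
apply: DeriveDef; first exact: D.
have -> : (fun t : R => g (z + t *: u)) = (g : _ -> R^o) \o L by [].
have Ld' : differentiable L s by case: Ld.
rewrite deriveE // diff_comp // gE /=.
have -> : 'd L s 1 = 1 *: u by rewrite diff_val /= !fctE add0r.
by rewrite scale1r.
Qed.

(** Mean value theorem on the segment from z to v, which stays in a ball where G varies little. *)
Lemma C1_uniform (O K : set 'rV[R]_n) (g : 'rV[R]_n -> R) G (k : R) :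
  C1_with O g G -> open O -> K `<=` O -> compact K -> 0 < k ->
  exists2 d, 0 < d & forall z, K z -> forall v, enorm (v - z) < d ->
    g v - g z <= dotp (G z) (v - z) + k * enorm (v - z).
Proof.
move=> [gG Gc] Oo KO Kc k0.
have [||d d0 hd] := @compact_uniform R n K (fun d z => forall v, enorm (v - z) < d ->
    g v - g z <= dotp (G z) (v - z) + k * enorm (v - z)) Kc.
- by move=> s t x t0 ts h v vt; apply: h; exact: lt_le_trans ts.
- move=> x Kx; have Ox := KO x Kx.
  have /open_enormP /(_ x Ox)[r1 r10 h1] := Oo.
  have [|r2 r20 h2] := Gc x Ox (k / 2); first by rewrite divr_gt0.
  pose r := Num.min r1 r2; have r0 : 0 < r by rewrite lt_min r10.
  exists (r / 2); first by rewrite divr_gt0.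
  move=> z Kz zx v vz; pose u := v - z.
  have seg t : 0 <= t <= 1 -> enorm (z + t *: u - x) < r.
    move=> /andP[t0 t1]; have -> : z + t *: u - x = t *: u + (z - x).
      by rewrite addrAC addrC.
    apply: le_lt_trans (enormD _ _) _; rewrite enormZ ger0_norm //.
    have : t * enorm u <= enorm u by rewrite ler_piMl ?enorm_ge0.
    rewrite /u; lra.
  have inO t : 0 <= t <= 1 -> O (z + t *: u).
    by move=> /seg; rewrite lt_min => /andP[/h1].
  have D (t : R) : 0 <= t <= 1 -> is_derive t 1 (fun t : R => g (z + t *: u)) (dotp (G (z + t *: u)) u).
    by move=> t01; apply: has_grad_line; apply: gG; exact: inO.
  have [||c c01] := @MVT R (fun t => g (z + t *: u)) (fun t => dotp (G (z + t *: u)) u) 0 1 ltr01.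
  - by move=> t; rewrite in_itv /= => /andP[t0 t1]; apply: D; rewrite !ltW.
  - apply: continuous_in_subspaceT => t; rewrite inE /= in_itv /= => t01.
    by apply: differentiable_continuous; apply/derivable1_diffP; case: (D t t01).
  have zu : z + u = v by rewrite /u addrC subrK.
  rewrite scale1r scale0r addr0 subr0 mulr1 zu => ->.
  move: c01; rewrite in_itv /= => /andP[c0 c1].
  have c01 : 0 <= c <= 1 by rewrite !ltW.
  rewrite -lerBlDl -dotpBl; apply: le_trans (dotp_le _ _) _.
  rewrite ler_wpM2r ?enorm_ge0 //.
  have Oc := inO c c01; have := seg c c01; rewrite lt_min => /andP[_ hc].
  have hz : enorm (z - x) < r2.
    have : r <= r2 by rewrite ge_min lexx orbT.
    lra.
  have := h2 _ Oc hc; have := h2 z (KO z Kz) hz.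
  have := enorm_sub_le (G (z + c *: u)) (G x) (G z); rewrite (enormB (G x) (G z)); lra.
by exists d.
Qed.

End FirstOrder.

(** * Nearly optimal controls *)

(** The old control keeps its value at s, matching causality up to s and integrals over ]s, b]. *)
Lemma switch_control (R : realType) (m : nat) (A : set 'rV[R]_m)
    (beta : R -> 'rV[R]_m) (s : R) (a : 'rV[R]_m) : control A beta -> A a ->
  control A (fun v => if v <= s then beta v else a).
Proof.
move=> [bA bm] Aa; split=> [t t0|O Oo]; first by case: ifP => // _; exact: bA.
have -> : `[0, +oo[%classic `&` (fun v => if v <= s then beta v else a) @^-1` O =
    (`]-oo, s]%classic `&` (`[0, +oo[%classic `&` beta @^-1` O)) `|`
    ((`[0, +oo[%classic `&` `]s, +oo[%classic) `&` [set _ : R | O a]).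
  apply/seteqP; split => v /=; rewrite !in_itv /= !andbT.
    move=> [v0]; case: ifPn => vs h; first by left.
    by right; split => //; split => //; rewrite ltNge.
  move=> [[vs [v0 h]]|[[v0 vs] h]]; split => //; first by rewrite vs.
  by rewrite leNgt vs.
apply: measurableU.
  by apply: measurableI; [exact: measurable_itv|exact: bm].
apply: measurableI; first by apply: measurableI; exact: measurable_itv.
have [Oa|Oa] := pselect (O a).
  have -> : [set _ : R | O a] = setT by apply/seteqP; split.
  exact: measurableT.
have -> : [set _ : R | O a] = set0 by apply/seteqP; split.
exact: measurable0.
Qed.

Lemma C1_grad_bounded (R : realType) (n : nat) (O K : set 'rV[R]_n) g G :
  C1_with O g G -> K `<=` O -> compact K ->
  exists2 C, 0 < C & forall z, K z -> enorm (G z) <= C.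
Proof.
move=> [_ Gc] KO Kc.
have GcK : {within K, continuous G}.
  apply: (continuous_subspaceW KO); apply/within_continuous_row_enormP => x Ox e e0.
  exact: Gc.
have [C C0 hC] := compact_enorm_bounded (continuous_compact GcK Kc).
by exists C => // z Kz; apply: hC; exists z.
Qed.

(* On each step of length si the control is the constant nearly attaining the supremum
   in the supersolution test of the inf-convolution W of w.  The quantity
   Theta = th * g - H decreases at rate c / 2 as long as the distance to T is at least r,
   while g >= 0 and H <= - ln (E1 - delta): the stage ends in finite time. *)
Lemma superoptimality_stage (R : realType) (n m : nat)
  (f : 'rV[R]_n -> 'rV[R]_m -> 'rV[R]_n) (h : 'rV[R]_n -> 'rV[R]_m -> R)
  (A : set 'rV[R]_m) (T : set 'rV[R]_n)
  (Ac : compact A) (T0 : T !=set0) (Tcl : closed T)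
  (f_cont : {within setT `*` A, continuous (fun q => f q.1 q.2)})
  (f_lip : forall r, 0 < r -> exists2 L, 0 < L &
     forall x1 x2 a, enorm x1 <= r -> enorm x2 <= r -> A a ->
       enorm (f x1 a - f x2 a) <= L * enorm (x1 - x2))
  (M : R) (M0 : 0 < M)
  (f_growth : forall x a, A a -> enorm (f x a) <= M * (1 + enorm x))
  (h_cont : {within setT `*` A, continuous (fun q => h q.1 q.2)})
  (h_ge0 : forall x a, A a -> 0 <= h x a)
  (w : 'rV[R]_n -> R) (wc : {within ~` interior T, continuous w})
  (w01 : forall x, ~ interior T x -> 0 <= w x <= 1)
  (wsup : viscosity_supersolution (hamiltonian f h A) (~` T) w)
  (g : 'rV[R]_n -> R) (G : 'rV[R]_n -> 'rV[R]_n)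
  (gG : comparison_barrier f h A T g G)
  (x : 'rV[R]_n) (alpha : R -> 'rV[R]_m) (t1 r delta : R) :
  let H (beta : R -> 'rV[R]_m) s := intg (fun v => h (flow f x beta v) (beta v)) 0 s in
  control A alpha -> 0 <= t1 -> ~ T (flow f x alpha t1) -> 0 < r -> 0 < delta ->
  delta < (1 - w (flow f x alpha t1)) * expR (- H alpha t1) ->
  exists beta t2, [/\ control A beta, forall s, s <= t1 -> beta s = alpha s,
    t1 <= t2, forall s, t1 <= s <= t2 -> ~ T (flow f x beta s)
    & dist T (flow f x beta t2) < r /\
      (1 - w (flow f x alpha t1)) * expR (- H alpha t1) - delta <=
      (1 - w (flow f x beta t2)) * expR (- H beta t2)].
Proof.
have [y yE] : exists y, y = flow f x by exists (flow f x).
rewrite -yE; move=> H'; have [H HdE] : exists H, forall beta s,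
    H beta s = intg (fun v => h (y beta v) (beta v)) 0 s by exists H'.
have -> : H' = H by apply/funext => beta; apply/funext => s; rewrite HdE.
move=> {H'} ca t10 X1T r0 de0 hde.
have ty beta (cb : control A beta) : trajectory f x beta (y beta).
  by rewrite yE; exact: (flow_trajectory Ac f_cont f_lip M0 f_growth).
have y_causal beta beta' s : (forall v, v <= s -> beta v = beta' v) ->
    forall v, v <= s -> y beta v = y beta' v.
  by rewrite yE; exact: flow_causal.
pose E1 := (1 - w (y alpha t1)) * expR (- H alpha t1).
(* Already close enough to T: the stage is empty. *)
have [dr|dr] := ltP (dist T (y alpha t1)) r.
  exists alpha, t1; split => //.
    by move=> s /andP[s1 s2]; have -> : s = t1 by apply/eqP; rewrite eq_le s2.
  by split => //; rewrite gerBl ltW.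
have [gC g0 _ _ gs] := gG.
(* With s = 1 this reads th <G, f> <= h - c at distance at least r from T, so th * g - H falls at
   rate c up to small errors. *)
have [th /andP[th0 th1] [c c0 hc]] := gs 1 r 1 ltr01 r0 ltr01.
have D1 : ~ interior T (y alpha t1) := not_T_D X1T.
have gX1 := g0 _ D1.
(* B bounds the total possible fall of Theta, so at rate c / 2 the stage cannot last for the time
   S. *)
pose B := th * g (y alpha t1) + `|ln (E1 - delta)|.
have B0 : 0 <= B by rewrite addr_ge0 // mulr_ge0 // ltW.
pose S := 2 * B / c + 1.
have S0 : 0 < S by rewrite ltr_wpDl // !mulr_ge0 // invr_ge0 ltW.
have cS : B < c / 2 * S.
  have -> : c / 2 * S = B + c / 2 by rewrite /S; field; rewrite gt_eqF.
  by rewrite ltrDl divr_gt0.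
pose Rb := (1 + enorm x) * expR (M * (t1 + S)).
have Rb0 : 0 < Rb by rewrite mulr_gt0 ?expR_gt0 // ltr_pwDl ?enorm_ge0.
have yRb beta s (cb : control A beta) : 0 <= s <= t1 + S -> enorm (y beta s) <= Rb.
  by rewrite yE; exact: (flow_bound Ac f_cont f_lip M0 f_growth).
have Rb1 : 0 < Rb + 1 by rewrite addr_gt0.
have [L L0 hL] := f_lip _ Rb1.
pose Mf := M * (1 + (Rb + 1)); have Mf0 : 0 < Mf by rewrite mulr_gt0 // addr_gt0.
have fMf z a : enorm z <= Rb + 1 -> A a -> enorm (f z a) <= Mf.
  by move=> zC Aa; apply: le_trans (f_growth z a Aa) _; rewrite ler_pM2l // lerD2l.
have [Ch Ch0 hCh] := joint_bounded Ac h_cont (Rb + 1).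
have r20 : 0 < r / 2 by rewrite divr_gt0.
pose K := tube T (Rb + 1) (r / 2).
have Kc : compact K by exact: tube_compact.
have KT z : K z -> ~ T z by exact: tube_notT.
have Kw v : K v -> 0 <= w v <= 1 by move=> /KT/not_T_D/w01.
have [CG CG0 hCG] := C1_grad_bounded gC KT Kc.
(* The loss is (4 + 2 L) k per unit of time during at most S, plus k for the return from W to w. *)
pose k := Num.min (delta / ((4 + 2 * L) * S + 1)) (c / 8).
have LS : 0 < (4 + 2 * L) * S + 1 by rewrite addr_gt0 // mulr_gt0 // addr_gt0 // mulr_gt0.
have k0 : 0 < k by rewrite lt_min !divr_gt0.
have kd : (4 + 2 * L) * k * S + k <= delta.
  have : k * ((4 + 2 * L) * S + 1) <= delta by rewrite -ler_pdivlMr // ge_min lexx.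
  by clear; lra.
have kc : k <= c / 8 by rewrite ge_min lexx orbT.
have [dw dw0 hdw] := tube_modulus T0 wc (Rb + 1) r20 k0.
have [dh dh0 hdh] := joint_uniform Ac h_cont (Rb + 1) k0.
have oT : open (~` T) by rewrite openC.
have [dg dg0 hdg] := C1_uniform gC oT KT Kc (divr_gt0 c0 (mulr_gt0 (ltr0n R 8) Mf0)).
pose d := Num.min (Num.min dw (dh / 2)) (Num.min (r / 8) (1 / 2)).
have d0 : 0 < d by rewrite !lt_min dw0 !divr_gt0.
have [d1 d2 d3 d4] : [/\ d <= dw, d <= dh / 2, d <= r / 8 & d <= 1 / 2].
  by rewrite !ge_min !lexx ?orbT.
pose N := 4 / d ^+ 2; have N0 : 0 < N by rewrite divr_gt0 // exprn_gt0.
have sqC (u v : 'rV[R]_n) : dotp (u - v) (u - v) = dotp (v - u) (v - u).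
  by rewrite -(opprB v u) dotpNl dotpNr opprK.
have K1 : K (y alpha t1).
  split => /=; last by apply: le_trans dr; clear - r0; lra.
  have := yRb alpha t1 ca; rewrite t10 lerDl (ltW S0) => /(_ isT) h1.
  by apply: le_trans h1 _; rewrite lerDl.
have wcN : {within ~` interior T, continuous (fun v => - w v)}.
  by move=> v; apply: cvgN; exact: wc.
have E z : exists z', K z' /\ forall v, K v ->
    w z' + N * dotp (z' - z) (z' - z) <= w v + N * dotp (v - z) (v - z).
  have K0 : K !=set0 by exists (y alpha t1).
  have [z' Kz' hz'] := tube_sup_conv T0 wcN N z r20 K0.
  exists z'; split => // v Kv; have := hz' v Kv; rewrite (sqC z v) (sqC z z').
  by clear; lra.
pose mz z := projT1 (cid (E z)); have mzP z := projT2 (cid (E z)).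
rewrite -/(mz _) in mzP.
pose W z := w (mz z) + N * dotp (mz z - z) (mz z - z).
pose Q z := 1 - W z.
have near X : enorm X <= Rb -> r * (3 / 4) <= dist T X ->
    [/\ K X, [/\ W X <= w X, w (mz X) <= W X & w X <= w (mz X) + k],
       N * dotp (mz X - X) (mz X - X) <= k, enorm (mz X - X) < d
     & exists2 rz, 0 < rz & forall v, enorm (v - mz X) < rz -> K v].
  move=> XR Xr; have KX : K X.
    by split => /=; [clear - XR; lra|clear - Xr r0; lra].
  have [Kz hz] := mzP X; rewrite -/(mz X) in Kz hz.
  have h1 := hz _ KX; rewrite subrr dotp0l mulr0 addr0 in h1.
  have dd := dotp_ge0 (mz X - X); have Nd := mulr_ge0 (ltW N0) dd.
  have /andP[a1 a2] := Kw _ KX; have /andP[a3 a4] := Kw _ Kz.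
  have hd : enorm (mz X - X) < d.
    rewrite -(ltr_pXn2r (ltn0Sn 1)) ?nnegrE ?enorm_ge0 ?(ltW d0) // sqr_enorm.
    have : N * dotp (mz X - X) (mz X - X) <= 1 by clear - h1 a2 a3; lra.
    rewrite /N mulrAC ler_pdivrMr ?exprn_gt0 // mul1r.
    have := exprn_gt0 2 d0; clear; lra.
  have hw : `|w (mz X) - w X| < k by apply: hdw => //; exact: lt_le_trans hd _.
  move: hw; rewrite ltr_norml => /andP[b1 b2]; rewrite /W; split => //.
  - by split; clear - h1 Nd b1 b2; lra.
  - by clear - h1 b1; lra.
  exists (Num.min (r / 8) (1 / 2)); first by rewrite lt_min !divr_gt0.
  move=> v; rewrite lt_min => /andP[v1 v2]; split => /=.
    have := enorm_le_dist v (mz X); have := enorm_le_dist (mz X) X.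
    by clear - v2 hd d4 XR; lra.
  have := dist_lip T0 X (mz X); have := dist_lip T0 (mz X) v.
  by rewrite (enormB (mz X) v) (enormB X); clear - v1 hd d3 Xr; lra.
have near' X : enorm X <= Rb -> r * (3 / 4) <= dist T X -> 0 <= Q X <= 1.
  move=> XR Xr; have [KX [q1 _ _] _ _ _] := near X XR Xr.
  have [Kz _] := mzP X; have /andP[q2 q3] := Kw _ Kz; have /andP[_ q4] := Kw _ KX.
  have := mulr_ge0 (ltW N0) (dotp_ge0 (mz X - X)); rewrite -/(mz X) in q2 q3.
  by rewrite /Q; move: q1; rewrite /W => q1 q5; apply/andP; clear - q1 q2 q4 q5; split; lra.
pose EQ beta s := Q (y beta s) * expR (- H beta s).
pose Theta beta s := th * g (y beta s) - H beta s.
(* Invariant of the steps. A step starts at distance at least r and moves by at most r / 4, hence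
   the margin 3 / 4. *)
pose Good beta s := [/\ control A beta, forall v, v <= t1 -> beta v = alpha v,
  forall v, t1 <= v <= s -> ~ T (y beta v), r * (3 / 4) <= dist T (y beta s)
  & EQ alpha t1 - (4 + 2 * L) * k * (s - t1) <= EQ beta s /\
    Theta beta s <= Theta alpha t1 - c / 2 * (s - t1)].
pose c1 := 2 * N * L * Mf + N * Mf ^+ 2 + 1.
have c10 : 0 < c1.
  have a1 : 0 < 2 * N * L * Mf by do !apply: mulr_gt0 => //.
  have a2 : 0 < N * Mf ^+ 2 by rewrite mulr_gt0 // exprn_gt0.
  by rewrite /c1; clear - a1 a2; lra.
have MfL0 : 0 < 8 * (CG * (L * Mf)) by do !apply: mulr_gt0 => //.
pose s0 := Num.min (Num.min (k / c1) (r / (4 * Mf))) (Num.min (Num.min (dh / (4 * Mf)) (dg / (2 * Mf)))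
   (Num.min (c / (8 * (CG * (L * Mf)))) (k / Ch ^+ 2))).
have s00 : 0 < s0.
  rewrite /s0 !lt_min; do !(apply/andP; split); apply: divr_gt0 => //.
  - by rewrite mulr_gt0.
  - by rewrite mulr_gt0.
  - by rewrite mulr_gt0.
  - by rewrite exprn_gt0.
have [Nn hNn] : exists N' : nat, S / s0 < N'.+1%:R.
  exists (Num.bound (S / s0)); apply: lt_trans (archi_boundP _) _.
    by rewrite divr_ge0 // ltW.
  by rewrite ltr_nat.
pose si := S / Nn.+1%:R.
have si0 : 0 < si by rewrite divr_gt0.
have sis0 : si <= s0.
  by rewrite /si ler_pdivrMr // mulrC -ler_pdivrMr // ltW.
have siN : Nn.+1%:R * si = S by rewrite /si mulrC divfK // gt_eqF.
have [z1 z2 z3 z4] : [/\ c1 * si <= k, 4 * Mf * si <= r, 4 * Mf * si <= dh & 2 * Mf * si <= dg].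
  have M4 : 0 < 4 * Mf by rewrite mulr_gt0.
  have M2 : 0 < 2 * Mf by rewrite mulr_gt0.
  split; rewrite mulrC -ler_pdivlMr //; apply: (le_trans sis0);
    by rewrite /s0 !ge_min !lexx ?orbT.
have [z5 z6] : 8 * (CG * (L * Mf)) * si <= c /\ Ch ^+ 2 * si <= k.
  have C2 : 0 < Ch ^+ 2 by rewrite exprn_gt0.
  split; rewrite mulrC -ler_pdivlMr //; apply: (le_trans sis0);
    by rewrite /s0 !ge_min !lexx ?orbT.
have step beta s : Good beta s -> t1 <= s -> s + si <= t1 + S -> r <= dist T (y beta s) ->
    exists beta', Good beta' (s + si).
  move=> [cb ba bT bd [bE bTh]] t1s sS rX.
  have [X XE] : exists X, X = y beta s by exists (y beta s).
  rewrite -XE in bd rX.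
  have s_0 : 0 <= s := le_trans t10 t1s.
  have sle : 0 <= s <= t1 + S by rewrite s_0 /=; apply: le_trans sS; rewrite lerDl ltW.
  have XR : enorm X <= Rb by rewrite XE; exact: yRb.
  have [KX [n1 n2 n3] n4 n5 [rz rz0 hrz]] := near X XR bd.
  have [Kz hz] := mzP X; rewrite -/(mz X) in Kz hz; set z := mz X in n2 n3 n4 n5 hrz Kz hz.
  have /andP[wz0 wz1] := Kw _ Kz.
  have Tz := KT _ Kz.
  have phiC : C1_with (~` T) (fun v => - N * dotp (v - X) (v - X))
      (fun v => - N *: (2 *: (v - X))) by apply: C1_withZ; exact: C1_with_sq.
  (* The control for the whole step: nearly optimal at the minimiser z, near which the trajectory
     remains. *)
  have [|a Aa ha] := supersol_test wsup phiC Tz rz0 _ k0.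
    by move=> v vz; have := hz v (hrz v vz); clear; lra.
  pose p := 2 * N *: (X - z).
  have pE : - N *: (2 *: (z - X)) = p.
    by rewrite /p -(opprB X z) scalerN scaleNr scalerN opprK scalerA [N * 2]mulrC.
  rewrite pE in ha.
  pose beta' v := if v <= s then beta v else a.
  have cb' : control A beta' by exact: switch_control.
  have b's v : v <= s -> beta' v = beta v by rewrite /beta' => ->.
  have b'a v : s < v -> beta' v = a by rewrite /beta' leNgt => ->.
  have y's v : v <= s -> y beta' v = y beta v by apply: y_causal; exact: b's.
  have H's : H beta' s = H beta s.
    by rewrite !HdE; apply: eq_intg => v /andP[_ vs]; rewrite (b's v vs) (y's v vs).
  have y'X : y beta' s = X by rewrite XE; exact: y's.
  have ssi : s <= s + si by rewrite lerDl ltW.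
  have sv v : s < v <= s + si -> 0 <= v <= t1 + S.
    move=> /andP[q1 q2]; apply/andP; split; first by apply: le_trans s_0 (ltW q1).
    exact: le_trans q2 sS.
  have As v : s < v <= s + si -> A (beta' v) by move=> /andP[/b'a -> _].
  have yR v : s < v <= s + si -> enorm (y beta' v) <= Rb by move=> /sv q; exact: yRb.
  have spd v : s < v <= s + si -> enorm (y beta' v - X) <= Mf * si.
    move=> svs; case/andP: (svs) => sa sb; rewrite -y'X.
    apply: le_trans (traj_speed Ac f_cont cb' (ty _ cb') (C := Mf) s_0 (ltW sa) _) _.
      move=> u /andP[u1 u2]; have us : s < u <= s + si by rewrite u1 (le_trans u2).
      by apply: fMf; [apply: le_trans (yR u us) _; rewrite lerDl|exact: As].
    by rewrite ler_pM2l // lerBlDl.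
  have dist' v : s < v <= s + si -> r * (3 / 4) <= dist T (y beta' v).
    move=> svs; have := dist_lip T0 X (y beta' v); rewrite (enormB X).
    by have := spd v svs; clear - rX z2; lra.
  have N2 : 0 <= 2 * N by rewrite mulr_ge0 // ltW.
  have pn' : enorm p = 2 * N * enorm (z - X).
    by rewrite /p enormZ ger0_norm // (enormB z X).
  have pn : enorm p * enorm (z - X) <= 2 * k.
    have -> : enorm p * enorm (z - X) = 2 * (N * enorm (z - X) ^+ 2) by rewrite pn'; ring.
    by rewrite sqr_enorm; clear - n4; lra.
  have pn1 : enorm p <= 2 * N by rewrite pn' ler_piMr //; clear - n5 d4; lra.
  have zC : enorm z <= Rb + 1 by case: Kz.
  have hlb := curve_lbm Ac h_cont cb' (ty _ cb').1.
  have [u uE] : exists u, u = intg (fun v => h (y beta' v) (beta' v)) s (s + si).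
    by eexists.
  have Xle : enorm X <= Rb + 1 by apply: le_trans XR _; rewrite lerDl.
  have /andP[QX0 QX1] := near' X XR bd.
  have ssE : s + si - s = si by rewrite addrC addKr.
  have fdiff v : s < v <= s + si -> enorm (y beta' v) <= Rb + 1.
    by move=> svs; apply: le_trans (yR v svs) _; rewrite lerDl.
  have pw v : s < v <= s + si -> dotp p (f (y beta' v) (beta' v)) <=
      - Q X * h (y beta' v) (beta' v) + (2 * k + 2 * L * k + 2 * N * L * Mf * si).
    move=> svs; case/andP: (svs) => sa sb; rewrite (b'a v sa).
    have sp := spd v svs; have yC := fdiff v svs.
    have e1 : dotp p (f (y beta' v) a) - dotp p (f z a) <= 2 * L * k + 2 * N * L * Mf * si.
      rewrite -dotpBr; apply: le_trans (dotp_le _ _) _.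
      have e2 := hL (y beta' v) z _ yC zC Aa; have e3 := enorm_sub_le (y beta' v) X z.
      rewrite (enormB X z) in e3.
      apply: (@le_trans _ _ (enorm p * (L * (Mf * si + enorm (z - X))))).
        rewrite ler_wpM2l ?enorm_ge0 //; apply: le_trans e2 _.
        by rewrite ler_pM2l //; clear - e3 sp; lra.
      have LM : 0 <= L * (Mf * si).
        by apply: mulr_ge0; [exact: ltW|apply: mulr_ge0; exact: ltW].
      have := ler_wpM2r LM pn1; have := ler_wpM2l (ltW L0) pn.
      rewrite mulrDr mulrDr mulrCA; clear; lra.
    have e4 : h (y beta' v) a - k <= h z a.
      have : `|h (y beta' v) a - h z a| < k.
        apply: hdh => //; have := enorm_sub_le (y beta' v) X z; rewrite (enormB X z).
        by clear - n5 sp z3 d2 dh0; lra.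
      by rewrite ltr_norml => /andP[q1 q2]; clear - q2; lra.
    have hy0 := h_ge0 (y beta' v) _ Aa.
    have e5 : (1 - w z) * (h (y beta' v) a - k) <= (1 - w z) * h z a.
      by apply: ler_wpM2l => //; clear - wz1; lra.
    have e6 : Q X * h (y beta' v) a <= (1 - w z) * h (y beta' v) a.
      by apply: ler_wpM2r => //; rewrite /Q; clear - n2; lra.
    have e7 : (1 - w z) * k <= k by rewrite ler_piMl ?(ltW k0) //; clear - wz0; lra.
    by rewrite mulrBr in e5; clear - ha e1 e5 e6 e7; lra.
  have int1 : dotp p (y beta' (s + si) - X) <=
      - Q X * u + (2 * k + 2 * L * k + 2 * N * L * Mf * si) * si.
    rewrite -{1}y'X (traj_dotp Ac f_cont cb' (ty _ cb')) //.
    have lc := lbm_cst (2 * k + 2 * L * k + 2 * N * L * Mf * si).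
    have lq := lbmZ (- Q X) hlb.
    have -> : (2 * k + 2 * L * k + 2 * N * L * Mf * si) * si =
        intg (fun=> 2 * k + 2 * L * k + 2 * N * L * Mf * si) s (s + si).
      by rewrite intg_cst // ssE.
    rewrite uE -(intgZ _ _ hlb s_0) -(intgD _ lq lc s_0).
    apply: le_intg; [|exact: lbmD|exact: s_0|exact: pw].
    exact: (curve_dotp_lbm Ac f_cont p cb' (ty _ cb').1).
  have Rend : s < s + si <= s + si by rewrite lexx andbT ltrDl.
  have sp := spd _ Rend.
  have MB : 0 <= Mf * si by apply: mulr_ge0; exact: ltW.
  have Wb : W (y beta' (s + si)) <= W X + dotp p (y beta' (s + si) - X) + N * (Mf * si) ^+ 2.
    have [Kzb hzb] := mzP (y beta' (s + si)).
    apply: (le_trans (hzb z Kz)).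
    have sp2 : dotp (y beta' (s + si) - X) (y beta' (s + si) - X) <= (Mf * si) ^+ 2.
      by rewrite -sqr_enorm ler_pXn2r ?nnegrE ?enorm_ge0.
    rewrite /W -/z (sqC z X) (sqC z (y beta' (s + si))).
    have -> : y beta' (s + si) - z = (y beta' (s + si) - X) + (X - z) by rewrite addrA subrK.
    have := ler_wpM2l (ltW N0) sp2; rewrite /p.
    move: (y beta' (s + si) - X) (X - z) => U V'.
    rewrite dotpZl !dotpDl !dotpDr (dotpC U V'); clear; lra.
  have hQ : Q X * (1 + u) - (3 + 2 * L) * k * si <= Q (y beta' (s + si)).
    have e2 : c1 * si * si <= k * si by rewrite ler_wpM2r // ltW.
    have e3 : 0 <= si * si by apply: mulr_ge0; exact: ltW.
    rewrite /c1 in e2; rewrite /Q in int1 *; clear - e2 e3 int1 Wb; lra.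
  have u0 : 0 <= u by rewrite uE; apply: intg_ge0 => v /As; exact: h_ge0.
  have uCh : u <= Ch * si.
    have -> : Ch * si = Ch * (s + si - s) by rewrite ssE.
    rewrite uE; apply: (intg_le hlb s_0 ssi) => v svs; apply: le_trans (ler_norm _) _.
    by apply: hCh; [exact: fdiff|exact: As].
  have u2 : u * u <= k * si.
    apply: (@le_trans _ _ (Ch * si * (Ch * si))).
      by apply: ler_pM.
    have -> : Ch * si * (Ch * si) = Ch ^+ 2 * si * si by ring.
    by rewrite ler_wpM2r // ltW.
  have HE : H beta' (s + si) = H beta s + u.
    by rewrite -H's !HdE uE (intg_split hlb (lexx 0) s_0 ssi).
  have H0 : 0 <= H beta s.
    by rewrite HdE; apply: intg_ge0 => v /andP[v0 _]; apply: h_ge0; apply: cb.1; exact: ltW.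
  exists beta'; split; first exact: cb'.
  - by move=> v vt; rewrite b's ?ba // (le_trans vt).
  - move=> v /andP[v1 v2]; have [vs|vs] := leP v s; first by rewrite y's //; apply: bT; rewrite v1.
    apply: (dist_gt0_notin T0); have := dist' v; rewrite vs v2 => /(_ isT) q.
    by clear - q r0; lra.
  - exact: dist'.
  split.
    pose eH := expR (- H beta s); pose eu := expR (- u).
    have eH0 : 0 <= eH by exact: expR_ge0.
    have eH1 : eH <= 1 by rewrite -[leRHS]expR0 ler_expR oppr_le0.
    have eu0 : 0 <= eu by exact: expR_ge0.
    have eu1 : eu <= 1 by rewrite -[leRHS]expR0 ler_expR oppr_le0.
    have eu2 : 1 - u <= eu by exact: expR_ge1Dx.
    have EE : expR (- H beta' (s + si)) = eH * eu by rewrite HE opprD expRD.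
    rewrite /EQ EE; rewrite /EQ -XE -/eH in bE.
    have m0 : 0 <= eH * eu by exact: mulr_ge0.
    have m1 : eH * eu <= 1.
      by apply: (@le_trans _ _ (1 * 1)); [exact: ler_pM|rewrite mulr1].
    have q1 := ler_wpM2r m0 hQ.
    have kk : 0 <= (3 + 2 * L) * k * si.
      by apply: mulr_ge0; [apply: mulr_ge0; [clear - L0; lra|exact: ltW]|exact: ltW].
    have q2 := ler_wpM2l kk m1; rewrite mulr1 in q2.
    have QE0 : 0 <= Q X * eH by exact: mulr_ge0.
    have QE1 : Q X * eH <= 1.
      by apply: (@le_trans _ _ (1 * 1)); [exact: ler_pM|rewrite mulr1].
    have u1 : 0 <= 1 + u by rewrite addr_ge0.
    (* The gain 1 + u in Q and the discount exp(- u) cancel up to u^2 <= k si, which adds one k to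
       the loss 3 + 2 L. *)
    have q3 : Q X * eH * ((1 + u) * (1 - u)) <= Q X * eH * ((1 + u) * eu).
      by apply: ler_wpM2l; [exact: QE0|exact: (ler_wpM2l u1 eu2)].
    have uu0 : 0 <= u * u by exact: mulr_ge0.
    have q4 := ler_wpM2r uu0 QE1; rewrite mul1r in q4.
    clear - q1 q2 q3 q4 u2 bE; move: q1 q2 q3 q4 u2 bE.
    by move: (Q X) (Q (y _ _)) (Q (y _ _)) => Q1 Q2 Q3; lra.
  have G1 := hdg X KX (y beta' (s + si)) (ltac:(apply: (le_lt_trans sp); clear - z4 dg0; lra)).
  have pwG v : s < v <= s + si -> th * dotp (G X) (f (y beta' v) (beta' v)) <=
      h (y beta' v) (beta' v) + (- (c * (3 / 4))).
    move=> svs; case/andP: (svs) => sa sb; rewrite (b'a v sa).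
    have spv := spd v svs; have yC := fdiff v svs.
    have e1 : dotp (G X) (f (y beta' v) a) - dotp (G X) (f X a) <= CG * (L * (Mf * si)).
      rewrite -dotpBr; apply: le_trans (dotp_le _ _) _.
      apply: ler_pM; rewrite ?enorm_ge0 //; first exact: hCG.
      by apply: le_trans (hL _ _ _ yC Xle Aa) _; rewrite ler_pM2l.
    have e2 : h X a <= h (y beta' v) a + k.
      have : `|h (y beta' v) a - h X a| < k.
        by apply: hdh => //; clear - spv z3 dh0; lra.
      by rewrite ltr_norml => /andP[q1 q2]; clear - q1; lra.
    have e3 := hc X a (KT _ KX) Aa rX.
    have e4 := ler_wpM2l (ltW th0) e1.
    have e5 : th * (CG * (L * (Mf * si))) <= CG * (L * (Mf * si)).
      apply: ler_piMl th1; apply: mulr_ge0; first exact: ltW.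
      by apply: mulr_ge0; [exact: ltW|exact: MB].
    rewrite mulrBr in e4; rewrite mul1r in e3.
    have e6 : 8 * (CG * (L * (Mf * si))) <= c.
      by apply: le_trans z5; rewrite !mulrA.
    by clear - e2 e3 e4 e5 e6 kc; lra.
  have intG : th * dotp (G X) (y beta' (s + si) - X) <= u + (- (c * (3 / 4))) * si.
    rewrite -{2}y'X (traj_dotp Ac f_cont cb' (ty _ cb')) //.
    have lf := curve_dotp_lbm Ac f_cont (G X) cb' (ty _ cb').1.
    have lc := lbm_cst (- (c * (3 / 4))).
    have -> : - (c * (3 / 4)) * si = intg (fun=> - (c * (3 / 4))) s (s + si).
      by rewrite intg_cst // ssE.
    rewrite uE -(intgZ _ _ lf s_0) -(intgD _ hlb lc s_0).
    by apply: le_intg; [exact: lbmZ|exact: lbmD|exact: s_0|exact: pwG].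
  have G2 := ler_wpM2l (ltW th0) G1.
  have G3 : th * (c / (8 * Mf) * enorm (y beta' (s + si) - X)) <= c / 8 * si.
    have q1 : c / (8 * Mf) * enorm (y beta' (s + si) - X) <= c / 8 * si.
      have -> : c / 8 * si = c / (8 * Mf) * (Mf * si) by field; rewrite gt_eqF.
      by rewrite ler_pM2l // divr_gt0 // mulr_gt0.
    apply: le_trans q1; rewrite ler_piMl // mulr_ge0 ?enorm_ge0 // divr_ge0 ?(ltW c0) //.
    by rewrite mulr_ge0 // ltW.
  have csi : 0 <= c * si by apply: mulr_ge0; exact: ltW.
  rewrite /Theta HE; rewrite /Theta -XE in bTh.
  rewrite mulrBr mulrDr in G2.
  by clear - bTh intG G2 G3 csi; lra.
have dr34 : r * (3 / 4) <= dist T (y alpha t1).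
  by apply: le_trans dr; clear - r0; lra.
have y1R : enorm (y alpha t1) <= Rb by apply: yRb => //; rewrite t10 lerDl ltW.
have Good0 : Good alpha t1.
  split => //; last by rewrite subrr !mulr0 !subr0.
  by move=> v /andP[v1 v2]; have -> : v = t1 by apply/eqP; rewrite eq_le v2.
have E1Q : E1 <= EQ alpha t1.
  have [_ [q _ _] _ _ _] := near _ y1R dr34.
  by rewrite /E1 /EQ ler_wpM2r ?expR_ge0 // /Q lerD2l lerN2.
(* Either some step has come within r of T, or all steps so far ended at distance at least r and one
   more can be made. *)
have indj j : (exists beta s, [/\ Good beta s, t1 <= s <= t1 + S & dist T (y beta s) < r]) \/
    ((j <= Nn.+1)%N -> exists beta, Good beta (t1 + j%:R * si) /\ r <= dist T (y beta (t1 + j%:R * si))).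
  elim: j => [|j [IH|IH]].
  - by right => _; exists alpha; rewrite mul0r addr0.
  - by left.
  have [jN|jN] := leqP j.+1 Nn.+1; last first.
    by right.
  have [beta [Gb rb]] := IH (ltnW jN).
  have jE : t1 + j%:R * si + si = t1 + j.+1%:R * si by rewrite -natr1 mulrDl mul1r addrA.
  have jS : t1 + j.+1%:R * si <= t1 + S.
    by rewrite lerD2l -siN ler_pM2r // ler_nat.
  have t1j i : t1 <= t1 + i%:R * si by rewrite lerDl mulr_ge0 // ltW.
  have [|beta' Gb'] := step beta _ Gb (t1j j) _ rb; first by rewrite jE.
  rewrite jE in Gb'.
  have [q|q] := ltP (dist T (y beta' (t1 + j.+1%:R * si))) r.
    by left; exists beta', (t1 + j.+1%:R * si); rewrite t1j.
  by right => _; exists beta'.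
have HQ beta s : Good beta s -> t1 <= s <= t1 + S ->
    E1 - delta + k <= EQ beta s /\ enorm (y beta s) <= Rb.
  move=> [cb _ _ _ [bE _]] /andP[s1 s2]; split; last first.
    by apply: yRb => //; rewrite s2 (le_trans t10).
  have kL : 0 <= (4 + 2 * L) * k by apply: mulr_ge0; [clear - L0; lra|exact: ltW].
  have : (4 + 2 * L) * k * (s - t1) <= (4 + 2 * L) * k * S.
    by apply: ler_wpM2l => //; clear - s2; lra.
  by clear - bE kd E1Q; lra.
have [[beta [s [Gb st bs]]]|fin] := indj Nn.+1.
  have [q1 q2] := HQ beta s Gb st; have [cb ba bT bd _] := Gb.
  exists beta, s; split => //; first by case/andP: st.
  split => //.
  have [_ [_ n2 n3] _ _ _] := near _ q2 bd.
  have He : expR (- H beta s) <= 1.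
    rewrite -[leRHS]expR0 ler_expR oppr_le0 HdE; apply: intg_ge0 => v /andP[v0 _].
    by apply: h_ge0; apply: cb.1; exact: ltW.
  have e0 := expR_ge0 (- H beta s).
  have : EQ beta s <= (1 - w (y beta s) + k) * expR (- H beta s).
    by rewrite /EQ ler_wpM2r // /Q; clear - n2 n3; lra.
  have := ler_wpM2l (ltW k0) He; rewrite mulr1 mulrDl -/E1.
  by clear - q1; lra.
(* Otherwise Theta has fallen by more than B during the time S, against g >= 0 and the bound on
   H. *)
have [beta [Gb rb]] := fin (leqnn _); exfalso; rewrite siN in Gb rb.
have tS : t1 <= t1 + S <= t1 + S by rewrite lexx andbT lerDl ltW.
have [q1 q2] := HQ _ _ Gb tS; have [cb _ bT bd [_ bTh]] := Gb.
have /andP[Q0 Q1] := near' _ q2 bd.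
have Ed : 0 < E1 - delta by rewrite subr_gt0.
have q3 : E1 - delta <= expR (- H beta (t1 + S)).
  have : EQ beta (t1 + S) <= 1 * expR (- H beta (t1 + S)) by rewrite ler_wpM2r // expR_ge0.
  by clear - q1 k0; lra.
have q4 : H beta (t1 + S) <= `|ln (E1 - delta)|.
  have : ln (E1 - delta) <= - H beta (t1 + S) by rewrite -[leRHS]expRK ler_ln ?posrE ?expR_gt0.
  have := ler_norm (- ln (E1 - delta)); rewrite normrN; clear; lra.
have gend : 0 <= g (y beta (t1 + S)).
  by apply: g0; apply: not_T_D; apply: bT; case/andP: tS => -> ->.
have Hal : 0 <= H alpha t1.
  by rewrite HdE; apply: intg_ge0 => v /andP[v0 _]; apply: h_ge0; apply: ca.1; exact: ltW.
have tg : 0 <= th * g (y beta (t1 + S)) by apply: mulr_ge0 => //; exact: ltW.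
have SE : t1 + S - t1 = S by rewrite addrC addKr.
rewrite /Theta SE in bTh; rewrite /B in cS.
by clear - bTh cS q4 Hal tg; lra.
Qed.

(** * Exit times and costs *)

Section ExitTime.
Context {R : realType} {n m : nat}.
Variables (A : set 'rV[R]_m) (T : set 'rV[R]_n).
Hypotheses (T0 : T !=set0) (Tcl : closed T).
Variables (y : R -> 'rV[R]_n).
Hypotheses (yc : {within `[0, +oo[, continuous y}).
Local Notation tau := (exit_time T y).

Lemma exit_time_ge s : (forall v, 0 <= v -> v < s -> ~ T (y v)) -> (s%:E <= tau)%E.
Proof.
move=> h; apply: le_ereal_inf_tmp => _ [v [v0 Tv] <-]; rewrite lee_fin leNgt.
by apply/negP => vs; exact: (h v v0 vs Tv).
Qed.

Lemma exit_time_le s : 0 <= s -> T (y s) -> (tau <= s%:E)%E.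
Proof. by move=> s0 Ts; apply: ereal_inf_lbound; exists s. Qed.

Lemma before_exit s : 0 <= s -> (s%:E < tau)%E -> ~ T (y s).
Proof. by move=> s0 st Ts; have := lt_le_trans st (exit_time_le s0 Ts); rewrite ltxx. Qed.

(** Strict because T is closed: the curve is at positive distance from T at time s and stays off T a
    little longer. *)
Lemma exit_time_gt s : 0 <= s -> (forall v, 0 <= v <= s -> ~ T (y v)) -> (s%:E < tau)%E.
Proof.
move=> s0 h; have Ts : ~ T (y s) by apply: h; rewrite s0 lexx.
have ds := dist_gt0 T0 Tcl Ts.
have [d d0 hd] := curve_continuous yc s0 ds.
apply: (@lt_le_trans _ _ (s + d)%:E); first by rewrite lte_fin ltrDl.
apply: exit_time_ge => v v0 vs; have [vs'|vs'] := leP v s; first by apply: h; rewrite v0.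
have : enorm (y v - y s) < dist T (y s).
  by apply: hd => //; rewrite gtr0_norm ?subr_gt0 //; lra.
by move=> q Tv; have := dist_le (y s) Tv; rewrite (enormB (y s)); lra.
Qed.

Lemma exit_time_ge0 : (0%:E <= tau)%E.
Proof. by apply: exit_time_ge => v v0; rewrite ltNge v0. Qed.

Lemma measurable_before_exit :
  measurable ([set s : R | 0 <= s /\ (s%:E < tau)%E] : set (measurableTypeR R)).
Proof.
have -> : [set s : R | 0 <= s /\ (s%:E < tau)%E] =
    [set` Interval (BLeft 0) (if tau is t%:E then BLeft t else +oo%O)].
  apply/seteqP; split => s /=; rewrite in_itv /=.
    by case=> ->; case E : tau => [t| |] //=; rewrite ?lte_fin // ltNge leNye.
  have := exit_time_ge0.
  by case E : tau => [t| |] //= _ /andP[-> st]; split => //; rewrite ?lte_fin ?ltry.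
exact: measurable_itv.
Qed.

(** Otherwise the distance is at least d on a left neighbourhood of the exit time, which is
    positive, and so is the lower limit. *)
Lemma approaches_near d : approaches T y -> ~ T (y 0) -> 0 < d ->
  exists t, [/\ 0 <= t, (t%:E < tau)%E & dist T (y t) < d].
Proof.
move=> ap T0y d0; apply: contrapT => H.
have tau0 : (0%:E < tau)%E.
  apply: exit_time_gt => // v v0; have -> : v = 0 by apply/eqP; rewrite eq_le andbC.
  by [].
have VF : left_nbhs tau [set s | 0 < s /\ (s%:E < tau)%E].
  case E : tau tau0 => [r| |] //=.
    rewrite lte_fin => r0; near=> s; split; first by near: s; exact: nbhs_left_gt.
    by rewrite lte_fin.
  by move=> _; exists 0; split => // s s0; split => //; exact: ltry.
suff : (d%:E <= limf_einf (fun s => (dist T (y s))%:E) (left_nbhs tau))%E.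
  by rewrite ap lee_fin leNgt d0.
rewrite limf_einfE.
apply: (@le_trans _ _ (ereal_inf [set (dist T (y s))%:E | s in [set s | 0 < s /\ (s%:E < tau)%E]])).
  apply: le_ereal_inf_tmp => _ [v [v0 vt] <-]; rewrite lee_fin leNgt; apply/negP => dv.
  by apply: H; exists v; rewrite (ltW v0).
by apply: ereal_sup_ubound; eexists; [exact: VF|].
Unshelve. all: by end_near. Qed.

Lemma le_cost (l : 'rV[R]_n -> 'rV[R]_m -> R) (alpha : R -> 'rV[R]_m) t :
  loc_bounded_meas (fun s => l (y s) (alpha s)) ->
  (forall s, 0 <= s -> 0 <= l (y s) (alpha s)) -> 0 <= t -> (t%:E < tau)%E ->
  ((intg (fun s => l (y s) (alpha s)) 0 t)%:E <= cost l tau alpha y)%E.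
Proof.
move=> lb l0 t0 tt; rewrite -(intg0E t lb) /Rintegral fineK; last first.
  apply: integrable_fin_num; first exact: measurable_itv.
  exact: lbm_integrable.
apply: ge0_subset_integral => //.
- exact: measurable_before_exit.
- apply/measurable_EFinP; case: lb => lm _; apply: (measurable_funS _ _ lm).
    exact: measurable_itv.
  by move=> s [s0 _]; rewrite /= in_itv /= s0.
- by move=> s [s0 _]; rewrite lee_fin; exact: l0.
- move=> s /=; rewrite in_itv /= => /andP[-> st]; split => //.
  by apply: le_lt_trans tt; rewrite lee_fin.
Qed.

Variable ts : nat -> R.
Hypotheses (ts0 : forall i, 0 <= ts i) (tsm : forall i, ts i <= ts i.+1)
  (tsT : forall i v, 0 <= v <= ts i -> ~ T (y v))
  (tsd : forall i, dist T (y (ts i.+1)) < 1 / 2 ^+ i).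

Let ts_mono i j : (i <= j)%N -> ts i <= ts j.
Proof. by have /nondecreasing_seqP := tsm; apply. Qed.

(** The times [ts] exhaust the interval before exit: a supremum t < tau would have y t at distance 0
    from T by continuity. *)
Lemma exit_time_sup s : 0 <= s -> (s%:E < tau)%E -> exists i, s <= ts i.
Proof.
move=> s0 st; apply: contrapT => H.
have H' i : ts i <= s by rewrite leNgt; apply/negP => h; apply: H; exists i; exact: ltW.
pose t := sup (range ts).
have hs : has_sup (range ts) by split; [exists (ts 0%N), 0%N|exists s => _ [i _ <-]].
have tst i : ts i <= t by apply: ub_le_sup; [exact: hs.2|exists i].
have t0 : 0 <= t by apply: le_trans (ts0 0%N) (tst 0%N).
have t_s : t <= s by apply: ge_sup; [exact: hs.1|move=> _ [i _ <-]].
have : (t%:E < tau)%E by apply: le_lt_trans st; rewrite lee_fin.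
move=> /(before_exit t0) Tt; have dt := dist_gt0 T0 Tcl Tt.
have d2 : 0 < dist T (y t) / 2 by rewrite divr_gt0.
have [d d0 hd] := curve_continuous yc t0 d2.
have [||_ [i0 _ <-] hi] := @sup_gt R (range ts) (t - d) _ _.
- exact: hs.1.
- by rewrite gtrBl.
have [k0 hk] := div_pow2_small ler01 d2.
pose i := maxn i0 k0; have ii : ts i0 <= ts i.+1 by apply: ts_mono; apply: leqW; exact: leq_maxl.
have := hd (ts i.+1) (ts0 _); rewrite ler0_norm ?subr_le0 // => /(_ _) q.
have {}q : enorm (y (ts i.+1) - y t) < dist T (y t) / 2 by apply: q; lra.
have := hk i (leq_maxr _ _); have := tsd i; have := dist_lip T0 (y t) (y (ts i.+1)).
rewrite (enormB (y t)); lra.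
Qed.

Lemma approaches_seq : approaches T y.
Proof.
rewrite /approaches limf_einfE.
have tau0 i : ((ts i)%:E < tau)%E by apply: exit_time_gt => // v; exact: tsT.
(* The times [ts] eventually enter every left neighbourhood of the exit time, finite or infinite,
   and the distances at these times tend to 0. *)
have hV V : left_nbhs tau V -> forall e : R, 0 < e -> exists2 v, V v & dist T (y v) < e.
  move=> hV e e0; have [k0 hk] := div_pow2_small ler01 e0.
  suff [i0 hi] : exists i0, forall i, (i0 <= i)%N -> V (ts i).
    exists (ts (maxn i0 k0).+1); first by apply: hi; apply: leqW; exact: leq_maxl.
    by apply: lt_trans (tsd _) (hk _ _); exact: leq_maxr.
  case E : tau hV => [r| |] /=.
  - move=> /nbhs_ballP[d /= d0 hd].
    have r0 : 0 < r by have := tau0 0%N; rewrite E lte_fin; exact: le_lt_trans.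
    pose s := Num.max 0 (r - d / 2).
    have [||i0 hi] := @exit_time_sup s.
    + by rewrite le_max lexx.
    + by rewrite E lte_fin gt_max r0 /= gtrBl divr_gt0.
    exists i0 => i ii; have tr : ts i < r by have := tau0 i; rewrite E lte_fin.
    apply: hd => //; rewrite /ball /= gtr0_norm ?subr_gt0 //.
    have : r - d / 2 <= s by rewrite le_max lexx orbT.
    have := ts_mono ii; lra.
  - move=> [M [_ hM]]; have [||i0 hi] := @exit_time_sup (`|M| + 1).
    + by rewrite addr_ge0.
    + by rewrite E ltry.
    exists i0 => i ii; apply: hM; have := ts_mono ii; have := ler_norm M; lra.
  - by have := tau0 0%N; rewrite E; case: ltP => //; rewrite leNye.
apply/eqP; rewrite eq_le; apply/andP; split.
  apply: ge_ereal_sup => _ [V VF <-]; apply/lee_addgt0Pr => e e0; rewrite add0e.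
  have [v Vv dv] := hV V VF e e0.
  apply: (@le_trans _ _ (dist T (y v))%:E); last by rewrite lee_fin ltW.
  by apply: ereal_inf_lbound; exists v.
apply: (@le_trans _ _ (ereal_inf [set (dist T (y s))%:E | s in setT])).
  by apply: le_ereal_inf_tmp => _ [v _ <-]; rewrite lee_fin; exact: dist_ge0.
apply: ereal_sup_ubound; exists setT => //.
rewrite /left_nbhs; case: (tau) => [r| |]; exact: filterT.
Qed.

(** Monotone convergence along the intervals [0, ts i], which cover the time before exit. *)
Lemma cost_le (l : 'rV[R]_n -> 'rV[R]_m -> R) (alpha : R -> 'rV[R]_m) (C : R) :
  loc_bounded_meas (fun s => l (y s) (alpha s)) ->
  (forall s, 0 <= s -> 0 <= l (y s) (alpha s)) ->
  (forall i, intg (fun s => l (y s) (alpha s)) 0 (ts i) <= C) ->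
  (cost l tau alpha y <= C%:E)%E.
Proof.
move=> lb l0 hC; set F := fun s => l (y s) (alpha s) in lb l0 hC.
have lm : measurable_fun (`[0, +oo[%classic : set (measurableTypeR R)) (EFin \o F).
  by apply/measurable_EFinP; case: lb.
pose U : set R := \bigcup_i `[0, ts i]%classic.
have U0 : U `<=` `[0, +oo[%classic.
  by move=> s [i _] /=; rewrite !in_itv /= andbT => /andP[].
have mU : measurable (U : set (measurableTypeR R)).
  by apply: bigcupT_measurable => i; exact: measurable_itv.
have hi i : (\int[lebesgue_measure]_(s in `[0%R, ts i]) (F s)%:E <= C%:E)%E.
  have int : (@lebesgue_measure R).-integrable `[0, ts i] (EFin \o F).
    exact: lbm_integrable.
  rewrite -[leLHS]fineK; last exact: integrable_fin_num.
  by rewrite lee_fin -/(Rintegral _ _ _) (intg0E (ts i) lb).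
have sub : [set s : R | 0 <= s /\ (s%:E < tau)%E] `<=` U.
  move=> s [s0 /(exit_time_sup s0)[i si]]; exists i => //=.
  by rewrite in_itv /= s0.
apply: (@le_trans _ _ (\int[lebesgue_measure]_(s in U) (F s)%:E)%E).
  apply: ge0_subset_integral => //.
  - exact: measurable_before_exit.
  - by apply: measurable_funS lm => //; exact: measurable_itv.
  - by move=> s Us; rewrite lee_fin; apply: l0; have := U0 s Us; rewrite /= in_itv /= andbT.
have -> : U = \bigcup_i (fun i => `[0, ts i]%classic : set R) i by [].
have nd : nondecreasing_seq (fun i => `[0, ts i]%classic : set R).
  apply/nondecreasing_seqP => i; apply/subsetPset => s /=; rewrite !in_itv /= => /andP[-> st].
  by rewrite (le_trans st).
have mF i : measurable (`[0, ts i]%classic : set (measurableTypeR R)) by exact: measurable_itv.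
have mf i : measurable_fun (`[0, ts i]%classic : set (measurableTypeR R)) (EFin \o F).
  apply: (measurable_funS _ _ lm); first exact: measurable_itv.
  by move=> s /=; rewrite !in_itv /= andbT => /andP[].
have f0 i s : (`[0, ts i]%classic : set R) s -> (0%:E <= (EFin \o F) s)%E.
  by rewrite /= in_itv /= lee_fin => /andP[s0 _]; exact: l0.
have cv := @ge0_nondecreasing_set_cvg_integral _ (measurableTypeR R) R
  (fun i => `[0, ts i]%classic) (EFin \o F) lebesgue_measure nd mF mf f0.
rewrite -(cvg_lim _ cv) //; apply: lime_le; first exact: cvgP cv.
by apply: nearW => i; exact: hi.
Qed.

End ExitTime.

(* Stage i loses at most delta / 2 ^ (i + 1) and ends at distance less than 2 ^ - i
   from T, so that the concatenated control belongs to A(x). *)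
Lemma value_le (R : realType) (n m : nat)
  (f : 'rV[R]_n -> 'rV[R]_m -> 'rV[R]_n) (l h : 'rV[R]_n -> 'rV[R]_m -> R)
  (A : set 'rV[R]_m) (T : set 'rV[R]_n)
  (Ac : compact A) (A0 : A !=set0) (T0 : T !=set0) (Tcl : closed T)
  (f_cont : {within setT `*` A, continuous (fun q => f q.1 q.2)})
  (f_lip : forall r, 0 < r -> exists2 L, 0 < L &
     forall x1 x2 a, enorm x1 <= r -> enorm x2 <= r -> A a ->
       enorm (f x1 a - f x2 a) <= L * enorm (x1 - x2))
  (M : R) (M0 : 0 < M)
  (f_growth : forall x a, A a -> enorm (f x a) <= M * (1 + enorm x))
  (h_cont : {within setT `*` A, continuous (fun q => h q.1 q.2)})
  (l_cont : {within setT `*` A, continuous (fun q => l q.1 q.2)})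
  (l_ge0 : forall x a, A a -> 0 <= l x a) (l_le : forall x a, A a -> l x a <= h x a)
  (w : 'rV[R]_n -> R) (wc : {within ~` interior T, continuous w})
  (w01 : forall x, ~ interior T x -> 0 <= w x <= 1)
  (wsup : viscosity_supersolution (hamiltonian f h A) (~` T) w)
  (g : 'rV[R]_n -> R) (G : 'rV[R]_n -> 'rV[R]_n)
  (gG : comparison_barrier f h A T g G) (x : 'rV[R]_n) (delta : R) :
  ~ T x -> 0 < delta -> delta < 1 - w x ->
  (value f l A T x <= (- ln (1 - w x - delta))%:E)%E.
Proof.
move=> Tx de0 dw; have [a0 Aa0] := A0.
have h_ge0 z a : A a -> 0 <= h z a by move=> Aa; exact: le_trans (l_ge0 z a Aa) (l_le z a Aa).
have [y yE] : exists y, y = flow f x by exists (flow f x).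
have ty beta (cb : control A beta) : trajectory f x beta (y beta).
  by rewrite yE; exact: (flow_trajectory Ac f_cont f_lip M0 f_growth).
have y_causal beta beta' s : (forall v, v <= s -> beta v = beta' v) ->
    forall v, v <= s -> y beta v = y beta' v.
  by rewrite yE; exact: flow_causal.
pose H beta s := intg (fun v => h (y beta v) (beta v)) 0 s.
pose E (p : (R -> 'rV[R]_m) * R) := (1 - w (y p.1 p.2)) * expR (- H p.1 p.2).
pose S := ((R -> 'rV[R]_m) * R)%type.
(* The loss delta (1 - 1 / 2 ^ i) is the sum of delta / 2 ^ (j + 1) over the stages j < i. *)
pose Inv i (p : S) := [/\ control A p.1, 0 <= p.2,
  forall s, 0 <= s <= p.2 -> ~ T (y p.1 s) & 1 - w x - delta * (1 - 1 / 2 ^+ i) <= E p].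
pose Rel i (p q : S) := [/\ forall s, s <= p.2 -> q.1 s = p.1 s, p.2 <= q.2 &
  dist T (y q.1 q.2) < 1 / 2 ^+ i].
have p2 i : 0 < 2 ^+ i :> R by rewrite exprn_gt0.
have step i p : Inv i p -> exists q, Inv i.+1 q /\ Rel i p q.
  move=> [cp p0 pT pE].
  have di : delta / 2 ^+ i.+1 < E p.
    apply: lt_le_trans pE; rewrite exprS invfM; have : 0 < (2 ^+ i)^-1 :> R by rewrite invr_gt0.
    by move: ((2 ^+ i)^-1) => z z0; clear - z0 dw de0; nra.
  have di0 : 0 < delta / 2 ^+ i.+1 by rewrite divr_gt0.
  have := superoptimality_stage (x := x) Ac T0 Tcl f_cont f_lip M0 f_growth h_cont h_ge0 wc w01
    wsup gG cp p0 _ (divr_gt0 ltr01 (p2 i)) di0.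
  rewrite -yE => /(_ (pT _ _) di); rewrite p0 lexx => /(_ isT).
  move=> [beta [t2 [cb ba pt bT [bd bE]]]].
  exists (beta, t2); split; last by split.
  split => //=; first exact: le_trans pt.
    move=> s /andP[s0 st]; have [sp|sp] := leP s p.2.
      by rewrite (y_causal _ _ _ ba s sp); apply: pT; rewrite s0.
    by apply: bT; rewrite (ltW sp).
  apply: le_trans bE; move: pE; rewrite /E /= exprS invfM => pE.
  by apply: le_trans (lerD pE (lexx _)); move: ((2 ^+ i)^-1) => z; clear; lra.
have Inv0 : Inv 0%N ((fun=> a0), 0).
  have c0 : control A (fun=> a0).
    split=> [//|O Oo]; apply: measurableI; first exact: measurable_itv.
    have [Oa|Oa] := pselect (O a0).
      by have -> : (fun=> a0 : 'rV[R]_m) @^-1` O = (setT : set R) by apply/seteqP; split.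
    by have -> : (fun=> a0 : 'rV[R]_m) @^-1` O = (set0 : set R) by apply/seteqP; split.
  have y0 : y (fun=> a0) 0 = x := traj0 Ac f_cont c0 (ty _ c0).
  split => //=.
    by move=> s; rewrite -eq_le => /eqP <-; rewrite y0.
  by rewrite /E /= y0 /H intg_set0 // oppr0 expR0 expr0; lra.
(* The default p is a mere filler: [stP] shows that the invariant holds all along [st]. *)
pose next i p := if pselect (Inv i p) is left ip then projT1 (cid (step i p ip)) else p.
pose st := fix st i := if i is i'.+1 then next i' (st i') else (((fun=> a0), 0) : S).
have stP i : Inv i (st i) /\ Rel i (st i) (st i.+1).
  have nx j : Inv j (st j) -> Inv j.+1 (st j.+1) /\ Rel j (st j) (st j.+1).
    by move=> ij; rewrite /= /next; case: pselect => // ip; have := projT2 (cid (step j _ ip)).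
  have I j : Inv j (st j) by elim: j => [//|j /nx[]].
  by split; [exact: I|have [] := nx i (I i)].
pose b i := (st i).1; pose t i := (st i).2.
have tm i : t i <= t i.+1 by have [_ []] := stP i.
have tmono i j : (i <= j)%N -> t i <= t j by have /nondecreasing_seqP := tm; apply.
have t0 i : 0 <= t i by have [[]] := stP i.
have bb i j : (i <= j)%N -> forall s, s <= t i -> b j s = b i s.
  move=> /subnK <-; elim: (j - i)%N => [//|k IH] s si; rewrite addSn.
  have [_ [q _ _]] := stP (k + i)%N; rewrite /b q; first exact: IH.
  by apply: le_trans si (tmono _ _ _); rewrite leq_addl.
(* Any stage reaching v gives the same value, by [bb]; a0 fills the time after all stages if the t i
   are bounded. *)
pose al v := if pselect (exists i, v <= t i) is left ex then b (projT1 (cid ex)) v else a0.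
have alE i v : v <= t i -> al v = b i v.
  move=> vi; rewrite /al; case: pselect => [ex|[]]; last by exists i.
  have vj := projT2 (cid ex); set j := projT1 (cid ex) in vj *.
  have [ij|ji] := leqP i j; first exact: bb.
  by rewrite (bb j i (ltnW ji)).
have cbi i : control A (b i) by have [[]] := stP i.
have cal : control A al.
  split=> [v v0|O Oo].
    by rewrite /al; case: pselect => // ex; exact: (cbi _).1.
  pose B := \bigcup_i (`]-oo, t i]%classic `&` (`[0, +oo[%classic `&` b i @^-1` O)) : set R.
  pose Z := \bigcup_i `]-oo, t i]%classic : set R.
  have -> : `[0, +oo[%classic `&` al @^-1` O =
      B `|` ((`[0, +oo[%classic `\` Z) `&` [set _ : R | O a0]).
    apply/seteqP; split => v /=.
      move=> [v0 Ov]; have [[i vi]|nex] := pselect (exists i, v <= t i).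
        by left; exists i => //=; rewrite in_itv /= vi; split => //; split => //; rewrite /= -(alE i v vi).
      right; split; last by move: Ov; rewrite /al; case: pselect.
      by split => // -[i _] /=; rewrite in_itv /= => vi; apply: nex; exists i.
    move=> [[i _ [vi [v0 Ov]]]|[[v0 nZ] Oa]].
      by split => //=; rewrite (alE i) //; move: vi; rewrite /= in_itv.
    split => //; rewrite /al; case: pselect => // -[i vi]; exfalso; apply: nZ.
    by exists i => //=; rewrite in_itv.
  apply: measurableU.
    apply: bigcupT_measurable => i; apply: measurableI; first exact: measurable_itv.
    exact: (cbi i).2.
  apply: measurableI.
    by apply: measurableD; [exact: measurable_itv|apply: bigcupT_measurable => i; exact: measurable_itv].
  have [Oa|Oa] := pselect (O a0).
    have -> : [set _ : R | O a0] = setT by apply/seteqP; split.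
    exact: measurableT.
  have -> : [set _ : R | O a0] = set0 by apply/seteqP; split.
  exact: measurable0.
have yal i v : v <= t i -> y al v = y (b i) v by apply: y_causal; exact: alE.
have ytr := ty al cal.
have aT i v : 0 <= v <= t i -> ~ T (y al v).
  by move=> vi; case/andP: (vi) => _ vt; rewrite (yal i v vt); have [[_ _ q _] _] := stP i; exact: q.
have ad i : dist T (y al (t i.+1)) < 1 / 2 ^+ i.
  by rewrite (yal i.+1) //; have [_ [_ _ q]] := stP i.
have yc := ytr.1.
have llb := curve_lbm Ac l_cont cal yc.
have hlb := curve_lbm Ac h_cont cal yc.
have Dx : 0 < 1 - w x - delta by rewrite subr_gt0.
have ci i : intg (fun s => l (y al s) (al s)) 0 (t i) <= - ln (1 - w x - delta).
  apply: (@le_trans _ _ (intg (fun s => h (y al s) (al s)) 0 (t i))).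
    apply: le_intg => // s /andP[s0 _]; apply: l_le; apply: cal.1; exact: ltW.
  have -> : intg (fun s => h (y al s) (al s)) 0 (t i) = H (b i) (t i).
    by apply: eq_intg => s /andP[_ si]; rewrite (alE i s si) (yal i s si).
  have [[_ _ q1 q2] _] := stP i.
  (* The invariant bounds (1 - w) exp(- H) from below, and 1 - w <= 1. *)
  have q3 : 1 - w x - delta <= expR (- H (b i) (t i)).
    apply: (@le_trans _ _ (1 - w x - delta * (1 - 1 / 2 ^+ i))).
      rewrite lerD2l lerN2 ler_piMr ?(ltW de0) // gerBl divr_ge0 // ltW //.
    apply: le_trans q2 _; rewrite /E -/(b i) -/(t i).
    have : 0 <= w (y (b i) (t i)) <= 1.
      by apply: w01; apply: not_T_D; apply: q1; rewrite t0 lexx.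
    by move=> /andP[q4 q5]; rewrite ler_piMl ?expR_ge0 // gerBl.
  have : ln (1 - w x - delta) <= - H (b i) (t i).
    by rewrite -[leRHS]expRK ler_ln ?posrE ?expR_gt0.
  by clear; lra.
rewrite /value ifF; last by apply/negP; rewrite inE.
apply: (@le_trans _ _ (cost l (exit_time T (y al)) al (y al))).
  apply: ereal_inf_lbound; exists al, (y al); split => //.
  exact: (approaches_seq T0 Tcl yc t0 tm aT ad).
apply: (cost_le T0 Tcl yc t0 tm ad llb _ ci) => s s0.
by apply: l_ge0; exact: cal.1.
Qed.

(** * Conclusion *)

(** The number c is a common lower bound of all W_e at x, later the limit W x; the w of [hw] may
    change with e, but the barrier Wb may not. *)
Lemma cost_ge (R : realType) (n m : nat)
  (f : 'rV[R]_n -> 'rV[R]_m -> 'rV[R]_n) (l rho : 'rV[R]_n -> 'rV[R]_m -> R)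
  (A : set 'rV[R]_m) (T : set 'rV[R]_n)
  (Ac : compact A) (T0 : T !=set0) (Tcl : closed T) (bc : compact (bdry T))
  (f_cont : {within setT `*` A, continuous (fun q => f q.1 q.2)})
  (f_lip : forall r, 0 < r -> exists2 L, 0 < L &
     forall x1 x2 a, enorm x1 <= r -> enorm x2 <= r -> A a ->
       enorm (f x1 a - f x2 a) <= L * enorm (x1 - x2))
  (f_growth : exists2 M : R, 0 < M &
     forall x a, A a -> enorm (f x a) <= M * (1 + enorm x))
  (l_cont : {within setT `*` A, continuous (fun q => l q.1 q.2)})
  (rho_cont : {within setT `*` A, continuous (fun q => rho q.1 q.2)})
  (h_cont : forall e, {within setT `*` A, continuous (fun q => l q.1 q.2 + e * rho q.1 q.2)})
  (l_ge0 : forall x a, A a -> 0 <= l x a) (rho_ge0 : forall x a, A a -> 0 <= rho x a)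
  (Wb : 'rV[R]_n -> R) (Wbc : {within ~` interior T, continuous Wb})
  (Wb0 : forall b, bdry T b -> Wb b = 0) (x : 'rV[R]_n) (c : R)
  (hw : forall e, 0 < e <= 1 -> exists w : 'rV[R]_n -> R,
    [/\ {within ~` interior T, continuous w},
        forall x, ~ interior T x -> 0 <= w x <= 1 /\ w x <= Wb x,
        viscosity_subsolution (hamiltonian f (fun x a => l x a + e * rho x a) A) (~` T) w
      & c <= w x])
  (alpha : R -> 'rV[R]_m) (y : R -> 'rV[R]_n) :
  ~ T x -> control A alpha -> trajectory f x alpha y -> approaches T y ->
  (- lne (1 - c)%:E <= cost l (exit_time T y) alpha y)%E.
Proof.
move=> Tx ca ty ap; have yc := ty.1.
have y0 : y 0 = x := traj0 Ac f_cont ca ty.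
have llb := curve_lbm Ac l_cont ca yc.
have rlb := curve_lbm Ac rho_cont ca yc.
have l0 s : 0 <= s -> 0 <= l (y s) (alpha s) by move=> s0; apply: l_ge0; exact: ca.1.
have C0 : (0%:E <= cost l (exit_time T y) alpha y)%E.
  by apply: integral_ge0 => s [s0 _]; rewrite lee_fin; exact: l0.
have key C : cost l (exit_time T y) alpha y = C%:E -> expR (- C) <= 1 - c.
  move=> CE; apply/ler_addgt0Pr => eta eta0.
  have e20 : 0 < eta / 2 by rewrite divr_gt0.
  have Wb0' b : bdry T b -> Wb b <= 0 by move=> /Wb0 ->.
  have [d d0 hd] := usc_bdry_small T0 Tcl bc (continuous_usc Wbc) Wb0' e20.
  have [|t [t0 tt td]] := approaches_near T0 Tcl yc ap _ d0; first by rewrite y0.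
  have tT s : 0 <= s <= t -> ~ T (y s).
    move=> /andP[s0 st]; have st' : (s%:E < exit_time T y)%E.
      by apply: le_lt_trans tt; rewrite lee_fin.
    exact: before_exit s0 st'.
  pose I1 := intg (fun s => l (y s) (alpha s)) 0 t.
  pose I2 := intg (fun s => rho (y s) (alpha s)) 0 t.
  have I20 : 0 <= I2.
    by apply: intg_ge0 => s /andP[s0 _]; apply: rho_ge0; apply: ca.1; exact: ltW.
  have I21 : 0 < I2 + 1 by rewrite ltr_wpDl.
  (* Chosen after t, so that e times the integral of rho up to t is at most eta / 2. *)
  pose e := Num.min 1 (eta / 2 / (I2 + 1)).
  have e01 : 0 < e <= 1 by rewrite lt_min ltr01 divr_gt0 //= ge_min lexx.
  have eI : e * I2 <= eta / 2.
    have : e * (I2 + 1) <= eta / 2 by rewrite -ler_pdivlMr // ge_min lexx orbT.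
    by case/andP: e01 => e0 _; rewrite mulrDr mulr1; clear - e0; lra.
  have [w [wc w01 wsub cw]] := hw e e01.
  have h_ge0 z a : A a -> 0 <= l z a + e * rho z a.
    move=> Aa; apply: addr_ge0; first exact: l_ge0.
    by apply: mulr_ge0; [case/andP: e01 => /ltW|exact: rho_ge0].
  have w01' z : ~ interior T z -> 0 <= w z <= 1 by move=> /w01[].
  have := suboptimality Ac T0 Tcl f_cont f_lip f_growth (h_cont e) h_ge0 wc w01' wsub ca ty t0 tT.
  have -> : intg (fun s => l (y s) (alpha s) + e * rho (y s) (alpha s)) 0 t = I1 + e * I2.
    by rewrite (intgD t llb (lbmZ e rlb) (lexx 0)) (intgZ e t rlb (lexx 0)).
  have I1C : I1 <= C by rewrite -lee_fin -CE; exact: le_cost.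
  have yt : ~ interior T (y t) by apply: not_T_D; apply: tT; rewrite t0 lexx.
  have [_ wW] := w01 _ yt; have Wd := hd _ yt td.
  rewrite opprD expRD => q.
  have q1 : expR (- C) <= expR (- I1) by rewrite ler_expR lerN2.
  have q2 : 1 - e * I2 <= expR (- (e * I2)) by exact: expR_ge1Dx.
  have C1 : expR (- C) <= 1.
    by rewrite -[leRHS]expR0 ler_expR oppr_le0 -lee_fin -CE.
  have Cp := expR_ge0 (- C); have Ep := expR_ge0 (- (e * I2)).
  have E1 : expR (- (e * I2)) <= 1.
    rewrite -[leRHS]expR0 ler_expR oppr_le0; apply: mulr_ge0 => //.
    by case/andP: e01 => /ltW.
  have wt1 : 0 <= 1 - w (y t) by have [/andP[_]] := w01 _ yt; rewrite subr_ge0.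
  have q3 : expR (- C) * expR (- (e * I2)) <= expR (- I1) * expR (- (e * I2)).
    by rewrite ler_wpM2r.
  have q4 := ler_wpM2l wt1 q3.
  have q5 : 1 - eta / 2 - e * I2 <= (1 - w (y t)) * expR (- (e * I2)).
    have : w (y t) * expR (- (e * I2)) <= eta / 2.
      apply: le_trans (_ : w (y t) * 1 <= _); last by rewrite mulr1; clear - wW Wd; lra.
      by apply: ler_wpM2l => //; have [/andP[]] := w01 _ yt.
    by rewrite mulrBl mul1r; clear - q2; lra.
  have q6 := ler_wpM2l Cp q5.
  have q7 : expR (- C) * (eta / 2 + e * I2) <= eta.
    apply: le_trans (_ : 1 * (eta / 2 + e * I2) <= _); last by rewrite mul1r; clear - eI; lra.
    apply: ler_wpM2r => //; apply: addr_ge0; first exact: ltW.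
    by apply: mulr_ge0 => //; case/andP: e01 => /ltW.
  clear - q q4 q6 q7 cw; move: q q4 q6 q7 cw.
  move: (expR (- C)) (expR (- I1)) (expR (- (e * I2))) (w _) (w _) => a1 a2 a3 a4 a5.
  by lra.
case E : (cost l (exit_time T y) alpha y) C0 key => [C| |] // _ key; last by rewrite leey.
have hC := key C erefl; have c1 : 0 < 1 - c by apply: lt_le_trans hC; exact: expR_gt0.
rewrite lne_EFin // -EFinN lee_fin lerNl -[leLHS]expRK ler_ln ?posrE ?expR_gt0 //.
Qed.

Section ContinuousSolution.
Context {R : realType} {n m : nat}.
Variables (f : 'rV[R]_n -> 'rV[R]_m -> 'rV[R]_n) (h : 'rV[R]_n -> 'rV[R]_m -> R)
  (A : set 'rV[R]_m) (T : set 'rV[R]_n).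
Hypotheses (T0 : T !=set0) (Tcl : closed T).
Let D := ~` interior T.
Variables (V : 'rV[R]_n -> R).
Hypotheses (Vc : {within D, continuous V}) (V01 : forall x, D x -> 0 <= V x <= 1)
  (Vb : forall b, bdry T b -> V b = 0)
  (Vsup : viscosity_supersolution (hamiltonian f h A) (~` T) V)
  (Vsub : viscosity_subsolution (hamiltonian f h A) (~` T) V).

Lemma continuous_nonneg_solution : nonneg_solution f h A T V.
Proof.
have lE x : D x -> lsc_env D V x = V x := lsc_env_id V01 (continuous_lsc Vc).
have uE x : D x -> usc_env D V x = V x := usc_env_id V01 (continuous_usc Vc).
have loc x : ~ T x -> exists2 r, 0 < r & forall y, enorm (y - x) < r -> D y.
  move=> /(notT_open Tcl)[r r0 hr]; exists r => // y yr.
  by apply: not_T_D; exact: hr.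
split; last by move=> x /V01/andP[].
split.
- by move=> x /V01/andP[].
- move=> x Dx; exists 1; split => // M M1; apply/within_enormP; exists 1 => // y Dy _ /=.
  by have /andP[v0 v1] := V01 Dy; rewrite ger0_norm // (le_trans v1) // ltW.
- split; first by move=> b bb; rewrite lE ?Vb //; exact: bdry_D.
  apply: supersol_eq Vsup => x /loc[r r0 hr]; exists r => // y /hr Dy.
  by rewrite lE.
split; first by move=> b bb; rewrite uE ?Vb //; exact: bdry_D.
apply: subsol_eq Vsub => x /loc[r r0 hr]; exists r => // y /hr Dy.
by rewrite uE.
Qed.

Hypotheses (Ac : compact A) (bc : compact (bdry T))
  (f_lip : forall r, 0 < r -> exists2 L, 0 < L &
     forall x1 x2 a, enorm x1 <= r -> enorm x2 <= r -> A a ->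
       enorm (f x1 a - f x2 a) <= L * enorm (x1 - x2))
  (h_cont : {within setT `*` A, continuous (fun q => h q.1 q.2)})
  (h_ge0 : forall x a, A a -> 0 <= h x a).
Variables (g : 'rV[R]_n -> R) (G : 'rV[R]_n -> 'rV[R]_n).
Hypothesis gG : comparison_barrier f h A T g G.

(** Comparison with the continuous V gives upper envelope of V' <= V <= lower envelope of V'. *)
Lemma nonneg_solution_unique V' : nonneg_solution f h A T V' -> {in D, V' =1 V}.
Proof.
move=> [[V'1 _ [lb lsup] [ub usub]] V'0] x /set_mem Dx.
have V'01 y : D y -> 0 <= V' y <= 1 by move=> Dy; rewrite V'0 // V'1.
have uV : usc_env D V' x <= V x.
  apply: (comparison Ac T0 Tcl bc f_lip h_cont h_ge0 gG (usc_env_usc V'01)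
    (continuous_lsc Vc)) => // y Dy; last by case/andP: (V01 Dy).
  by apply: (usc_env_le V'01 Dy ltr01) => z Dz _; exact: V'1.
have Vl : V x <= lsc_env D V' x.
  apply: (comparison Ac T0 Tcl bc f_lip h_cont h_ge0 gG (continuous_usc Vc)
    (lsc_env_lsc V'01)) => // y Dy.
  - by case/andP: (V01 Dy).
  - by apply: (lsc_env_ge V'01 Dy ltr01) => z Dz _; exact: V'0.
  - by rewrite Vb.
apply/eqP; rewrite eq_le; apply/andP; split.
  exact: le_trans (le_usc_env V'01 Dx) uV.
exact: le_trans Vl (lsc_env_le V'01 Dx).
Qed.

End ContinuousSolution.

(** The cost enters as - h (1 - w), nonincreasing in h when w <= 1. *)
Lemma supersolution_mono (R : realType) (n m : nat)
    (f : 'rV[R]_n -> 'rV[R]_m -> 'rV[R]_n) (h h' : 'rV[R]_n -> 'rV[R]_m -> R)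
    (A : set 'rV[R]_m) (O : set 'rV[R]_n) (w : 'rV[R]_n -> R) :
  (forall x, O x -> w x <= 1) -> (forall x a, A a -> h x a <= h' x a) ->
  viscosity_supersolution (hamiltonian f h' A) O w ->
  viscosity_supersolution (hamiltonian f h A) O w.
Proof.
move=> w1 hh ws phi x phiC Ox hm; apply: le_trans (ws phi x phiC Ox hm) _.
apply: ge_ereal_sup => _ [a Aa <-].
apply: (@le_trans _ _ (- dotp (grad phi x) (f x a) - h x a + h x a * w x)%:E).
  rewrite lee_fin; have := ler_wpM2r (_ : 0 <= 1 - w x) (hh x a Aa).
  by rewrite subr_ge0 => /(_ (w1 x Ox)); lra.
by apply: ereal_sup_ubound; exists a.
Qed.

(** Dini's argument on the compact part of D in a unit ball: an estimate at one e0 spreads to a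
    neighbourhood by continuity and to all smaller e by monotonicity. *)
Lemma dini (R : realType) (n : nat) (D : set 'rV[R]_n) (We : R -> 'rV[R]_n -> R)
    (W : 'rV[R]_n -> R) (x : 'rV[R]_n) :
  closed D -> {within D, continuous W} ->
  (forall e, 0 < e <= 1 -> {within D, continuous (We e)}) ->
  (forall e, 0 < e <= 1 -> forall y, D y -> W y <= We e y) ->
  (forall e e', 0 < e -> e <= e' -> e' <= 1 -> forall y, D y -> We e y <= We e' y) ->
  (forall y s, D y -> 0 < s -> exists2 e, 0 < e <= 1 & We e y < W y + s) ->
  exists2 N, nbhs x N & {uniform N `&` D, We e @[e --> 0^'+] --> W}.
Proof.
move=> Dcl Wc Wec WW Wm Wlim.
exists [set y | enorm (y - x) <= 1].
  by apply/nbhs_enormP; exists 1 => // y /ltW.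
pose K := [set y | enorm (y - x) <= 1] `&` D.
have Kc : compact K.
  apply: (@enorm_bounded_closed_compact _ _ _ (enorm x + 1)).
    by apply: closedI => //; exact: closed_enorm_ball.
  by move=> y [/= y1 _]; have := enorm_le_dist y x; lra.
move=> P /uniform_nbhs[E [+ EP]]; rewrite -entourage_ballE => -[s /= s0 sE].
have [||r r0 hr] := @compact_uniform R n K
  (fun r y => forall e, 0 < e <= 1 -> e <= r -> We e y < W y + s) Kc.
- by move=> r t y t0 tr hr e e01 et; apply: hr => //; exact: le_trans tr.
- move=> y [_ Dy]; have s3 : 0 < s / 3 by rewrite divr_gt0.
  have [e0 e01 he0] := Wlim y _ Dy s3.
  have := Wec _ e01; move=> /within_continuous_enormP /(_ y Dy _ s3)[r1 r10 h1].
  move/within_continuous_enormP: (Wc) => /(_ y Dy _ s3)[r2 r20 h2].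
  have e00 : 0 < e0 by case/andP: e01.
  exists (Num.min e0 (Num.min r1 r2)); first by rewrite !lt_min e00 r10.
  move=> z [_ Dz]; rewrite !lt_min => /andP[_ /andP[z1 z2]] e /andP[ep e1].
  rewrite !le_min => /andP[ee0 _].
  have e0le : e0 <= 1 by case/andP: e01.
  have := Wm _ _ ep ee0 e0le z Dz.
  have := h1 z Dz z1; have := h2 z Dz z2.
  rewrite !ltr_norml => /andP[a1 a2] /andP[a3 a4] a5.
  by clear - he0 a1 a4 a5; lra.
near=> e; apply: EP => /= y Ky; apply: sE; rewrite /ball /= -/K in Ky *.
have e0 : 0 < e by near: e; exact: nbhs_right_gt.
have e1 : 0 < e <= 1 by rewrite e0; apply: ltW; near: e; exact: nbhs_right_lt.
have er : e <= r by apply: ltW; near: e; exact: nbhs_right_lt.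
have := hr y Ky e e1 er; have := WW e e1 y Ky.2; rewrite ltr_norml => a1 a2.
by apply/andP; split; clear - s0 a1 a2; lra.
Unshelve. all: by end_near. Qed.

Theorem theorem3p1 (R : realType) (n m : nat)
  (A : set 'rV[R]_m) (T : set 'rV[R]_n)
  (f : 'rV[R]_n -> 'rV[R]_m -> 'rV[R]_n)
  (l rho : 'rV[R]_n -> 'rV[R]_m -> R)
  (A_compact : compact A)
  (T_nonempty : T !=set0) (T_closed : closed T) (bdryT_compact : compact (bdry T))
  (f_cont : {within setT `*` A, continuous (fun q => f q.1 q.2)})
  (l_cont : {within setT `*` A, continuous (fun q => l q.1 q.2)})
  (rho_cont : {within setT `*` A, continuous (fun q => rho q.1 q.2)})
  (l_ge0 : forall x a, A a -> 0 <= l x a)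
  (rho_ge0 : forall x a, A a -> 0 <= rho x a)
  (f_growth : exists2 M : R, 0 < M &
     forall x a, A a -> enorm (f x a) <= M * (1 + enorm x))
  (fl_lipschitz : forall r : R, 0 < r -> exists2 L : R, 0 < L &
     forall x1 x2 a, enorm x1 <= r -> enorm x2 <= r -> A a ->
       enorm (f x1 a - f x2 a) <= L * enorm (x1 - x2) /\
       `|l x1 a - l x2 a| <= L * enorm (x1 - x2))
  (HLACL : LACL f (fun x a => l x a + rho x a) A T)
  (HSC : SC1 f A T \/ SC2 (fun x a => l x a + rho x a) A T) :
  let D := ~` interior T in
  let sol (e : R) := nonneg_solution f (fun x a => l x a + e * rho x a) A T in
  (CV f l A ->
     exists We : R -> 'rV[R]_n -> R,
       (forall e, 0 < e <= 1 -> sol e (We e) /\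
          (forall W', sol e W' -> {in D, W' =1 We e})) /\
       exists W : 'rV[R]_n -> R,
         [/\ forall x, D x -> We e x @[e --> 0^'+] --> W x,
             forall x, D x -> value f l A T x = (- lne (1 - W x)%:E)%E,
             Dom T (value f l A T) = [set x | D x /\ W x < 1]
           & {within D, continuous W} ->
             forall x, D x -> exists2 N, nbhs x N &
               {uniform N `&` D, We e @[e --> 0^'+] --> W}]) /\
  (~ CV f l A ->
     forall e, 0 < e <= 1 -> exists We : 'rV[R]_n -> R,
       [/\ sol e We, {within D, continuous We}
         & forall W', sol e W' -> {within D, continuous W'} ->
             {in D, W' =1 We}]).
Proof.
move=> D sol.
have f_lip r : 0 < r -> exists2 L, 0 < L &
    forall x1 x2 a, enorm x1 <= r -> enorm x2 <= r -> A a ->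
      enorm (f x1 a - f x2 a) <= L * enorm (x1 - x2).
  move=> /fl_lipschitz[L L0 hL]; exists L => // x1 x2 a r1 r2 Aa.
  by have [] := hL x1 x2 a r1 r2 Aa.
pose h e x a := l x a + e * rho x a.
have h_cont e : {within setT `*` A, continuous (fun q => h e q.1 q.2)}.
  move=> q; apply: cvgD; first exact: l_cont.
  by apply: cvgM; [exact: cvg_cst|exact: rho_cont].
have h_ge0 e x a : 0 <= e -> A a -> 0 <= h e x a.
  by move=> e0 Aa; apply: addr_ge0; [exact: l_ge0|apply: mulr_ge0 => //; exact: rho_ge0].
have h_mono e e' x a : e <= e' -> A a -> h e x a <= h e' x a.
  by move=> ee Aa; rewrite lerD2l; apply: ler_wpM2r => //; exact: rho_ge0.
have gGe e : 0 < e <= 1 -> exists g G, comparison_barrier f (h e) A T g G.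
  move=> /andP[e0 e1]; case: HSC => [HS|HS].
    by apply: SC1_barrier HS => x a; apply: h_ge0; exact: ltW.
  apply: (SC2_barrier HS e0 _ f_growth) => x a Aa.
  by rewrite mulrDr lerD2r ler_piMl // l_ge0.
have [Wb [Wb01 Wbc Wb0 Wbsup]] := MRF_barrier T_nonempty T_closed HLACL.
(* Stated for every real e so that [choice] gives a single family; outside ]0, 1] a filler is
   taken. *)
have hWe : forall e, exists V : 'rV[R]_n -> R, 0 < e <= 1 ->
    [/\ {within D, continuous V}, forall x, D x -> 0 <= V x <= Wb x,
        viscosity_supersolution (hamiltonian f (h e) A) (~` T) V
      & viscosity_subsolution (hamiltonian f (h e) A) (~` T) V].
  move=> e; have [e01|ne] := pselect (0 < e <= 1); last by exists (fun=> 0).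
  have [g [G gG]] := gGe e e01; case/andP: (e01) => e0 e1.
  have hes : viscosity_supersolution (hamiltonian f (h e) A) (~` T) Wb.
    apply: Wbsup => x a Aa; rewrite h_ge0 ?(ltW e0) //=.
    by rewrite lerD2l ler_piMl // rho_ge0.
  have he0 x a : A a -> 0 <= h e x a by apply: h_ge0; exact: ltW.
  have [V hV] := perron_solution A_compact T_nonempty T_closed bdryT_compact f_lip
    f_growth (h_cont e) he0 Wb01 Wbc Wb0 hes gG.
  by exists V.
have {hWe} [We hWe] := choice hWe.
have We01 e x : 0 < e <= 1 -> D x -> 0 <= We e x <= 1.
  move=> /hWe[_ q _ _] Dx; have /andP[-> q2] := q x Dx.
  by apply: le_trans q2 _; case/andP: (Wb01 x Dx).
have Web e b : 0 < e <= 1 -> bdry T b -> We e b = 0.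
  move=> /hWe[_ q _ _] bb; have := q b (bdry_D bb).
  by rewrite (Wb0 b bb) => h0; apply/eqP; rewrite eq_le andbC.
have Wesol e : 0 < e <= 1 -> sol e (We e).
  move=> e01; have [Wc _ Wsup Wsub] := hWe e e01.
  apply: (continuous_nonneg_solution T_closed Wc) => // [x Dx|b bb].
    exact: We01.
  exact: Web.
have Weuniq e W' : 0 < e <= 1 -> sol e W' -> {in D, W' =1 We e}.
  move=> e01; have [Wc _ Wsup Wsub] := hWe e e01.
  have [g [G gG]] := gGe e e01; case/andP: (e01) => e0 e1.
  have he0 x a : A a -> 0 <= h e x a by apply: h_ge0; exact: ltW.
  by apply: (nonneg_solution_unique T_nonempty T_closed Wc (fun x => @We01 e x e01)
    (fun b => @Web e b e01) Wsup Wsub A_compact bdryT_compact f_lip (h_cont e) he0 gG).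
split; last first.
  move=> _ e e01; exists (We e); split; first exact: Wesol.
    by have [] := hWe e e01.
  by move=> W' sW' _; exact: Weuniq.
move=> _; exists We; split.
  by move=> e e01; split; [exact: Wesol|move=> W'; exact: Weuniq].
(* W_e' is also a supersolution for the smaller cost h_e, so comparison orders the two. *)
have Wm e e' : 0 < e -> e <= e' -> e' <= 1 -> forall x, D x -> We e x <= We e' x.
  move=> e0 ee e'1 x Dx; have e01 : 0 < e <= 1 by rewrite e0 (le_trans ee).
  have e'01 : 0 < e' <= 1 by rewrite (lt_le_trans e0).
  have [Wc _ Wsup Wsub] := hWe e e01; have [Wc' _ Wsup' _] := hWe e' e'01.
  have [g [G gG]] := gGe e e01.
  have he0 y a : A a -> 0 <= h e y a by apply: h_ge0; exact: ltW.
  apply: (comparison A_compact T_nonempty T_closed bdryT_compact f_lip (h_cont e) he0 gG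
    (continuous_usc Wc) (continuous_lsc Wc')) => //.
  - by move=> y /(We01 e y e01)/andP[].
  - by move=> y /(We01 e' y e'01)/andP[].
  - by move=> b /(Web e b e01) ->.
  apply: supersolution_mono Wsup' => [y Ty|y a]; last exact: h_mono.
  by case/andP: (We01 e' y e'01 (not_T_D Ty)).
pose S x := [set We e x | e in [set e | 0 < e <= 1]].
(* By monotonicity in e the infimum is the limit as e tends to 0. *)
pose W x := inf (S x).
have S1 x : S x (We 1 x) by exists 1 => //=; rewrite ltr01 lexx.
have hS x : D x -> has_inf (S x).
  move=> Dx; split; first by exists (We 1 x).
  by exists 0 => _ [e e01 <-]; case/andP: (We01 e x e01 Dx).
have WW e : 0 < e <= 1 -> forall x, D x -> W x <= We e x.
  by move=> e01 x Dx; apply: ge_inf; [case: (hS x Dx)|exists e].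
have W0 x : D x -> 0 <= W x.
  move=> Dx; apply: lb_le_inf; first by exists (We 1 x).
  by move=> _ [e e01 <-]; case/andP: (We01 e x e01 Dx).
have i01 : (0 < (1 : R)) && ((1 : R) <= 1) by rewrite ltr01 lexx.
have W1 x : D x -> W x <= 1.
  by move=> Dx; apply: le_trans (WW 1 i01 x Dx) _; case/andP: (We01 1 x i01 Dx).
have Wlim x s : D x -> 0 < s -> exists2 e, 0 < e <= 1 & We e x < W x + s.
  by move=> Dx s0; have [_ [e e01 <-] he] := inf_adherent s0 (hS x Dx); exists e.
have valW x : D x -> value f l A T x = (- lne (1 - W x)%:E)%E.
  move=> Dx; case: (D_cases Dx) => [Tx|bx]; last first.
    rewrite /value ifT; last by rewrite inE; exact: bdry_T.
    have -> : W x = 0.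
      apply/eqP; rewrite eq_le W0 // andbT -(Web 1 x i01 bx).
      exact: WW.
    by rewrite subr0 lne1 oppe0.
  apply/eqP; rewrite eq_le; apply/andP; split; last first.
    rewrite /value ifF; last by apply/negP; rewrite inE.
    apply: le_ereal_inf_tmp => _ [alpha [y [ca ty ap ->]]].
    apply: (cost_ge A_compact T_nonempty T_closed bdryT_compact f_cont f_lip f_growth
      l_cont rho_cont h_cont l_ge0 rho_ge0 Wbc Wb0 _ Tx ca ty ap) => e e01.
    have [Wc Wle _ Wsub] := hWe e e01.
    exists (We e); split => //; last exact: WW.
    by move=> z Dz; rewrite We01 //; case/andP: (Wle z Dz).
  (* If W x = 1 the right side is [+oo], and the upper bound is trivial. *)
  have [q0|q0] := leP (1 - W x) 0.
    have -> : 1 - W x = 0 by apply/eqP; rewrite eq_le q0 subr_ge0 W1.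
    by rewrite le0_lneNy //= leey.
  rewrite lne_EFin // -EFinN; apply/lee_addgt0Pr => s s0; rewrite -EFinD.
  have sE : expR (- s) < 1 by rewrite expR_lt1 oppr_lt0.
  (* - ln q exceeds - ln(1 - W x) by s. With e small enough that 1 - W_e x > q, the tolerance 1 -
     W_e x - q in [value_le] bounds the value by - ln q. *)
  pose q := (1 - W x) * expR (- s).
  have q1 : q < 1 - W x by rewrite gtr_pMr.
  have qp : 0 < q by rewrite mulr_gt0 // expR_gt0.
  have [e e01 he] := Wlim x (1 - W x - q) Dx (ltac:(by rewrite subr_gt0)).
  have [M M0 fM] := f_growth; have [Wc Wle Wsup _] := hWe e e01.
  have [g [G gG]] := gGe e e01.
  have A0 := LACL_control T_nonempty T_closed HLACL Tx.
  have lh y a : A a -> l y a <= h e y a.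
    move=> Aa; rewrite lerDl; apply: mulr_ge0; last exact: rho_ge0.
    by case/andP: e01 => /ltW.
  have d0 : 0 < 1 - We e x - q by clear - he; lra.
  have d1 : 1 - We e x - q < 1 - We e x by rewrite gtrBl.
  have := value_le A_compact A0 T_nonempty T_closed f_cont f_lip M0 fM (h_cont e)
    l_cont l_ge0 lh Wc (fun y => We01 e y e01) Wsup gG Tx d0 d1.
  have -> : 1 - We e x - (1 - We e x - q) = q by ring.
  by rewrite /q lnM ?posrE ?expR_gt0 // expRK opprB [s - _]addrC.
exists W; split => //.
- move=> x Dx; apply/cvgrPdist_lt => s s0.
  have [e0 /andP[e00 e01] he] := Wlim x s Dx s0.
  near=> e; have ep : 0 < e by near: e; exact: nbhs_right_gt.
  have ee0 : e <= e0 by apply: ltW; near: e; exact: nbhs_right_lt.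
  have := Wm e e0 ep ee0 e01 x Dx.
  have := WW e (ltac:(by rewrite ep (le_trans ee0))) x Dx.
  rewrite distrC => a1 a2; rewrite ger0_norm ?subr_ge0 //.
  by clear - a1 a2 he; lra.
- rewrite /Dom; apply/seteqP; split => x /= [Dx vx]; split=> //; last rewrite valW //.
    rewrite (valW x Dx) in vx.
    rewrite ltNge; apply/negP => Wx; move: vx.
    have -> : 1 - W x = 0 by apply/eqP; rewrite eq_le subr_le0 Wx subr_ge0 W1.
    by rewrite le0_lneNy //= ltxx.
  by rewrite lne_EFin ?subr_gt0 // -EFinN ltry.
- move=> Wc x Dx.
  apply: (dini x (D_closed (T := T)) Wc) => // e e01.
    by have [] := hWe e e01.
Unshelve. all: by end_near. Qed.
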